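(* The problem of counting Eulerian tours in general Eulerian graphs is polynomial-time Turing reducible to the problem of counting Eulerian tours in 4-regular graphs. That is, there is a polynomial-time algorithm with access to an oracle that returns the number of Eulerian tours of any given 4-regular graph, which on input an arbitrary Eulerian graph $G$ outputs the number of Eulerian tours of $G$.
   Context: Graphs are finite and undirected; parallel edges and loops are allowed. An Eulerian graph is a connected graph all of whose vertices have even degree. A graph is 4-regular if every vertex has degree 4 (a loop contributes 2). An Eulerian tour is a closed trail that travels each edge exactly once; tours are counted up to the choice of starting point and direction, i.e. an Eulerian tour is identified with the choice, at every vertex, of a perfect matching (''pairing'') of the edge-ends at that vertex such that following these pairings gives a single closed trail through all edges. *)

(* Defs.v *)
From mathcomp Require Import all_boot.

Set Implicit Arguments.
Unset Strict Implicit.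
Unset Printing Implicit Defensive.

(** * Multigraphs and Eulerian tours *)

(* Edge number i of G joins the two components of the i-th entry of [edges G].
   Repeated entries are parallel edges and an entry (v, v) is a loop; the order
   of the two components only serves to name the two ends of the edge. *)
Record multigraph := Multigraph {
  nvert : nat;
  edges : seq ('I_nvert * 'I_nvert)
}.

Definition edge (G : multigraph) : finType := 'I_(size (edges G)).

(* (i, b) is one of the two ends of edge i; a loop also has two ends. *)
Definition edge_end (G : multigraph) : finType := (edge G * bool)%type.

Definition vertex_of (G : multigraph) (x : edge_end G) : 'I_(nvert G) :=
  let uv := tnth (in_tuple (edges G)) x.1 in if x.2 then uv.2 else uv.1.

Definition opposite (G : multigraph) (x : edge_end G) : edge_end G :=
  (x.1, ~~ x.2).

Definition degree (G : multigraph) (v : 'I_(nvert G)) : nat :=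
  #|[set x : edge_end G | vertex_of x == v]|.

Definition adjacent (G : multigraph) : rel 'I_(nvert G) :=
  fun u v => [exists x : edge_end G,
                (vertex_of x == u) && (vertex_of (opposite x) == v)].

Definition connected (G : multigraph) : bool :=
  [forall u, forall v, connect (@adjacent G) u v].

Definition eulerian (G : multigraph) : bool :=
  connected G && [forall v : 'I_(nvert G), ~~ odd (degree v)].

Definition four_regular (G : multigraph) : bool :=
  [forall v : 'I_(nvert G), degree v == 4].

(* A perfect matching of the edge-ends at every vertex, given as the map that
   sends each edge-end to its partner. *)
Definition is_pairing (G : multigraph)
    (p : {ffun edge_end G -> edge_end G}) : bool :=
  [forall x, [&& p (p x) == x, p x != x & vertex_of (p x) == vertex_of x]].

(* Traverse the edge of x from x to its opposite end, then leave the vertex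
   reached through the partner of that end. *)
Definition follow (G : multigraph) (p : {ffun edge_end G -> edge_end G})
    (x : edge_end G) : edge_end G :=
  p (opposite x).

(* For a pairing p, a trail obtained by [follow] is closed and never uses an
   edge twice, so the second condition says that there is only one such trail.
   A graph without edges has exactly one tour, the empty one. *)
Definition is_eulerian_tour (G : multigraph)
    (p : {ffun edge_end G -> edge_end G}) : bool :=
  is_pairing p &&
  [forall x : edge_end G, forall e : edge G,
     exists b : bool, fconnect (follow p) x (e, b)].

Definition num_eulerian_tours (G : multigraph) : nat :=
  #|[set p : {ffun edge_end G -> edge_end G} | is_eulerian_tour p]|.

(** * Random access machines with an oracle, logarithmic cost *)

(* Programs work on finitely many named arrays (the names occurring in the
   program) of natural numbers of arbitrary size; scalars are array cells.
   Each operation is charged the bit length of the numbers it handles, so that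
   this is the usual logarithmic-cost RAM with instructions ADD, SUB, MULT and
   DIV, in structured form. *)

Definition bitlen (n : nat) : nat := (trunc_log 2 n).+1.

Definition word := seq nat.

Definition wordlen (w : word) : nat := sumn [seq bitlen n | n <- w].

Inductive binop := Add | Sub | Mul | Div.

(* Truncated subtraction; division rounds down and n / 0 = 0. *)
Definition binop_sem (o : binop) (m n : nat) : nat :=
  match o with
  | Add => m + n
  | Sub => m - n
  | Mul => m * n
  | Div => m %/ n
  end.

Inductive expr :=
| Const of nat
| Get of nat & expr                     (* a[e] *)
| Op of binop & expr & expr.

Inductive cmd :=
| Skip
| Set_ of nat & expr & expr             (* a[e1] := e2 *)
| Seq of cmd & cmd
| If of expr & cmd & cmd                (* nonzero means true *)
| While of expr & cmd
| Ask of nat & expr & nat & expr.       (* b[e2] := oracle (a[0..e1-1]) *)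

Definition store := nat -> nat -> nat.

Definition update (s : store) (a i n : nat) : store :=
  fun b j => if (b == a) && (j == i) then n else s b j.

Fixpoint eval (s : store) (e : expr) : nat :=
  match e with
  | Const n => n
  | Get a e1 => s a (eval s e1)
  | Op o e1 e2 => binop_sem o (eval s e1) (eval s e2)
  end.

Fixpoint eval_cost (s : store) (e : expr) : nat :=
  bitlen (eval s e) +
  match e with
  | Const _ => 0
  | Get _ e1 => eval_cost s e1
  | Op _ e1 e2 => eval_cost s e1 + eval_cost s e2
  end.

Definition segment (s : store) (a n : nat) : word := mkseq (s a) n.

(* [exec O c s t s']: with oracle O, program c started in s halts in s' after
   time t. *)
Inductive exec (O : word -> nat) : cmd -> store -> nat -> store -> Prop :=
| exec_skip s : exec O Skip s 1 s
| exec_set s a e1 e2 :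
    exec O (Set_ a e1 e2) s (eval_cost s e1 + eval_cost s e2)
         (update s a (eval s e1) (eval s e2))
| exec_seq c1 c2 s t1 s1 t2 s2 :
    exec O c1 s t1 s1 -> exec O c2 s1 t2 s2 ->
    exec O (Seq c1 c2) s (t1 + t2) s2
| exec_if s e c1 c2 t s' :
    exec O (if eval s e != 0 then c1 else c2) s t s' ->
    exec O (If e c1 c2) s (eval_cost s e + t) s'
| exec_while_end s e c :
    eval s e = 0 -> exec O (While e c) s (eval_cost s e) s
| exec_while_loop s e c t1 s1 t2 s2 :
    eval s e != 0 -> exec O c s t1 s1 -> exec O (While e c) s1 t2 s2 ->
    exec O (While e c) s (eval_cost s e + t1 + t2) s2
| exec_ask s a e1 b e2 :
    let w := segment s a (eval s e1) in
    exec O (Ask a e1 b e2) s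
         (eval_cost s e1 + eval_cost s e2 + wordlen w + bitlen (O w))
         (update s b (eval s e2) (O w)).

(* A program has at most one run from a given store, so that "there is a
   halting run" below speaks about the run of the program. *)
Lemma exec_det (O : word -> nat) (c : cmd) (s : store) (t1 t2 : nat)
    (s1 s2 : store) :
  exec O c s t1 s1 -> exec O c s t2 s2 -> t1 = t2 /\ s1 = s2.
Proof.
move=> H; elim: H t2 s2 => {c s t1 s1}.
- by move=> s u v H; inversion H.
- by move=> s a e1 e2 u v H; inversion H.
- move=> c1 c2 s t s1 t' s2 _ IH1 _ IH2 u v H.
  inversion H as [| |? ? ? ? ? ? ? E1 E2| | | |]; subst.
  by have [? ?] := IH1 _ _ E1; subst; have [? ?] := IH2 _ _ E2; subst.
- move=> s e c1 c2 t s' _ IH u v H.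
  inversion H as [| | |? ? ? ? ? ? E| | |]; subst.
  by have [? ?] := IH _ _ E; subst.
- move=> s e c e0 u v H.
  inversion H as [| | | |? ? ? E|? ? ? ? ? ? ? E|]; subst => //.
  by rewrite e0 in E.
- move=> s e c t s1 t' s2 en0 _ IH1 _ IH2 u v H.
  inversion H as [| | | |? ? ? E|? ? ? ? ? ? ? E E1 E2|]; subst.
    by rewrite E in en0.
  by have [? ?] := IH1 _ _ E1; subst; have [? ?] := IH2 _ _ E2; subst.
- by move=> s a e1 b e2 w u v H; inversion H.
Qed.

(* The input word is in array 0 and its number of entries in cell 0 of array 1;
   all other cells are 0. *)
Definition init_store (w : word) : store :=
  fun a i => match a with
             | 0 => nth 0 w i
             | 1 => if i == 0 then size w else 0
             | _ => 0
             end.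

Definition output (s : store) : nat := s 0 0.

(** * Polynomial-time Turing reductions between counting problems *)

(* [count] only matters on the instances satisfying [promise]. *)
Record counting_problem := CountingProblem {
  instance : Type;
  encode : instance -> word;
  promise : instance -> bool;
  count : instance -> nat
}.

(* Nothing is assumed on the answers to queries that do not encode an instance
   of Q. *)
Definition oracle_for (Q : counting_problem) (O : word -> nat) : Prop :=
  forall y : instance Q, promise y -> O (encode y) = count y.

Definition poly_time_turing_reducible (P Q : counting_problem) : Prop :=
  exists (c : cmd) (C k : nat),
    forall O : word -> nat, oracle_for Q O ->
    forall x : instance P, promise x ->
    exists (t : nat) (s : store),
      [/\ exec O c (init_store (encode x)) t s,
          output s = count x
        & t <= C * wordlen (encode x) ^ k + C].

(* The number of vertices followed by the list of edges, vertices being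
   numbered from 0. *)
Definition encode_graph (G : multigraph) : word :=
  nvert G :: flatten [seq [:: val uv.1; val uv.2] | uv <- edges G].

Definition count_tours_eulerian : counting_problem :=
  CountingProblem encode_graph eulerian num_eulerian_tours.

Definition count_tours_four_regular : counting_problem :=
  CountingProblem encode_graph four_regular num_eulerian_tours.

(* Main.v *)
Require Import Defs.
From mathcomp Require Import all_boot.
From mathcomp Require Import ssralg ssrint boolp zify.

(** A vertex of degree 2d is replaced by a network of 4-valent nodes.  Call the
    three pairings at a node parallel, cross and turn.  In a chain of t 4-valent
    vertices, joined by double edges, two turns enclose a closed trail, so the
    chain acts as one node with weights (1, 1, t) up to the factor 2^(t-1).
    Hence, after division by a power of 2, the number of tours of the network
    with all M nodes expanded to chains of length t is a polynomial P(t) of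
    degree at most M, and P(0) is extrapolated from the oracle's answers for
    t = 1, .., M+1.

    At t = 0 nodes only have two states, so m of them in series (with parallel
    and turn as the states) form a switch with weights (1, m, 0): again two
    turns enclose a closed trail.  The switches insert a strand at random: the
    end x of a strand meets the other ends at the vertex one after the other and
    is passed on with weight m if m further ends follow, and otherwise linked to
    the current one.  This makes all partners of x equally likely, and iterating
    it makes all pairings at the vertex equally likely, so P(0) is an explicit
    multiple of the number of tours of the given graph.  An additional node on
    every edge makes sure that no edge of the network lacks an end vertex. *)

Set Implicit Arguments.
Unset Strict Implicit.
Unset Printing Implicit Defensive.

(** * Connectedness of a set of links *)

Section Connected.
Context {T : eqType}.
Implicit Types (l : seq (T * T)) (S : T -> bool) (x y a b : T).

(** Chains only realize weights t >= 1, so the value at 0, where the cross or the turn of a node can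
    be suppressed, lies outside the oracle's reach; hence the extrapolation. It stays within the
    integers: the difference of order M+1 of P vanishes, so P(0) is, up to sign, the alternating sum
    of the P(j) weighted by the binomial coefficients of M+1 over j. A weight m costs m nodes.
    Inserting one strand among n+1 other ends takes columns of n, n-1, .., 1 nodes, contributes the
    factor n! and leaves n ends to be paired, so the network has polynomial size although its
    multiplier is large. To avoid surgery on multigraphs, a configuration is a bare list of links
    between points, counted when no closed set of points separates it. Contracting a point that lies
    on two links preserves this, and gadget identities hold in every context that avoids their
    interior. Multigraphs occur only as input and as queries. *)

Fixpoint pts l : seq T := if l is p :: l' then [:: p.1, p.2 & pts l'] else [::].

Definition invariant_set S l : bool := all (fun p => S p.1 == S p.2) l.

(* No set of points that is closed under the links separates two points. *)
Definition conn l : bool :=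
  `[< forall S, invariant_set S l -> {in pts l &, forall x y, S x = S y} >].

Lemma connP l :
  reflect (forall S, invariant_set S l -> {in pts l &, forall x y, S x = S y})
    (conn l).
Proof. exact: asboolP. Qed.

Lemma pts_cat l1 l2 : pts (l1 ++ l2) = pts l1 ++ pts l2.
Proof. by elim: l1 => //= p l1 ->. Qed.

Lemma ptsE l : pts l = flatten [seq [:: p.1; p.2] | p <- l].
Proof. by elim: l => //= p l ->. Qed.

Lemma ptsP x l : reflect (exists2 p, p \in l & x \in [:: p.1; p.2]) (x \in pts l).
Proof. by rewrite ptsE; apply: flatten_mapP. Qed.

Lemma pts_cons p l : pts (p :: l) = p.1 :: p.2 :: pts l.
Proof. by []. Qed.

Lemma mem_pts p l : p \in l -> (p.1 \in pts l) && (p.2 \in pts l).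
Proof.
by move=> pl; apply/andP; split; apply/ptsP; exists p => //;
  rewrite !inE eqxx ?orbT.
Qed.

Lemma eq_conn l l' :
  (forall S, invariant_set S l = invariant_set S l') -> pts l =i pts l' ->
  conn l = conn l'.
Proof.
move=> einv epts; apply/connP/connP => H S iS x y xl yl.
  by apply: (H S); rewrite ?einv ?epts.
by apply: (H S); rewrite -?einv -?epts.
Qed.

Lemma conn_perm l l' : perm_eq l l' -> conn l = conn l'.
Proof.
move=> pll'; apply: eq_conn => [S|x]; first exact: perm_all.
by rewrite !ptsE; apply: perm_mem; apply: perm_flatten; apply: perm_map.
Qed.

Lemma conn_swap a b l : conn ((a, b) :: l) = conn ((b, a) :: l).
Proof.
apply: eq_conn => [S|x]; first by rewrite /= eq_sym.
by rewrite !pts_cons !inE orbCA.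
Qed.

(** A point on exactly two links only subdivides: a closed set extends to [x] by its value at [a].
    The inequalities prevent a loop at [x] from being contracted away. *)
Lemma conn_contract x a b l : x != a -> x != b -> x \notin pts l ->
  conn ((a, x) :: (x, b) :: l) = conn ((a, b) :: l).
Proof.
move=> xa xb xl; apply/connP/connP => H S.
- move=> iS; pose S' z := if z == x then S a else S z.
  have eS' z : z \in a :: b :: pts l -> S' z = S z.
    rewrite /S' !inE; case: (z =P x) => // ->.
    by rewrite (negPf xa) (negPf xb) (negPf xl).
  have iS' : invariant_set S' ((a, x) :: (x, b) :: l).
    move: iS; rewrite /invariant_set /= => /andP [/eqP Sab iS].
    rewrite [S' a]eS' ?[S' b]eS' ?inE ?eqxx ?orbT // -Sab {1 2}/S' eqxx eqxx /=.
    apply/allP => p pl; have /= /eqP E := allP iS p pl.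
    have /andP [p1 p2] := mem_pts pl.
    by rewrite !eS' ?inE ?p1 ?p2 ?orbT // E.
  move=> u v ul vl; rewrite -(eS' u) // -(eS' v) //.
  by apply: H => //; rewrite !pts_cons /= !inE;
    [move: ul | move: vl]; rewrite !inE => /orP [->|/orP [->|->]]; rewrite ?orbT.
- rewrite /invariant_set /= => /and3P [/eqP Sax /eqP Sxb iS].
  have E : {in pts ((a, b) :: l) &, forall x y, S x = S y}.
    by apply: H; rewrite /invariant_set /= Sax Sxb eqxx.
  have sub z : z \in pts ((a, x) :: (x, b) :: l) -> S z = S a.
    rewrite !pts_cons /= !inE; case: (z =P x) => [-> _|_]; first by [].
    by move=> Hz; apply: E; rewrite !pts_cons !inE ?eqxx //;
       case/or3P: Hz => ->; rewrite ?orbT.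
  by move=> u v ul vl; rewrite !sub.
Qed.

(* This kills the configurations in which a closed trail misses some edge. *)
Lemma conn_dead l l' : l != [::] -> l' != [::] ->
  {in pts l, forall x, x \notin pts l'} -> conn (l ++ l') = false.
Proof.
move=> l0 l'0 dis; apply/negP => /connP H.
have iS : invariant_set (mem (pts l)) (l ++ l').
  rewrite /invariant_set all_cat; apply/andP; split; apply/allP => p pl /=;
    have /andP [p1 p2] := mem_pts pl.
    by rewrite p1 p2.
  have N z : z \in pts l' -> (z \in pts l) = false.
    by move=> zl'; apply/negP => /dis; rewrite zl'.
  by rewrite !N.
case: l l0 dis H iS => [//|p l] _ dis H iS.
case: l' l'0 dis H iS => [//|q l'] _ dis H iS.
have q1 : q.1 \in pts (q :: l') by rewrite pts_cons mem_head.
have p1 : p.1 \in pts (p :: l) by rewrite pts_cons mem_head.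
have /= E : (p.1 \in pts (p :: l)) = (q.1 \in pts (p :: l)).
  by apply: (H _ iS); rewrite pts_cat mem_cat ?p1 ?q1 ?orbT.
by move: (dis q.1); rewrite -E p1 q1 => /(_ isT).
Qed.

End Connected.

Lemma conn_map (T T' : eqType) (f : T -> T') (l : seq (T * T)) :
  injective f -> conn [seq (f p.1, f p.2) | p <- l] = conn l.
Proof.
move=> finj.
have ptsm : pts [seq (f p.1, f p.2) | p <- l] = map f (pts l).
  by elim: l => //= p l ->.
apply/connP/connP => H S iS.
- pose S' z := has (fun x => (f x == z) && S x) (pts l).
  have eS' x : x \in pts l -> S' (f x) = S x.
    move=> xl; apply/hasP/idP => [[y yl /andP [/eqP /finj -> //]]|Sx].
    by exists x; rewrite ?eqxx.
  move=> x y xl yl; rewrite -!eS' //; apply: H; rewrite ?ptsm ?map_f //.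
  rewrite /invariant_set all_map; apply/allP => p pl /=.
  have /andP [p1 p2] := mem_pts pl.
  by rewrite !eS' //; apply: (allP iS).
- rewrite ptsm => _ _ /mapP [x xl ->] /mapP [y yl ->].
  apply: (H (S \o f)) => //.
  by move: iS; rewrite /invariant_set all_map.
Qed.

(** * Counting connected configurations *)

Section Tours.
Context {T : eqType}.
Implicit Types (l E L : seq (T * T)) (o : seq (seq (T * T)))
  (vs : seq (seq (seq (T * T)))) (s : seq T) (x y : T).

(* [vs] lists the admissible local states of every vertex, each given by the
   pairs it links; repeating a state is how an integer weight is expressed.
   [E] is the list of links common to all configurations. *)
Fixpoint tours vs E : nat :=
  if vs is o :: vs' then \sum_(l <- o) tours vs' (l ++ E) else conn E.

Lemma eq_tours vs E E' :
  (forall F, conn (F ++ E) = conn (F ++ E')) -> tours vs E = tours vs E'.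
Proof.
elim: vs E E' => [|o vs IH] E E' H /=; first by have /= -> := H [::].
by apply: eq_bigr => l _; apply: IH => F; rewrite !(catA F) H.
Qed.

Lemma tours_permE vs E E' : perm_eq E E' -> tours vs E = tours vs E'.
Proof. by move=> p; apply: eq_tours => F; apply: conn_perm; rewrite perm_cat2l. Qed.

Lemma tours_swapE vs a b E :
  tours vs ((a, b) :: E) = tours vs ((b, a) :: E).
Proof.
apply: eq_tours => F.
have pF p : perm_eq (F ++ p :: E) (p :: F ++ E) by rewrite -cat1s perm_catCA.
by rewrite (conn_perm (pF _)) conn_swap (conn_perm (pF _)).
Qed.

Lemma tours_mid vs1 o vs2 E : tours (vs1 ++ o :: vs2) E = tours (o :: vs1 ++ vs2) E.
Proof.
elim: vs1 E => [//|o1 vs1 IH] E /=.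
under eq_bigr => l _ do rewrite IH /=.
rewrite exchange_big /=; apply: eq_bigr => l _; apply: eq_bigr => l' _.
by apply: tours_permE; rewrite perm_catCA.
Qed.

Lemma tours_perm vs vs' E : perm_eq vs vs' -> tours vs E = tours vs' E.
Proof.
elim: vs vs' E => [|o vs IH] vs' E p.
  by have /esym/size0nil -> := perm_size p.
have ovs' : o \in vs' by rewrite -(perm_mem p) mem_head.
case/splitPr: ovs' p => v1 v2 p; rewrite tours_mid /=.
apply: eq_bigr => l _; apply: IH.
by rewrite -(perm_cons o) (permPl p) -cat1s perm_catCA.
Qed.


Definition options_in (P : pred T) vs : bool :=
  all (all (fun l => all P (pts l))) vs.

Lemma options_in_cat P vs1 vs2 :
  options_in P (vs1 ++ vs2) = options_in P vs1 && options_in P vs2.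
Proof. exact: all_cat. Qed.

Lemma sub_options_in (P Q : pred T) vs :
  subpred P Q -> options_in P vs -> options_in Q vs.
Proof. by move=> PQ; apply: sub_all => o; apply: sub_all => l; apply: sub_all. Qed.

(** Locality, with [X] the interior of a gadget. As the hypothesis ranges over every context [L]
    that avoids [X], each choice made at an outside vertex is merely absorbed into [L]. Gadget
    identities enter the network through this lemma. *)
Lemma tours_local (X : pred T) c vs1 E1 vs2 E2 vs E :
  (forall L, all (predC X) (pts L) ->
     tours vs1 (E1 ++ L) = c * tours vs2 (E2 ++ L)) ->
  options_in (predC X) vs -> all (predC X) (pts E) ->
  tours (vs1 ++ vs) (E1 ++ E) = c * tours (vs2 ++ vs) (E2 ++ E).
Proof.
move=> H avs aE.
rewrite (tours_perm _ (permEl (perm_catC vs1 vs)))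
  (tours_perm _ (permEl (perm_catC vs2 vs))).
elim: vs E avs aE => [|o vs IH] E /= avs aE; first exact: H.
case/andP: avs => ao avs.
rewrite big_distrr /= !big_seq; apply: eq_bigr => l lo.
rewrite (tours_permE _ (permEl (perm_catCA l E1 E))) IH //.
  by rewrite (tours_permE _ (permEl (perm_catCA E2 l E))).
by rewrite pts_cat all_cat (allP ao).
Qed.

(** The fuel [n] is there because [rem y s'] is not a subterm of the list. *)
Fixpoint pairings_rec n s : seq (seq (T * T)) :=
  match n, s with
  | n'.+1, x :: s' =>
      flatten [seq [seq (x, y) :: p | p <- pairings_rec n' (rem y s')] | y <- s']
  | _, _ => [:: [::]]
  end.

Definition pairings s := pairings_rec (size s) s.

Lemma pairings_recE n s : size s <= n -> pairings_rec n s = pairings s.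
Proof.
rewrite /pairings.
elim: n {-2}n (leqnn n) s => [|m IH] n nm s sn.
  by move: sn nm; case: n => //; case: s.
case: n sn nm => [|n]; first by case: s.
case: s => [//|x s] /= sn nm; congr flatten; apply/eq_in_map => y ys.
have sr : size (rem y s) <= (size s).-1 by rewrite size_rem.
rewrite !IH //; lia.
Qed.

Lemma pairings_cons x s :
  pairings (x :: s) =
  flatten [seq [seq (x, y) :: p | p <- pairings (rem y s)] | y <- s].
Proof.
rewrite {1}/pairings /=; congr flatten; apply/eq_in_map => y ys.
by rewrite pairings_recE // size_rem // leq_pred.
Qed.

Lemma big_pairings_cons x s (F : seq (T * T) -> nat) :
  \sum_(p <- pairings (x :: s)) F p =
  \sum_(y <- s) \sum_(p <- pairings (rem y s)) F ((x, y) :: p).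
Proof.
rewrite pairings_cons big_flatten /= big_map; apply: eq_bigr => y _.
by rewrite big_map.
Qed.

Lemma perm_rem x s s' :
  perm_eq s s' -> x \in s -> perm_eq (rem x s) (rem x s').
Proof.
move=> p xs; rewrite -(perm_cons x) -(permPl (perm_to_rem xs)) (permPl p).
by apply: perm_to_rem; rewrite -(perm_mem p).
Qed.

(** Pairings of permuted lists agree only up to the order and the orientation of their links, so
    sums over them are compared for functions blind to both. *)
Definition link_invariant (F : seq (T * T) -> nat) :=
  (forall l l', perm_eq l l' -> F l = F l') /\
  (forall a b l, F ((a, b) :: l) = F ((b, a) :: l)).

Lemma link_invariant_cons F p :
  link_invariant F -> link_invariant (fun l => F (p :: l)).
Proof.
case=> FP FS; split=> [l l' pl|a b l]; first by apply: FP; rewrite perm_cons.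
have sw (q r : T * T) l' : perm_eq (q :: r :: l') (r :: q :: l').
  by rewrite -cat1s -(cat1s r) perm_catCA.
by rewrite (FP _ _ (sw _ _ _)) FS; apply: FP; apply: sw.
Qed.

Lemma link_invariant_tours vs E : link_invariant (fun l => tours vs (l ++ E)).
Proof.
split=> [l l' p|a b l]; first by apply: tours_permE; rewrite perm_cat2r.
exact: tours_swapE.
Qed.

Lemma perm_big_pairings s s' (F : seq (T * T) -> nat) :
  link_invariant F -> uniq s -> perm_eq s s' ->
  \sum_(p <- pairings s) F p = \sum_(p <- pairings s') F p.
Proof.
elim: {s}(size s) {-2}s (leqnn (size s)) s' F => [|n IH] s sn s' F FI us.
  case: s sn us => // _ _ p; by have /esym/size0nil -> := perm_size p.
have step1 x t t' : size t <= n -> uniq t -> perm_eq t t' ->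
    \sum_(p <- pairings (x :: t)) F p = \sum_(p <- pairings (x :: t')) F p.
  move=> tn ut p; rewrite !big_pairings_cons (perm_big _ p) /= !big_seq.
  apply: eq_bigr => y yt'; have yt : y \in t by rewrite (perm_mem p).
  apply: IH; last exact: perm_rem.
  - by rewrite size_rem //; lia.
  - exact: link_invariant_cons.
  - exact: rem_uniq.
(* Swapping the first two elements: the terms that pair [x] with [y] agree by reorientation; the
   others form a double sum over the two partners, and the summations are exchanged. *)
have step2 x y t : uniq (x :: y :: t) ->
    \sum_(p <- pairings (x :: y :: t)) F p =
    \sum_(p <- pairings (y :: x :: t)) F p.
  rewrite /= inE negb_or => /and3P [/andP [xy xt] yt ut].
  rewrite !big_pairings_cons !big_cons /= !eqxx; congr (_ + _).
    by apply: eq_bigr => l _; case: FI => _ ->.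
  have E z w : z \notin t -> \sum_(y0 <- t)
      \sum_(p <- pairings (if z == y0 then t else z :: rem y0 t))
        F ((w, y0) :: p) =
      \sum_(y0 <- t) \sum_(y1 <- t | y1 != y0)
        \sum_(p <- pairings (rem y1 (rem y0 t))) F ((w, y0) :: (z, y1) :: p).
    move=> zt; rewrite !big_seq; apply: eq_bigr => u ut'.
    rewrite (negPf (_ : z != u)); last by apply: contraNneq zt => ->.
    rewrite big_pairings_cons rem_filter // big_filter.
    by apply: eq_bigl => v.
  rewrite E // E //.
  rewrite (exchange_big_dep xpredT) //=; apply: eq_bigr => u _.
  rewrite [LHS](eq_bigl (fun v => v != u)) => [|v]; last by rewrite eq_sym.
  apply: eq_bigr => v _; rewrite !rem_filter ?filter_uniq // -!filter_predI.
  rewrite (eq_filter (a2 := predI (predC1 v) (predC1 u))) => [|z]; last exact: andbC.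
  apply: eq_bigr => p _; case: FI => FP _.
  by apply: FP; rewrite -cat1s -(cat1s (y, _)) perm_catCA.
have step3 x t : uniq t -> size t <= n.+1 -> x \in t ->
    \sum_(p <- pairings t) F p = \sum_(p <- pairings (x :: rem x t)) F p.
  case: t => [//|y t] ut tn; rewrite inE /=.
  have [->//|nxy /= xt] := eqVneq x y.
  have pt : perm_eq t (x :: rem x t) by apply: perm_to_rem.
  have ut' : uniq t by case/andP: ut.
  have pyt : perm_eq (y :: t) [:: y, x & rem x t] by rewrite perm_cons.
  by rewrite (step1 y _ _ _ _ pt) // step2 // -(perm_uniq pyt).
clear step2; case: s sn us => [|x s] sn us p.
  by have /esym/size0nil -> := perm_size p.
have xs' : x \in s' by rewrite -(perm_mem p) mem_head.
rewrite (step3 x s') -?(perm_uniq p) // -?(perm_size p) //.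
apply: step1 => //; first by case/andP: us.
by rewrite -(perm_cons x) (permPl p) perm_to_rem.
Qed.

End Tours.

(** * Nodes in series *)

Ltac solve_perm := apply/permP => ? /=; rewrite ?count_cat /=; clear; lia.

Ltac split_ands H :=
  repeat (let h := fresh "nd" in case/andP: H => h H; try split_ands h).

Ltac solve_fresh :=
  rewrite /= ?(pts_cat, pts_cons, mem_cat, inE, negb_or) /=;
  repeat (apply/andP; split);
  first [done | assumption | by rewrite eq_sym].

Section Gadgets.
Context {T : eqType}.
Implicit Types (L : seq (T * T)) (x y : T).

Lemma conn_contract_perm x a b l l' :
  perm_eq l ((a, x) :: (x, b) :: l') -> x != a -> x != b -> x \notin pts l' ->
  conn l = conn ((a, b) :: l').
Proof. by move=> p xa xb xl'; rewrite (conn_perm p) conn_contract. Qed.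

Lemma conn_contract_perm_r x a b l l' :
  perm_eq l ((a, x) :: (b, x) :: l') -> x != a -> x != b -> x \notin pts l' ->
  conn l = conn ((a, b) :: l').
Proof.
have sw q r : perm_eq (q :: r :: l') (r :: q :: l') by solve_perm.
move=> p xa xb xl'; rewrite (conn_perm p) -(conn_contract xa xb xl').
by rewrite (conn_perm (sw _ _)) conn_swap (conn_perm (sw _ _)).
Qed.

Definition fresh_in (s : seq T) (l : seq (T * T)) : bool :=
  uniq s && all (fun x => x \notin pts l) s.

Ltac open_fresh fr :=
  move: (fr); rewrite /fresh_in /= ?pts_cat ?pts_cons /= ?mem_cat ?inE ?negb_or;
  let fr' := fresh in move=> fr'; split_ands fr'.

Ltac close_fresh := rewrite /fresh_in /=; solve_fresh.

Section Series.
Variables (a1 a2 b1 b2 c1 c2 d1 d2 : T) (L : seq (T * T)).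
Hypothesis fr :
  fresh_in [:: b1; b2; c1; c2] ([:: (a1, a2); (d1, d2)] ++ L).

(** The two letters give the states, parallel or turn, of the first node (from [a] to [b]) and of
    the second one (from [c] to [d]). *)
Lemma conn_series_pp :
  conn ([:: (c1, d1); (c2, d2); (a1, b1); (a2, b2); (b1, c1); (b2, c2)] ++ L) =
  conn ([:: (a1, d1); (a2, d2)] ++ L).
Proof.
open_fresh fr.
rewrite (@conn_contract_perm b1 a1 c1 _
  ([:: (a2, b2); (c1, d1); (c2, d2); (b2, c2)] ++ L)); [|solve_perm| solve_fresh..].
rewrite (@conn_contract_perm b2 a2 c2 _
  ([:: (a1, c1); (c1, d1); (c2, d2)] ++ L)); [|solve_perm| solve_fresh..].
rewrite (@conn_contract_perm c1 a1 d1 _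
  ([:: (a2, c2); (c2, d2)] ++ L)); [|solve_perm| solve_fresh..].
rewrite (@conn_contract_perm c2 a2 d2 _
  ([:: (a1, d1)] ++ L)); [|solve_perm| solve_fresh..].
by apply: conn_perm; solve_perm.
Qed.

Lemma conn_series_pt :
  conn ([:: (c1, c2); (d1, d2); (a1, b1); (a2, b2); (b1, c1); (b2, c2)] ++ L) =
  conn ([:: (a1, a2); (d1, d2)] ++ L).
Proof.
open_fresh fr.
rewrite (@conn_contract_perm b1 a1 c1 _
  ([:: (a2, b2); (c1, c2); (d1, d2); (b2, c2)] ++ L)); [|solve_perm| solve_fresh..].
rewrite (@conn_contract_perm b2 a2 c2 _
  ([:: (a1, c1); (c1, c2); (d1, d2)] ++ L)); [|solve_perm| solve_fresh..].
rewrite (@conn_contract_perm c1 a1 c2 _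
  ([:: (a2, c2); (d1, d2)] ++ L)); [|solve_perm| solve_fresh..].
by rewrite (@conn_contract_perm_r c2 a1 a2 _
  ([:: (d1, d2)] ++ L)); [|solve_perm| solve_fresh..].
Qed.

Lemma conn_series_tp :
  conn ([:: (c1, d1); (c2, d2); (a1, a2); (b1, b2); (b1, c1); (b2, c2)] ++ L) =
  conn ([:: (a1, a2); (d1, d2)] ++ L).
Proof.
open_fresh fr.
rewrite (@conn_contract_perm c1 b1 d1 _
  ([:: (a1, a2); (b1, b2); (c2, d2); (b2, c2)] ++ L)); [|solve_perm| solve_fresh..].
rewrite (@conn_contract_perm c2 b2 d2 _
  ([:: (b1, d1); (a1, a2); (b1, b2)] ++ L)); [|solve_perm| solve_fresh..].
rewrite (@conn_contract_perm b2 b1 d2 _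
  ([:: (b1, d1); (a1, a2)] ++ L)); [|solve_perm| solve_fresh..].
rewrite conn_swap (@conn_contract_perm b1 d2 d1 _
  ([:: (a1, a2)] ++ L)); [|solve_perm| solve_fresh..].
by rewrite conn_swap; apply: conn_perm; solve_perm.
Qed.

Lemma conn_series_tt :
  conn ([:: (c1, c2); (d1, d2); (a1, a2); (b1, b2); (b1, c1); (b2, c2)] ++ L) =
  false.
Proof.
open_fresh fr.
rewrite (conn_perm (l' := [:: (b1, b2); (c1, c2); (b1, c1); (b2, c2)] ++
  ((a1, a2) :: (d1, d2) :: L))); last by solve_perm.
apply: conn_dead => // x /ptsP [p].
by rewrite !inE => /or4P [] /eqP -> /orP [] /eqP ->; solve_fresh.
Qed.

End Series.

(* With [t = 1] these are the three pairings at a 4-valent vertex; a chain of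
   [t] such vertices behaves, up to a power of two, as the node of weight [t]. *)
Definition node (t : nat) (a1 a2 b1 b2 : T) : seq (seq (T * T)) :=
  [:: [:: (a1, b1); (a2, b2)]; [:: (a1, b2); (a2, b1)]] ++
  nseq t [:: (a1, a2); (b1, b2)].

Lemma big_node t a1 a2 b1 b2 (F : seq (T * T) -> nat) :
  \sum_(l <- node t a1 a2 b1 b2) F l =
  F [:: (a1, b1); (a2, b2)] + F [:: (a1, b2); (a2, b1)] +
  t * F [:: (a1, a2); (b1, b2)].
Proof. by rewrite /node /= !big_cons big_nseq iter_addn_0 mulnC addnA. Qed.

(** Of the nine combinations, the four without a turn give parallel and cross twice each, a single
    turn gives a turn with total weight [2 * t + 2], and two turns give nothing: twice the node of
    weight [t.+1]. Crosses reduce to parallels by exchanging the names of two terminals. *)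
Lemma tours_series t a1 a2 b1 b2 c1 c2 d1 d2 L :
  fresh_in [:: b1; b2; c1; c2] ([:: (a1, a2); (d1, d2)] ++ L) ->
  tours [:: node t a1 a2 b1 b2; node 1 c1 c2 d1 d2]
    ([:: (b1, c1); (b2, c2)] ++ L) =
  2 * tours [:: node t.+1 a1 a2 d1 d2] L.
Proof.
move=> fr; open_fresh fr; rewrite /= !big_node /=.
have -> : conn [:: (c1, d2), (c2, d1), (a1, b1), (a2, b2), (b1, c1), (b2, c2) & L]
    = conn [:: (a1, d2), (a2, d1) & L].
  by apply: (@conn_series_pp a1 a2 b1 b2 c1 c2 d2 d1 L); close_fresh.
have -> : conn [:: (c1, d1), (c2, d2), (a1, b2), (a2, b1), (b1, c1), (b2, c2) & L]
    = conn [:: (a1, d2), (a2, d1) & L].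
  rewrite -[RHS](@conn_series_pp a1 a2 b2 b1 c2 c1 d2 d1 L); last by close_fresh.
  by apply: conn_perm; solve_perm.
have -> : conn [:: (c1, d2), (c2, d1), (a1, b2), (a2, b1), (b1, c1), (b2, c2) & L]
    = conn [:: (a1, d1), (a2, d2) & L].
  rewrite -[RHS](@conn_series_pp a1 a2 b2 b1 c2 c1 d1 d2 L); last by close_fresh.
  by apply: conn_perm; solve_perm.
have -> : conn [:: (c1, c2), (d1, d2), (a1, b2), (a2, b1), (b1, c1), (b2, c2) & L]
    = conn [:: (a1, a2), (d1, d2) & L].
  rewrite -[RHS](@conn_series_pt a1 a2 b2 b1 c2 c1 d1 d2 L); last by close_fresh.
  by rewrite conn_swap; apply: conn_perm; solve_perm.
have -> : conn [:: (c1, d2), (c2, d1), (a1, a2), (b1, b2), (b1, c1), (b2, c2) & L]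
    = conn [:: (a1, a2), (d1, d2) & L].
  rewrite (@conn_series_tp a1 a2 b1 b2 c1 c2 d2 d1 L); last by close_fresh.
  rewrite /= (@conn_perm _ _ [:: (d2, d1), (a1, a2) & L]); last by solve_perm.
  by rewrite conn_swap; apply: conn_perm; solve_perm.
rewrite (conn_series_pp fr) (conn_series_pt fr) (conn_series_tp fr).
rewrite (conn_series_tt fr) /=; clear; lia.
Qed.

(* [column m l1 l2 r1 r2] is [m] nodes of weight 0 in series. *)
Definition column (m : nat) (l1 l2 r1 r2 : T) : seq (seq (T * T)) :=
  [:: (l1, r1); (l2, r2)] :: nseq m [:: (l1, l2); (r1, r2)].

Lemma big_column m l1 l2 r1 r2 (F : seq (T * T) -> nat) :
  \sum_(l <- column m l1 l2 r1 r2) F l =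
  F [:: (l1, r1); (l2, r2)] + m * F [:: (l1, l2); (r1, r2)].
Proof. by rewrite /column big_cons big_nseq iter_addn_0 mulnC. Qed.

(** The terminals of the new node are listed crosswise, so that its state of weight 0 is the cross
    of the column and the surviving states are parallel and turn. *)
Lemma tours_column_step m l1 l2 r1 r2 l1' l2' r1' r2' L :
  fresh_in [:: r1; r2; l1'; l2'] ([:: (l1, l2); (r1', r2')] ++ L) ->
  tours [:: column m l1 l2 r1 r2; node 0 l1' r2' l2' r1']
    ([:: (r1, l1'); (r2, l2')] ++ L) =
  tours [:: column m.+1 l1 l2 r1' r2'] L.
Proof.
move=> fr; open_fresh fr; rewrite /= !big_column !big_node /=.
have -> : conn [:: (l1', r1'), (r2', l2'), (l1, r1), (l2, r2), (r1, l1'), (r2, l2') & L]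
    = conn [:: (l1, r1'), (l2, r2') & L].
  rewrite -[RHS](conn_series_pp fr).
  rewrite (@conn_perm _ _
    [:: (r2', l2'), (l1', r1'), (l1, r1), (l2, r2), (r1, l1'), (r2, l2') & L]);
    last by solve_perm.
  by rewrite conn_swap; apply: conn_perm; solve_perm.
have -> : conn [:: (l1', r1'), (r2', l2'), (l1, l2), (r1, r2), (r1, l1'), (r2, l2') & L]
    = conn [:: (l1, l2), (r1', r2') & L].
  rewrite -[RHS](conn_series_tp fr).
  rewrite (@conn_perm _ _
    [:: (r2', l2'), (l1', r1'), (l1, l2), (r1, r2), (r1, l1'), (r2, l2') & L]);
    last by solve_perm.
  by rewrite conn_swap; apply: conn_perm; solve_perm.
have -> : conn [:: (l1', l2'), (r2', r1'), (l1, r1), (l2, r2), (r1, l1'), (r2, l2') & L]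
    = conn [:: (l1, l2), (r1', r2') & L].
  rewrite -[RHS](conn_series_pt fr).
  rewrite (@conn_perm _ _
    [:: (r2', r1'), (l1', l2'), (l1, r1), (l2, r2), (r1, l1'), (r2, l2') & L]);
    last by solve_perm.
  by rewrite conn_swap; apply: conn_perm; solve_perm.
have -> : conn [:: (l1', l2'), (r2', r1'), (l1, l2), (r1, r2), (r1, l1'), (r2, l2') & L]
    = false.
  rewrite -[RHS](conn_series_tt fr).
  rewrite (@conn_perm _ _
    [:: (r2', r1'), (l1', l2'), (l1, l2), (r1, r2), (r1, l1'), (r2, l2') & L]);
    last by solve_perm.
  by rewrite conn_swap; apply: conn_perm; solve_perm.
by clear; lia.
Qed.

(** Both surviving states join [a1] to [a2] through the link; the turn, which would close the link
    off, has weight 0. *)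
Lemma tours_node_link a1 a2 b1 b2 L :
  fresh_in [:: b1; b2] ((a1, a2) :: L) ->
  tours [:: node 0 a1 a2 b1 b2] ((b1, b2) :: L) = 2 * conn ((a1, a2) :: L).
Proof.
move=> fr; open_fresh fr; rewrite /= !big_node /=.
have -> : conn [:: (a1, b1), (a2, b2), (b1, b2) & L] = conn ((a1, a2) :: L).
  rewrite (@conn_contract_perm b1 a1 b2 _ ([:: (a2, b2)] ++ L));
    [|solve_perm| solve_fresh..].
  by rewrite (@conn_contract_perm_r b2 a1 a2 _ L); [|solve_perm| solve_fresh..].
have -> : conn [:: (a1, b2), (a2, b1), (b1, b2) & L] = conn ((a1, a2) :: L).
  rewrite (@conn_contract_perm b1 a2 b2 _ ([:: (a1, b2)] ++ L));
    [|solve_perm| solve_fresh..].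
  by rewrite (@conn_contract_perm_r b2 a1 a2 _ L); [|solve_perm| solve_fresh..].
by clear; lia.
Qed.

Lemma tours_column_base l1 l2 r1 r2 s L :
  fresh_in [:: l1] ([:: (s, l2); (r1, r2)] ++ L) ->
  tours [:: node 0 l1 r2 l2 r1] ((s, l1) :: L) = tours [:: column 1 s l2 r1 r2] L.
Proof.
move=> fr; open_fresh fr; rewrite /= !big_node !big_column /=.
have -> : conn [:: (l1, l2), (r2, r1), (s, l1) & L] = conn [:: (s, l2), (r1, r2) & L].
  rewrite (@conn_contract_perm l1 s l2 _ ((r2, r1) :: L));
    [|solve_perm| solve_fresh..].
  rewrite (@conn_perm _ _ [:: (r2, r1), (s, l2) & L]); last by solve_perm.
  by rewrite conn_swap; apply: conn_perm; solve_perm.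
have -> : conn [:: (l1, r1), (r2, l2), (s, l1) & L] = conn [:: (s, r1), (l2, r2) & L].
  rewrite (@conn_contract_perm l1 s r1 _ ((r2, l2) :: L));
    [|solve_perm| solve_fresh..].
  rewrite (@conn_perm _ _ [:: (r2, l2), (s, r1) & L]); last by solve_perm.
  by rewrite conn_swap; apply: conn_perm; solve_perm.
by clear; lia.
Qed.

Lemma tours_column_end m s l2 r1 r2 o L :
  r1 != s -> r1 != l2 -> r1 != r2 -> r1 != o -> r1 \notin pts L ->
  tours [:: column m s l2 r1 r2] ((r1, o) :: L) = tours [:: column m s l2 o r2] L.
Proof.
move=> r1s r1l r1r r1o r1L; rewrite /= !big_column /=.
have -> : conn [:: (s, r1), (l2, r2), (r1, o) & L] = conn [:: (s, o), (l2, r2) & L].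
  by rewrite (@conn_contract_perm r1 s o _ ((l2, r2) :: L));
    [|solve_perm| solve_fresh..].
have -> : conn [:: (s, l2), (r1, r2), (r1, o) & L] = conn [:: (s, l2), (o, r2) & L].
  rewrite (@conn_perm _ _ [:: (r1, o), (r1, r2), (s, l2) & L]); last by solve_perm.
  rewrite conn_swap (@conn_contract_perm r1 o r2 _ ((s, l2) :: L));
    [|solve_perm| solve_fresh..].
  by apply: conn_perm; solve_perm.
by clear; lia.
Qed.

End Gadgets.

(** * Random insertion of a strand *)

Section Insert.
Context {T : eqType}.
Implicit Types (L p : seq (T * T)) (x y : T) (s : seq T).

Lemma pairings_pts s p : p \in pairings s -> {subset pts p <= s}.
Proof.
elim: {s}(size s) {-2}s (leqnn (size s)) p => [|n IH] [|x s] //= sn p.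
- by rewrite inE => /eqP ->.
- by rewrite inE => /eqP ->.
rewrite pairings_cons => /flatten_mapP [y ys] /mapP [q qp -> z].
rewrite pts_cons !inE => /or3P [/eqP ->|/eqP -> /=|zq]; rewrite ?eqxx ?ys ?orbT //.
have {}zq : z \in rem y s by apply: IH qp z zq; rewrite size_rem //; lia.
by rewrite (mem_rem zq) orbT.
Qed.

(** [s1] stands for the ends that the strand [x] has already passed, [s2] for its remaining
    candidates. *)
Definition pairings_into x s1 s2 : seq (seq (T * T)) :=
  flatten [seq [seq (x, y) :: p | p <- pairings (s1 ++ rem y s2)] | y <- s2].

Lemma big_pairings_into x s1 s2 (F : seq (T * T) -> nat) :
  \sum_(p <- pairings_into x s1 s2) F p =
  \sum_(y <- s2) \sum_(p <- pairings (s1 ++ rem y s2)) F ((x, y) :: p).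
Proof.
rewrite /pairings_into big_flatten /= big_map; apply: eq_bigr => y _.
by rewrite big_map.
Qed.

Lemma pairings_into_all x s : pairings_into x [::] s = pairings (x :: s).
Proof. by rewrite pairings_cons. Qed.

Lemma pairings_into1 x s y :
  pairings_into x s [:: y] = [seq (x, y) :: p | p <- pairings s].
Proof. by rewrite /pairings_into /= eqxx !cats0. Qed.

Lemma link_invariant_conn L : link_invariant (fun l => conn (l ++ L) : nat).
Proof. exact: (link_invariant_tours [::]). Qed.

(* A random insertion step.  Linking [x] to [y0] with weight 1, or passing [x]
   on with weight [size s2], keeps the partner of [x] uniform. *)
Lemma tours_column_insert x x' z y0 s1 s2 L :
  uniq (s1 ++ y0 :: s2) -> x' != z ->
  all (fun u => u \notin x :: y0 :: s1 ++ s2 ++ pts L) [:: x'; z] ->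
  tours [:: column (size s2) x x' y0 z; pairings_into x' (rcons s1 z) s2] L =
  size s2 * tours [:: pairings_into x s1 (y0 :: s2)] L.
Proof.
move=> us xz /= /and3P []; rewrite !inE !mem_cat !negb_or.
move=> /andP [x'x /andP [x'y0 /and3P [x's1 x's2 x'L]]].
move=> /andP [zx /andP [zy0 /and3P [zs1 zs2 zL]]] _.
have us' : uniq (y0 :: s1 ++ s2).
  by rewrite -cat1s uniq_catCA.
have /andP [y0s us12] : (y0 \notin s1 ++ s2) && uniq (s1 ++ s2) by [].
pose s' y := s1 ++ rem y s2.
have us'' y : y \in s2 -> [/\ uniq (z :: s' y), perm_eq (y :: s' y) (s1 ++ s2)
    & perm_eq (y0 :: s' y) (s1 ++ rem y (y0 :: s2))].
  move=> ys2.
  have pP : perm_eq (y :: s' y) (s1 ++ s2).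
    by rewrite -cat1s perm_catCA perm_cat2l perm_sym; apply: perm_to_rem.
  have pP' : perm_eq (y0 :: s' y) (s1 ++ rem y (y0 :: s2)).
    rewrite -cat1s perm_catCA perm_cat2l /=.
    by case: eqP y0s => // ->; rewrite mem_cat ys2 orbT.
  split => //; move: us12; rewrite -(perm_uniq pP) /= => /andP [_ ->].
  rewrite andbT mem_cat negb_or zs1; apply: contra zs2; exact: mem_rem.
(* The partners of [x'] and of [z] are made explicit, since both points are going to be
   contracted. *)
have expand G : link_invariant G ->
    \sum_(p <- pairings_into x' (rcons s1 z) s2) G p =
    \sum_(o <- s2) \sum_(y <- s' o) \sum_(p <- pairings (rem y (s' o)))
      G ((x', o) :: (z, y) :: p).
  move=> GI; rewrite big_pairings_into !big_seq; apply: eq_bigr => o os2.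
  have [uz _ _] := us'' _ os2.
  rewrite -(big_pairings_cons z (s' o) (fun p => G ((x', o) :: p))).
  apply: esym; apply: perm_big_pairings => //; first exact: link_invariant_cons.
  by rewrite cat_rcons -cat1s perm_catCA perm_refl.
rewrite /= big_column.
rewrite (expand (fun p => conn (p ++ [:: (x, y0); (x', z)] ++ L)) (link_invariant_conn _)).
rewrite (expand (fun p => conn (p ++ [:: (x, x'); (y0, z)] ++ L)) (link_invariant_conn _)).
rewrite big_pairings_into big_cons /= eqxx mulnDr; congr (_ + _).
(* Parallel state: [x] gets [y0], and the strand from [x'] to [z] joins [o] to [y]. A pairing of
   [s1 ++ s2] thus arises once for each [o] in [s2]. *)
- rewrite (eq_big_seq (fun=> \sum_(p <- pairings (s1 ++ s2)) conn ((x, y0) :: p ++ L))).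
    by rewrite big_const_seq count_predT iter_addn_0 mulnC.
  move=> o os2; have [uz pP _] := us'' _ os2.
  have /andP [zs us'o] : (z \notin s' o) && uniq (s' o) by [].
  have li : link_invariant (fun p => conn ((x, y0) :: p ++ L) : nat).
    exact: (link_invariant_cons (x, y0) (link_invariant_conn L)).
  rewrite -(perm_big_pairings li _ pP) ?big_pairings_cons; last first.
    by rewrite (perm_uniq pP).
  rewrite !big_seq; apply: eq_bigr => y ys'.
  rewrite !big_seq; apply: eq_bigr => p pp.
  have sub u : u \notin s' o -> u \notin pts p.
    by apply: contra => /(pairings_pts pp) /mem_rem.
  have sx : x' \notin s' o.
    by rewrite mem_cat negb_or x's1; apply: contra x's2 => /mem_rem.
  have sz : z \notin s' o by [].
  have ne u : u \notin s' o -> u != y by apply: contraNneq => ->.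
  have no u : u \notin s2 -> u != o by apply: contraNneq => ->.
  have xo := no _ x's2; have zo := no _ zs2.
  have xy := ne _ sx; have zy := ne _ sz.
  have xp := sub _ sx; have zp := sub _ sz.
  congr (nat_of_bool _).
  rewrite /= conn_swap (@conn_contract_perm _ x' o z _ ((z, y) :: p ++ (x, y0) :: L));
    [|solve_perm|solve_fresh..].
  rewrite (@conn_contract_perm _ z o y _ (p ++ (x, y0) :: L));
    [|solve_perm|solve_fresh..].
  by apply: conn_perm; solve_perm.
(* Turn state: [x] gets the partner [o] of [x'], and [y0] gets the partner [y] of [z]. Every pairing
   arises once, and the factor is the weight of the turn. *)
- congr (_ * _); apply: eq_big_seq => o os2.
  have [uz _ pP] := us'' _ os2.
  have /andP [zs us'o] : (z \notin s' o) && uniq (s' o) by [].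
  have li : link_invariant (fun p => conn ((x, o) :: p ++ L) : nat).
    exact: (link_invariant_cons (x, o) (link_invariant_conn L)).
  rewrite -(perm_big_pairings li _ pP) ?big_pairings_cons; last first.
    rewrite cons_uniq us'o andbT; apply: contra y0s.
    by rewrite !mem_cat => /orP [->//|/mem_rem ->]; rewrite orbT.
  rewrite !big_seq; apply: eq_bigr => y ys'.
  rewrite !big_seq; apply: eq_bigr => p pp.
  have sub u : u \notin s' o -> u \notin pts p.
    by apply: contra => /(pairings_pts pp) /mem_rem.
  have sx : x' \notin s' o.
    by rewrite mem_cat negb_or x's1; apply: contra x's2 => /mem_rem.
  have sz : z \notin s' o by [].
  have ne u : u \notin s' o -> u != y by apply: contraNneq => ->.
  have no u : u \notin s2 -> u != o by apply: contraNneq => ->.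
  have xo := no _ x's2; have zo := no _ zs2.
  have xy := ne _ sx; have zy := ne _ sz.
  have xp := sub _ sx; have zp := sub _ sz.
  congr (nat_of_bool _).
  rewrite /= (@conn_contract_perm _ x' x o _ ([:: (z, y); (y0, z)] ++ p ++ L));
    [|solve_perm|solve_fresh..].
  rewrite (@conn_contract_perm _ z y0 y _ ((x, o) :: p ++ L));
    [|solve_perm|solve_fresh..].
  by apply: conn_perm; solve_perm.
Qed.

End Insert.

(** * Tours of a multigraph as configurations *)

Section Count.
Context {X : finType}.
Implicit Types (p q : {ffun X -> X}) (vs : seq (seq X)) (s : seq X)
  (l E : seq (X * X)).

Definition graph p : seq (X * X) := [seq (x, p x) | x <- enum X].

Definition matching_on s p : bool :=
  all (fun x => [&& p x \in s, p x != x & p (p x) == x]) s.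

Definition extends vs q p : bool :=
  [forall x, (x \notin flatten vs) ==> (p x == q x)] && all (matching_on ^~ p) vs.

Lemma extendsP vs q p :
  reflect ((forall x, x \notin flatten vs -> p x = q x) /\
           (forall s, s \in vs -> {in s, forall x,
              [/\ p x \in s, p x != x & p (p x) = x]}))
    (extends vs q p).
Proof.
apply: (iffP andP) => [[/forallP H1 /allP H2]|[H1 H2]]; split.
- by move=> x xvs; apply/eqP; apply: (implyP (H1 x)).
- move=> s /H2 /allP H x xs.
  by case/and3P: (H x xs) => ? ? /eqP ?.
- by apply/forallP => x; apply/implyP => /H1 ->.
- by apply/allP => s svs; apply/allP => x xs; case: (H2 s svs x xs) => -> -> ->;
    rewrite eqxx.
Qed.

(** [l] lists the links decided so far. It may hold a pair in one orientation only, whereas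
    [graph q] has both; hence the disjunction. *)
Definition records vs q l :=
  (forall x, x \notin flatten vs -> ((x, q x) \in l) || ((q x, x) \in l)) /\
  (forall x y, (x, y) \in l ->
     [/\ x \notin flatten vs, y \notin flatten vs, q x = y & q y = x]).

Definition set_pair q x y : {ffun X -> X} :=
  [ffun z => if z == x then y else if z == y then x else q z].

Lemma extends_cons x s vs q p y : uniq (flatten ((x :: s) :: vs)) -> y \in s ->
  extends ((x :: s) :: vs) q p && (p x == y) =
  extends (rem y s :: vs) (set_pair q x y) p.
Proof.
move=> u ys.
have /andP [xn us] : (x \notin s ++ flatten vs) && uniq (s ++ flatten vs) by [].
move: xn; rewrite mem_cat negb_or => /andP [xs xvs].
move: us; rewrite cat_uniq => /and3P [us /hasPn dis uvs].
have xy : y != x by apply: contraNneq xs => <-.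
have yr : y \notin rem y s by rewrite mem_rem_uniq // inE eqxx.
have yvs : y \notin flatten vs by apply/negP => /dis /negP; apply.
apply/andP/idP => [[/extendsP [H1 H2] /eqP pxy]|/extendsP [H1 H2]].
- have pyx : p y = x.
    by have [_ _ <-] := H2 _ (mem_head _ _) x (mem_head _ _); rewrite pxy.
  apply/extendsP; split=> [z /= zn|s']; rewrite ?inE.
    rewrite ffunE; case: eqP => [->//|/eqP zx]; case: eqP => [->//|/eqP zy].
    apply: H1; rewrite /= inE negb_or zx /= mem_cat.
    by move: zn; rewrite mem_cat mem_rem_uniq // inE zy.
  case/orP=> [/eqP ->|s'vs] z.
    rewrite mem_rem_uniq // !inE => /andP [zy zs].
    have [pz1 pz2 pz3] := H2 _ (mem_head _ _) z (mem_behead (s := x :: s) zs).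
    split=> //; rewrite mem_rem_uniq // inE.
    move: pz1; rewrite inE => /orP [/eqP pzx|->].
      by rewrite -pz3 pzx pxy eqxx in zy.
    rewrite andbT; apply: contraNneq xs => pzy.
    by rewrite -pyx -pzy pz3.
  by apply: H2; rewrite inE s'vs orbT.
- have pxy : p x = y.
    rewrite H1 ?ffunE ?eqxx //= mem_cat negb_or xvs andbT.
    by apply: contra xs => /mem_rem.
  have pyx : p y = x.
    rewrite H1 ?ffunE ?eqxx ?(negPf xy) //= mem_cat negb_or yvs andbT //.
  split; last by rewrite pxy.
  apply/extendsP; split=> [z /=|s'].
    rewrite inE mem_cat !negb_or => /and3P [zx zs zvs].
    rewrite H1 ?ffunE ?(negPf zx) /=; last first.
      by rewrite mem_cat negb_or zvs andbT; apply: contra zs => /mem_rem.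
    by rewrite (negPf (_ : z != y)) //; apply: contraNneq zs => ->.
  rewrite inE => /orP [/eqP ->|s'vs] z; last first.
    by apply: H2; rewrite inE s'vs orbT.
  rewrite inE => /orP [/eqP ->|zs].
    by rewrite pxy pyx inE ys orbT.
  have [->|zy] := eqVneq z y.
    by rewrite pyx pxy inE eqxx eq_sym.
  have zr : z \in rem y s by rewrite mem_rem_uniq // inE zy.
  have [pz1 pz2 pz3] := H2 _ (mem_head _ _) z zr.
  by split=> //; rewrite inE (mem_rem pz1) orbT.
Qed.

Lemma records_cons x s vs q l y : uniq (flatten ((x :: s) :: vs)) -> y \in s ->
  records ((x :: s) :: vs) q l ->
  records (rem y s :: vs) (set_pair q x y) ((x, y) :: l).
Proof.
move=> u ys [H1 H2].
have /andP [xn us] : (x \notin s ++ flatten vs) && uniq (s ++ flatten vs) by [].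
move: xn; rewrite mem_cat negb_or => /andP [xs xvs].
move: us; rewrite cat_uniq => /and3P [us /hasPn dis uvs].
have xy : y != x by apply: contraNneq xs => <-.
have yr : y \notin rem y s by rewrite mem_rem_uniq // inE eqxx.
have yvs : y \notin flatten vs by apply/negP => /dis /negP; apply.
split=> [z|a b].
- rewrite /= mem_cat mem_rem_uniq // inE negb_or negb_and negbK => /andP [zs zvs].
  rewrite ffunE !inE.
  case: (z =P x) => [->|/eqP zx]; first by rewrite eqxx.
  case: (z =P y) => [->|/eqP zy]; first by rewrite eqxx !orbT.
  have : z \notin flatten ((x :: s) :: vs).
    by rewrite /= inE negb_or zx mem_cat negb_or zvs andbT; move: zs; rewrite (negPf zy).
  by move/H1 => /orP [->|->]; rewrite !orbT.
- have out z : z \notin flatten ((x :: s) :: vs) ->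
      [/\ z != x, z != y & z \notin rem y s ++ flatten vs].
    rewrite /= inE mem_cat !negb_or => /and3P [zx zs zvs]; split=> //.
      by apply: contraNneq zs => ->.
    by rewrite mem_cat negb_or zvs andbT; apply: contra zs => /mem_rem.
  rewrite inE => /orP [/eqP [-> ->]|/H2 [/out [ax ay an] /out [bx by_ bn] qa qb]].
    rewrite /= !mem_cat !negb_or xvs yvs yr !ffunE !eqxx (negPf xy); split=> //.
    by rewrite andbT; apply: contra xs => /mem_rem.
  by rewrite !ffunE (negPf ax) (negPf ay) (negPf bx) (negPf by_).
Qed.

(** The bridge from pairings as functions to lists of options: the first free end of the first
    vertex is given each possible partner, and the decision moves from [vs] into [q] and [l]. *)
Lemma sum_extends vs q l E : uniq (flatten vs) -> records vs q l ->
  \sum_(p | extends vs q p) conn (graph p ++ E) =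
  tours [seq pairings s | s <- vs] (l ++ E).
Proof.
(* The second summand pays for dropping a vertex whose ends are used up. *)
have [n] := ubnP (size (flatten vs) + size vs).
elim: n vs q l => // n IH [|[|x s] vs] q l vn u R.
- rewrite /= (big_pred1 q) => [|p].
    congr (nat_of_bool _).
    case: R => R1 R2; apply: eq_conn => [S|z].
      rewrite /invariant_set !all_cat; congr (_ && _).
      apply/allP/allP => H.
        move=> [a b] /R2 [_ _ <- _].
        by apply: (H (a, q a)); apply: map_f; rewrite mem_enum.
      move=> _ /mapP [a _ ->] /=.
      by case/orP: (R1 a isT) => /H //=; rewrite eq_sym.
    rewrite !pts_cat !mem_cat; congr (_ || _); apply/idP/idP.
      case/ptsP => _ /mapP [a _ ->]; rewrite !inE => zz.
      by case/orP: (R1 a isT) => /mem_pts /andP [] /= A B; case/orP: zz => /eqP ->.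
    case/ptsP => [[a b]] /R2 [_ _ ab ba]; rewrite !inE => /orP [] /eqP ->.
      by have /mem_pts /andP [] // : (a, q a) \in graph q by apply: map_f; rewrite mem_enum.
    by have /mem_pts /andP [] // : (b, q b) \in graph q by apply: map_f; rewrite mem_enum.
  apply/extendsP/eqP => [[H _]|->]; last by split.
  by apply/ffunP => z; apply: H.
- rewrite /= big_seq1 -(IH _ q) //.
  by move: vn => /=; rewrite addnS.
- rewrite (partition_big (fun p : {ffun X -> X} => p x) (mem s)) /=; last first.
    move=> p /extendsP [_ H].
    have [pz1 pz2 _] := H _ (mem_head _ _) x (mem_head _ _).
    by move: pz1; rewrite inE (negPf pz2).
  rewrite big_pairings_cons -big_uniq /=; last first.
    by move: u; rewrite /= cat_uniq => /andP [_ /andP []].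
  rewrite !big_seq; apply: eq_bigr => y ys.
  under eq_bigl => p do rewrite extends_cons //.
  rewrite (IH _ _ ((x, y) :: l)) //=.
  + apply: eq_bigr => p _; apply: tours_permE.
    by rewrite -cat1s perm_catCA.
  + move: vn => /=; rewrite !size_cat size_rem //; move: ys; case: (s) => //= *; lia.
  + move: u; rewrite /= mem_cat negb_or -andbA => /and3P [_ _].
    rewrite !cat_uniq => /and3P [us /hasPn dis ->].
    rewrite rem_uniq // andbT; apply/hasPn => z /dis; apply: contra; exact: mem_rem.
  + exact: records_cons.
Qed.

End Count.

Lemma uniq_flatten_fibers (T I : eqType) (f : T -> I) (s : seq T) (r : seq I) :
  uniq s -> uniq r -> uniq (flatten [seq [seq x <- s | f x == i] | i <- r]).
Proof.
move=> us; elim: r => //= i r IH /andP [ir ur].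
rewrite cat_uniq filter_uniq // IH // andbT; apply/hasPn => x.
case/flatten_mapP => j jr; rewrite !mem_filter => /andP [/eqP -> _].
by apply: contra ir => /andP [/eqP <-].
Qed.

Section Graph.
Variable G : multigraph.
Implicit Types (p : {ffun edge_end G -> edge_end G}) (x y : edge_end G).

Definition edge_links : seq (edge_end G * edge_end G) :=
  [seq ((i, false), (i, true)) | i <- enum (edge G)].

Definition ends_at (v : 'I_(nvert G)) : seq (edge_end G) :=
  [seq x <- enum (edge_end G) | vertex_of x == v].

Lemma mem_ends_at v x : (x \in ends_at v) = (vertex_of x == v).
Proof. by rewrite mem_filter mem_enum andbT. Qed.

Lemma opposite_inj : injective (@opposite G).
Proof. by move=> [i b] [j c] [-> /(congr1 negb)]; rewrite !negbK => ->. Qed.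

(** A set closed under [p] and [opposite] is closed under [follow p]. Conversely, the ends of the
    edges on one trail form such a set, because [follow p] is injective and can therefore be run
    backwards. *)
Lemma eulerian_tour_conn p :
  is_pairing p -> is_eulerian_tour p = conn (graph p ++ edge_links).
Proof.
move=> pp; rewrite /is_eulerian_tour pp /=.
have pK x : p (p x) = x by move/forallP/(_ x): pp => /and3P [/eqP].
have pinj : injective p by apply: can_inj pK.
have finj : injective (follow p) by move=> x y /pinj /opposite_inj.
have inv S : invariant_set S (graph p ++ edge_links) ->
    (forall x, S (p x) = S x) /\ (forall x, S (opposite x) = S x).
  rewrite /invariant_set all_cat => /andP [/allP H1 /allP H2]; split=> x.
    apply/eqP; rewrite eq_sym.
    by apply: (H1 (x, p x)); apply: map_f; rewrite mem_enum.
  case: x => i b; have /eqP /= E : S (i, false) == S (i, true).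
    by apply: (H2 ((i, false), (i, true))); apply: map_f; rewrite mem_enum.
  by case: b; rewrite /opposite /=.
have all_pts x : x \in pts (graph p ++ edge_links).
  rewrite pts_cat mem_cat; apply/orP; left.
  by have /mem_pts /andP [] // : (x, p x) \in graph p by apply: map_f; rewrite mem_enum.
apply/forallP/connP => [H S /inv [Sp So] x y _ _|H x].
- have Sf z w : fconnect (follow p) z w -> S w = S z.
    by move=> /iter_findex <-; elim: (findex _ _ _) => //= m <-; rewrite Sp So.
  case: y => e b; have /forallP /(_ e) /existsP [c /Sf <-] := H x.
  by case: (c =P b) => [-> //|/eqP]; case: b c => [] [] // _;
    rewrite -[RHS]So.
- apply/forallP => e.
  pose S (z : edge_end G) := [exists b, fconnect (follow p) x (z.1, b)].
  have So z : S (opposite z) = S z by [].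
  have Sp1 z : S z -> S (p z).
    case/existsP => b xz.
    have [xz'|xz'] : fconnect (follow p) x (opposite z) \/ fconnect (follow p) x z.
      case: z xz => i c /=; rewrite /opposite /=; case: b; case: c => xz; auto.
    - apply/existsP; exists (p z).2; rewrite -surjective_pairing.
      apply: connect_trans xz' _; apply: connect1 => /=.
      by rewrite /follow /opposite /= negbK -surjective_pairing.
    - apply/existsP; exists (~~ (p z).2).
      apply: connect_trans xz' _; rewrite (fconnect_sym finj); apply: connect1 => /=.
      by rewrite /follow /opposite /= negbK -surjective_pairing pK.
  have Sp z : S (p z) = S z by apply/idP/idP => /Sp1 //; rewrite pK.
  have iS : invariant_set S (graph p ++ edge_links).
    rewrite /invariant_set all_cat; apply/andP; split; apply/allP => _ /mapP [z _ ->] /=.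
      by rewrite Sp.
    by rewrite -(So (z, true)).
  have := H S iS (e, true) x (all_pts _) (all_pts _); rewrite /S /= => ->.
  by apply/existsP; exists x.2; rewrite -surjective_pairing connect0.
Qed.

Lemma num_eulerian_toursE :
  num_eulerian_tours G =
  tours [seq pairings (ends_at v) | v <- enum 'I_(nvert G)] edge_links.
Proof.
pose vs := [seq ends_at v | v <- enum 'I_(nvert G)].
have mvs x : x \in flatten vs.
  apply/flatten_mapP; exists (vertex_of x); rewrite ?mem_enum //.
  by rewrite mem_ends_at.
have u : uniq (flatten vs) by apply: uniq_flatten_fibers; rewrite enum_uniq.
have R : records vs [ffun x => x] [::] by split=> // x; rewrite mvs.
have := sum_extends edge_links u R; rewrite /= -map_comp => <-.
have pE p : extends vs [ffun x => x] p = is_pairing p.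
  apply/extendsP/forallP => [[_ H] x|H].
    have vx : ends_at (vertex_of x) \in vs by rewrite map_f ?mem_enum.
    have [|px pn ->] := H _ vx x; first by rewrite mem_ends_at.
    by rewrite eqxx pn; move: px; rewrite mem_ends_at.
  split=> [x|_ /mapP [v _ ->] x]; first by rewrite mvs.
  rewrite !mem_ends_at => /eqP <-.
  by case/and3P: (H x) => /eqP -> -> ->.
rewrite /num_eulerian_tours cardsE -sum1_card big_mkcond.
rewrite [RHS]big_mkcond /=; apply: eq_bigr => p _; rewrite pE.
have [pp|pp] := boolP (is_pairing p); last first.
  by rewrite unfold_in /is_eulerian_tour (negPf pp).
by rewrite -[p \in _]/(is_eulerian_tour p) eulerian_tour_conn //; case: conn.
Qed.

End Graph.

Lemma pts_map (T T' : eqType) (f : T -> T') (l : seq (T * T)) :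
  pts [seq (f p.1, f p.2) | p <- l] = map f (pts l).
Proof. by elim: l => //= p l IH; rewrite IH. Qed.

Section Rename.
Context {T T' : eqType} (f : T -> T').
Hypothesis f_inj : injective f.
Let rename (l : seq (T * T)) := [seq (f p.1, f p.2) | p <- l].

Lemma tours_map vs E : tours (map (map rename) vs) (rename E) = tours vs E.
Proof.
elim: vs E => [|o vs IH] E /=; first by rewrite conn_map.
by rewrite big_map; apply: eq_bigr => l _; rewrite -IH /rename map_cat.
Qed.

Lemma pairings_map s : pairings (map f s) = map rename (pairings s).
Proof.
have [n] := ubnP (size s); elim: n s => // n IH [|x s] //= sn.
rewrite !pairings_cons map_flatten -!map_comp; congr flatten.
apply/eq_in_map => y ys /=.
have -> : rem (f y) (map f s) = map f (rem y s).
  elim: s {sn ys} => //= z s IHs; rewrite (inj_eq f_inj); case: eqP => // _ /=.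
  by rewrite IHs.
rewrite IH ?size_rem //; first by rewrite -!map_comp.
by rewrite ltnS in sn; apply: leq_ltn_trans (leq_pred _) sn.
Qed.

End Rename.

(** * Numbered ports *)

(* Port [4 q + r] is the [r]-th terminal of node [q]. *)
Definition pnode (t q : nat) := node t (4 * q) (4 * q + 1) (4 * q + 2) (4 * q + 3).

Arguments pnode : simpl never.

Lemma pts_pnode t q l : l \in pnode t q -> all (fun x => x %/ 4 == q) (pts l).
Proof.
rewrite !inE mem_nseq => lP.
have {lP} [] : [\/ l = [:: (4 * q, 4 * q + 2); (4 * q + 1, 4 * q + 3)],
  l = [:: (4 * q, 4 * q + 3); (4 * q + 1, 4 * q + 2)] |
  l = [:: (4 * q, 4 * q + 1); (4 * q + 2, 4 * q + 3)]].
  by case/or3P: lP => [/eqP|/eqP|/andP [_ /eqP]]; [constructor 1|constructor 2|constructor 3].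
all: move=> ->; rewrite /=; lia.
Qed.

Lemma options_in_pnodes t m k :
  options_in (fun x => m <= x %/ 4 < m + k) [seq pnode t q | q <- iota m k].
Proof.
apply/allP => _ /mapP [q qm ->]; apply/allP => l /pts_pnode.
by apply: sub_all => x /eqP ->; rewrite mem_iota in qm.
Qed.

Lemma options_in_pairings (P : pred nat) s : all P s -> options_in P [:: pairings s].
Proof.
move=> /allP Ps; rewrite /options_in /= andbT; apply/allP => p ps.
by apply/allP => x /(pairings_pts ps) /Ps.
Qed.

Lemma options_in_pairings_into (P : pred nat) x s1 s2 :
  P x -> all P s1 -> all P s2 -> options_in P [:: pairings_into x s1 s2].
Proof.
move=> Px /allP Ps1 /allP Ps2; rewrite /options_in /= andbT; apply/allP => p.
case/flatten_mapP => y ys /mapP [q qp ->]; apply/allP => z.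
rewrite pts_cons !inE => /or3P [/eqP ->|/eqP -> /=|] //; first exact: Ps2.
move/(pairings_pts qp); rewrite mem_cat => /orP [/Ps1|/mem_rem /Ps2] //.
Qed.

Lemma fresh_by (P : pred nat) s L :
  uniq s -> all (predC P) (pts L) -> all P s -> fresh_in s L.
Proof.
move=> us /allP PL /allP Ps; rewrite /fresh_in us; apply/allP => x /Ps Px.
by apply: contraL Px => /PL.
Qed.

(** The node on an edge has its ports 2 and 3 linked to each other and offers ports 0 and 1 as the
    two half-edges. *)
Lemma tours_edge_nodes m k vs L :
  let X := fun x => (m <= x %/ 4 < m + k) && (1 < x %% 4) in
  options_in (predC X) vs -> all (predC X) (pts L) ->
  tours ([seq pnode 0 q | q <- iota m k] ++ vs)
    ([seq (4 * q + 2, 4 * q + 3) | q <- iota m k] ++ L) =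
  2 ^ k * tours vs ([seq (4 * q, 4 * q + 1) | q <- iota m k] ++ L).
Proof.
elim: k m L => [|k IH] m L X vsX LX; first by rewrite mul1n.
pose Y x := (x %/ 4 == m) && (1 < x %% 4).
have YX x : Y x -> X x by rewrite /X /Y; lia.
have XY x : predC X x -> predC Y x by apply: contra; apply: YX.
rewrite [LHS](@tours_local _ Y 2 [:: pnode 0 m] [:: (4 * m + 2, 4 * m + 3)]
  [::] [:: (4 * m, 4 * m + 1)] ([seq pnode 0 q | q <- iota m.+1 k] ++ vs)
  ([seq (4 * q + 2, 4 * q + 3) | q <- iota m.+1 k] ++ L)).
- rewrite (tours_permE _ (permEl (perm_catCA _ _ _))) IH ?expnS ?mulnA //.
  + by congr (_ * _); apply: tours_permE; rewrite perm_catCA.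
  + by apply: sub_options_in vsX => x; rewrite /X /=; lia.
  + rewrite pts_cat all_cat pts_cons /= (sub_all _ LX) ?andbT; first by lia.
    by move=> x; rewrite /X /=; lia.
- move=> L' L'Y; rewrite tours_node_link //.
  apply: (@fresh_by Y); rewrite /= ?inE; last by rewrite /Y; lia.
    by lia.
    by rewrite /= L'Y andbT /Y; lia.
- rewrite options_in_cat (sub_options_in XY vsX) andbT.
  by apply: sub_options_in (options_in_pnodes 0 m.+1 k) => x; rewrite /Y /=; lia.
- rewrite pts_cat all_cat (sub_all XY LX) andbT; apply/allP => x.
  case/ptsP => _ /mapP [q qm ->]; rewrite mem_iota in qm.
  by rewrite !inE /Y /=; lia.
Qed.

(** In a column the ports 0, 1, 2, 3 of a node are the terminals [l1], [r2], [l2], [r1], in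
    accordance with the crosswise listing in [tours_column_step]. *)
Definition column_links (m k : nat) : seq (nat * nat) :=
  flatten [seq [:: (4 * q + 3, 4 * q.+1); (4 * q + 1, 4 * q.+1 + 2)]
          | q <- iota m k].

Lemma column_linksS m k :
  column_links m k.+1 = column_links m k ++
    [:: (4 * (m + k) + 3, 4 * (m + k.+1)); (4 * (m + k) + 1, 4 * (m + k.+1) + 2)].
Proof.
by rewrite /column_links -[in LHS](addn1 k) iotaD map_cat flatten_cat /= (addnS m k).
Qed.

(* On the left the column ends in [x], linked from outside, and port [4 m + 2]. *)
Lemma tours_pnodes_column m k x L :
  let X := fun y => (4 * m <= y < 4 * (m + k.+1)) &&
    (y \notin [:: 4 * m + 2; 4 * (m + k) + 3; 4 * (m + k) + 1]) in
  x < 4 * m -> all (predC X) (pts L) ->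
  tours [seq pnode 0 q | q <- iota m k.+1] ((x, 4 * m) :: column_links m k ++ L) =
  tours [:: column k.+1 x (4 * m + 2) (4 * (m + k) + 3) (4 * (m + k) + 1)] L.
Proof.
elim: k L => [|k IH] L X xm LX.
  rewrite /column_links /= addn0.
  apply: (@tours_column_base _ (4 * m) (4 * m + 2) (4 * m + 3) (4 * m + 1)).
  apply: (@fresh_by X) => //; last by rewrite /X /= !inE; lia.
  by rewrite /= LX andbT /X !inE; lia.
pose Y := fun y => (4 * m <= y < 4 * (m + k.+1)) &&
  (y \notin [:: 4 * m + 2; 4 * (m + k) + 3; 4 * (m + k) + 1]).
have XY y : predC X y -> predC Y y.
  by apply: contra; rewrite /X /Y !inE; lia.
pose E1 := (x, 4 * m) :: column_links m k.
pose L1 := [:: (4 * (m + k) + 3, 4 * (m + k.+1));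
  (4 * (m + k) + 1, 4 * (m + k.+1) + 2)].
have -> : iota m k.+2 = iota m k.+1 ++ [:: m + k.+1].
  by rewrite -[k.+2]addn1 iotaD.
rewrite column_linksS -catA map_cat.
rewrite [LHS](@tours_local _ Y 1 [seq pnode 0 q | q <- iota m k.+1] E1
  [:: column k.+1 x (4 * m + 2) (4 * (m + k) + 3) (4 * (m + k) + 1)] [::]
  [:: pnode 0 (m + k.+1)] (L1 ++ L)).
- rewrite mul1n.
  apply: (@tours_column_step _ k.+1 x (4 * m + 2) (4 * (m + k) + 3)
    (4 * (m + k) + 1) (4 * (m + k.+1)) (4 * (m + k.+1) + 2)
    (4 * (m + k.+1) + 3) (4 * (m + k.+1) + 1) L).
  apply: (@fresh_by X).
  + rewrite /= !inE; lia.
  + by rewrite /= LX andbT /X !inE; lia.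
  + by rewrite /X /= !inE; lia.
- by move=> L' L'Y; rewrite mul1n; apply: IH.
- by apply: sub_options_in (options_in_pnodes 0 (m + k.+1) 1) => y; rewrite /Y /=; lia.
- by rewrite /= (sub_all XY LX) andbT /Y !inE; lia.
Qed.

(** The count at weight 0, where [vs] keeps the vertices that no nodes realize yet. *)
Definition value (m : nat) (E : seq (nat * nat)) vs : nat :=
  tours ([seq pnode 0 q | q <- iota 0 m] ++ vs) E.

(** The interior consists of all ports from [4 * m] on. It contains the new strand and the new end,
    so the pairings at the current vertex are part of the gadget. *)
Lemma value_column m E x s1 y0 s2 k vs : size s2 = k.+1 ->
  uniq (s1 ++ y0 :: s2) ->
  all (gtn (4 * m)) (x :: y0 :: s1 ++ s2 ++ pts E) ->
  options_in (gtn (4 * m)) vs ->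
  value (m + k.+1)
    ((x, 4 * m) :: column_links m k ++ (4 * (m + k) + 3, y0) :: E)
    (pairings_into (4 * m + 2) (rcons s1 (4 * (m + k) + 1)) s2 :: vs) =
  k.+1 * value m E (pairings_into x s1 (y0 :: s2) :: vs).
Proof.
move=> ks us; rewrite /= !all_cat => /and5P [xm ym /allP s1m /allP s2m Em] vsm.
rewrite /value iotaD map_cat add0n.
set new := map _ (iota m _).
set PI := pairings_into _ _ _; set PI' := pairings_into _ _ _.
set E1 := (x, 4 * m) :: column_links m k.
pose X y := 4 * m <= y.
have gX y : gtn (4 * m) y -> predC X y by rewrite /X /=; lia.
rewrite -catA.
rewrite (@tours_perm _ _ ((new ++ [:: PI]) ++ ([seq pnode 0 q | q <- iota 0 m] ++ vs)));
  last first.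
  by apply/permP => P; rewrite !count_cat /=; clear; lia.
rewrite (_ : _ :: _ = (E1 ++ [:: (4 * (m + k) + 3, y0)]) ++ E); last by rewrite -catA.
rewrite [LHS](@tours_local _ X k.+1 (new ++ [:: PI]) (E1 ++ [:: (4 * (m + k) + 3, y0)])
  [:: PI'] [::] _ E).
- by congr (_ * _); apply: tours_perm; rewrite -cat1s perm_catCA.
- move=> L LX; rewrite -catA.
  pose Y := fun y => (4 * m <= y < 4 * (m + k.+1)) &&
    (y \notin [:: 4 * m + 2; 4 * (m + k) + 3; 4 * (m + k) + 1]).
  have XY y : predC X y -> predC Y y by apply: contra; rewrite /X /Y; lia.
  have gY y : gtn (4 * m) y -> predC Y y by move/gX/XY.
  rewrite (@tours_local _ Y 1 new E1
    [:: column k.+1 x (4 * m + 2) (4 * (m + k) + 3) (4 * (m + k) + 1)] [::]).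
  + rewrite mul1n cat0s.
    pose r := 4 * (m + k) + 3.
    have Lr : r \notin pts L by apply: contraL isT => /(allP LX); rewrite /X /r /=; lia.
    rewrite [LHS](@tours_local _ (pred1 r) 1
      [:: column k.+1 x (4 * m + 2) r (4 * (m + k) + 1)] [:: (r, y0)]
      [:: column k.+1 x (4 * m + 2) y0 (4 * (m + k) + 1)] [::] [:: PI] L).
    * rewrite mul1n cat0s -ks /PI /PI'.
      apply: tours_column_insert => //; first by lia.
      have Lm y : 4 * m <= y -> y \notin pts L.
        by move=> my; apply: contraL my => /(allP LX); rewrite /X.
      have s1' y : 4 * m <= y -> y \notin s1.
        by move=> my; apply: contraL my => /s1m /=; rewrite ltnNge.
      have s2' y : 4 * m <= y -> y \notin s2.
        by move=> my; apply: contraL my => /s2m /=; rewrite ltnNge.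
      rewrite /= !inE !mem_cat !negb_or !Lm ?s1' ?s2' /=; lia.
    * move=> L' L'r; rewrite mul1n [LHS](@tours_column_end _ k.+1 x (4 * m + 2) r _ y0 L') //=;
        rewrite /r; try lia.
      by apply/negP => /(allP L'r) /=; rewrite eqxx.
    * apply: options_in_pairings_into; first by rewrite /r /=; lia.
        rewrite all_rcons /= (_ : _ != r) /=; last by rewrite /r; lia.
        by apply/allP => y /s1m /=; rewrite /r; lia.
      by apply/allP => y /s2m /=; rewrite /r; lia.
    * by apply/allP => y yL; apply: contraNneq Lr => <-.
  + by move=> L' L'Y; rewrite mul1n; apply: tours_pnodes_column.
  + apply: options_in_pairings_into; first by rewrite /Y /= !inE; lia.
      rewrite all_rcons; apply/andP; split; first by rewrite /Y /= !inE; lia.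
      by apply/allP => y /s1m /gY.
    by apply/allP => y /s2m /gY.
  + by rewrite /= (sub_all XY LX) andbT /Y !inE; lia.
- rewrite options_in_cat (sub_options_in gX vsm) andbT.
  by apply: sub_options_in (options_in_pnodes 0 0 m) => y; rewrite /X /=; lia.
- by apply: sub_all Em.
Qed.

(** This ends an insertion: a single remaining candidate needs no switch. *)
Lemma value_cons m E x y s vs :
  value m E (pairings_into x s [:: y] :: vs) =
  value m ((x, y) :: E) (pairings s :: vs).
Proof.
rewrite /value pairings_into1 !tours_mid /= big_map; apply: eq_bigr => p _.
by apply: tours_permE; apply/permP => P; rewrite /= !count_cat /=; clear; lia.
Qed.

Lemma tours_perm_pairings (T : eqType) (s s' : seq T) vs (E : seq (T * T)) :
  uniq s -> perm_eq s s' ->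
  tours (pairings s :: vs) E = tours (pairings s' :: vs) E.
Proof. move=> us p /=; exact: (perm_big_pairings (link_invariant_tours vs E)). Qed.

Lemma tours_perm_pairings_map (T : eqType) I (r : seq I) (f g : I -> seq T) vs
    (E : seq (T * T)) :
  (forall i, uniq (f i) && perm_eq (f i) (g i)) ->
  tours ([seq pairings (f i) | i <- r] ++ vs) E =
  tours ([seq pairings (g i) | i <- r] ++ vs) E.
Proof.
move=> fg; elim: r E => //= i r IH E; case/andP: (fg i) => u p.
rewrite (perm_big_pairings (link_invariant_tours _ E) u p).
by apply: eq_bigr => l _; apply: IH.
Qed.

Lemma value_perm_pairings m E s s' vs : uniq s -> perm_eq s s' ->
  value m E (pairings s :: vs) = value m E (pairings s' :: vs).
Proof. by move=> us p; rewrite /value !tours_mid (tours_perm_pairings _ _ us p). Qed.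

Lemma value_nil m E vs : value m E (pairings [::] :: vs) = value m E vs.
Proof. by rewrite /value tours_mid /= big_seq1. Qed.

(** * Expanding nodes into chains *)

Definition chain_links (m k : nat) : seq (nat * nat) :=
  flatten [seq [:: (4 * q + 2, 4 * q.+1); (4 * q + 3, 4 * q.+1 + 1)]
          | q <- iota m k].

Lemma chain_linksS m k :
  chain_links m k.+1 = chain_links m k ++
    [:: (4 * (m + k) + 2, 4 * (m + k.+1)); (4 * (m + k) + 3, 4 * (m + k.+1) + 1)].
Proof.
by rewrite /chain_links -[in LHS](addn1 k) iotaD map_cat flatten_cat /= (addnS m k).
Qed.

Lemma tours_chain m k L :
  all (predC (fun y => 4 * m + 2 <= y < 4 * (m + k) + 2)) (pts L) ->
  tours [seq pnode 1 q | q <- iota m k.+1] (chain_links m k ++ L) =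
  2 ^ k * tours [:: node k.+1 (4 * m) (4 * m + 1) (4 * (m + k) + 2)
                             (4 * (m + k) + 3)] L.
Proof.
elim: k L => [|k IH] L LX; first by rewrite addn0 mul1n.
set X := (fun y => _) in LX.
pose Y y := 4 * m + 2 <= y < 4 * (m + k) + 2.
have XY y : predC X y -> predC Y y by apply: contra; rewrite /X /Y; lia.
pose L1 := [:: (4 * (m + k) + 2, 4 * (m + k.+1));
  (4 * (m + k) + 3, 4 * (m + k.+1) + 1)].
have -> : iota m k.+2 = iota m k.+1 ++ [:: m + k.+1].
  by rewrite -[k.+2]addn1 iotaD.
rewrite chain_linksS -catA map_cat.
rewrite [LHS](@tours_local _ Y (2 ^ k) [seq pnode 1 q | q <- iota m k.+1] (chain_links m k)
  [:: node k.+1 (4 * m) (4 * m + 1) (4 * (m + k) + 2) (4 * (m + k) + 3)] [::]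
  [:: pnode 1 (m + k.+1)] (L1 ++ L)).
- rewrite expnS mulnAC [RHS]mulnC; congr (_ * _).
  apply: (@tours_series _ k.+1 (4 * m) (4 * m + 1) (4 * (m + k) + 2) (4 * (m + k) + 3)
    (4 * (m + k.+1)) (4 * (m + k.+1) + 1)); apply: (@fresh_by X).
  + rewrite /= !inE; lia.
  + by rewrite /= LX andbT /X; lia.
  + by rewrite /X /=; lia.
- by move=> L' L'Y; apply: IH.
- by apply: sub_options_in (options_in_pnodes 1 (m + k.+1) 1) => y; rewrite /Y /=; lia.
- by rewrite /= (sub_all XY LX) andbT /Y; lia.
Qed.

(* Position of port [x] once every node is expanded into a chain of [t] nodes:
   terminals 0 and 1 stay on the first one, 2 and 3 go to the last one. *)
Definition spread_vertex (t x : nat) := x %/ 4 * t + x %/ 2 %% 2 * t.-1.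
Definition spread (t x : nat) := 4 * spread_vertex t x + x %% 4.

Lemma spread_port t q r : r < 4 ->
  spread t (4 * q + r) = 4 * (q * t + r %/ 2 * t.-1) + r.
Proof.
move=> r4; rewrite /spread /spread_vertex.
have -> : (4 * q + r) %/ 4 = q by lia.
have -> : (4 * q + r) %% 4 = r by lia.
by have -> : (4 * q + r) %/ 2 %% 2 = r %/ 2 by lia.
Qed.

Lemma spread_node t x : 0 < t -> spread_vertex t x %/ t = x %/ 4.
Proof.
move=> t0; rewrite /spread_vertex divnMDl // [_ * _ %/ t]divn_small ?addn0 //.
have: x %/ 2 %% 2 < 2 by rewrite ltn_pmod.
by case: (x %/ 2 %% 2) => [|[|c]] // _; rewrite ?mul0n ?mul1n ?prednK ?leqnn //.
Qed.

Lemma spread_inj t : 0 < t -> injective (spread t).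
Proof.
move=> t0 x y; rewrite /spread => e.
have [ev er] : spread_vertex t x = spread_vertex t y /\ x %% 4 = y %% 4.
  move: (spread_vertex t x) (spread_vertex t y) e => a b; lia.
have := congr1 (divn^~ t) ev; rewrite /= !spread_node // => e4.
by rewrite (divn_eq x 4) (divn_eq y 4) e4 er.
Qed.

(* [i + i %/ t.-1] is the [i]-th node that is not the last one of its chain;
   there is none for [t = 1], where the division is by 0. *)
Definition all_chain_links (t m : nat) : seq (nat * nat) :=
  flatten [seq [:: (4 * q + 2, 4 * q.+1); (4 * q + 3, 4 * q.+1 + 1)]
          | q <- [seq i + i %/ t.-1 | i <- iota 0 (m * t.-1)]].

Lemma all_chain_linksS t m :
  all_chain_links t m.+1 = all_chain_links t m ++ chain_links (m * t.-1.+1) t.-1.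
Proof.
rewrite /all_chain_links mulSn addnC iotaD map_cat map_cat flatten_cat add0n.
congr (_ ++ _); rewrite /chain_links; congr flatten; congr map.
have iE a n : iota a n = [seq a + i | i <- iota 0 n] by rewrite -iotaDl addn0.
case: (t.-1) => [|k] //; rewrite iE [in RHS]iE -map_comp.
apply/eq_in_map => i; rewrite mem_iota => ik /=.
by rewrite divnMDl // divn_small //; lia.
Qed.

(** Ports 0 and 1 stay free only on the first node of a chain, ports 2 and 3 only on the last one;
    the others are taken by chain links. *)
Definition internal_port (t x : nat) : bool :=
  if x %% 4 < 2 then x %/ 4 %% t != 0 else x %/ 4 %% t != t.-1.

Definition chain_node (t q : nat) :=
  node t (4 * (q * t)) (4 * (q * t) + 1) (4 * (q * t + t.-1) + 2)
       (4 * (q * t + t.-1) + 3).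

Lemma options_in_node (T : eqType) (P : pred T) t a1 a2 b1 b2 :
  all P [:: a1; a2; b1; b2] -> options_in P [:: node t a1 a2 b1 b2].
Proof.
move=> /= /and5P [Pa1 Pa2 Pb1 Pb2 _]; rewrite /options_in /= all_nseq /=.
by rewrite Pa1 Pa2 Pb1 Pb2 orbT.
Qed.

Lemma tours_all_chains_rec t m L : 0 < t ->
  all (predC (fun x => internal_port t x && (x < 4 * (m * t)))) (pts L) ->
  tours [seq pnode 1 q | q <- iota 0 (m * t)] (all_chain_links t m ++ L) =
  2 ^ (m * t.-1) * tours [seq chain_node t q | q <- iota 0 m] L.
Proof.
move=> t0; elim: m L => [|m IH] L LX; first by rewrite mul1n.
set X := (fun x => _) in LX.
(* [Y] is the interior of the first [m] chains and [Z] that of the new one; each part is replaced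
   with the other as context. *)
pose Y x := internal_port t x && (x < 4 * (m * t)).
pose Z x := 4 * (m * t) + 2 <= x < 4 * (m * t + t.-1) + 2.
have XY x : predC X x -> predC Y x.
  apply: contra => /andP [xi xm]; apply/andP; split=> //.
  by apply: leq_trans xm _; rewrite leq_mul2l leq_mul.
have XZ x : predC X x -> predC Z x.
  apply: contra => /andP [x1 x2].
  have i1 : m * t <= x %/ 4 by lia.
  have i2 : x %/ 4 <= m * t + t.-1 by lia.
  have xE : x %/ 4 %% t = x %/ 4 - m * t.
    by rewrite -{1}(subnKC i1) modnMDl modn_small //; lia.
  rewrite /X /internal_port xE; apply/andP; split; last by rewrite mulSn; lia.
  by case: ifP => x4; lia.
have iE : iota 0 (m.+1 * t) = iota 0 (m * t) ++ iota (m * t) t.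
  by rewrite mulSn addnC iotaD.
rewrite all_chain_linksS iE map_cat prednK // -catA.
rewrite [LHS](@tours_local _ Y (2 ^ (m * t.-1)) _ _
  [seq chain_node t q | q <- iota 0 m] [::] _ (chain_links (m * t) t.-1 ++ L)).
- rewrite cat0s (tours_perm _ (permEl (perm_catC _ _))).
  rewrite [X in _ * X](@tours_local _ Z (2 ^ t.-1) _ (chain_links (m * t) t.-1)
    [:: chain_node t m] [::]).
  + rewrite mulnA -expnD mulSn addnC; congr (_ * _).
    have -> : iota 0 m.+1 = iota 0 m ++ [:: m] by rewrite -[m.+1]addn1 iotaD.
    by rewrite map_cat; apply: tours_perm; rewrite perm_catC.
  + by move=> L' L'Z; have := tours_chain L'Z; rewrite prednK.
  + apply/allP => _ /mapP [q qm ->]; rewrite mem_iota in qm.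
    suff: options_in (predC Z) [:: chain_node t q] by rewrite /options_in /= andbT.
    have q1 : q * t + t <= m * t by rewrite -mulSnr leq_mul2r; lia.
    by apply: options_in_node; rewrite /= /Z; lia.
  + by rewrite (sub_all XZ LX).
- by move=> L' L'Y; apply: IH.
- apply: sub_options_in (options_in_pnodes 1 (m * t) t) => x.
  by rewrite /Y /= => /andP [x1 _]; rewrite negb_and; apply/orP; right; lia.
- rewrite pts_cat all_cat (sub_all XY LX) andbT; apply/allP => x.
  case/ptsP => p /flatten_mapP [q]; rewrite mem_iota => /andP [qm _] pq xp.
  rewrite /Y /= negb_and; apply/orP; right; rewrite -leqNgt.
  by move: pq xp; rewrite inE => /orP [|/predU1P [|//]];
    [move/eqP=> ->|move=> ->]; rewrite !inE /= => /orP [] /eqP ->; lia.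
Qed.

Lemma spread_not_internal t x : 0 < t -> ~~ internal_port t (spread t x).
Proof.
move=> t0; rewrite (divn_eq x 4) [x %/ 4 * 4]mulnC spread_port ?ltn_pmod //.
have : x %% 4 < 4 by rewrite ltn_pmod.
move: (x %/ 4) (x %% 4) => q r r4; rewrite /internal_port.
rewrite [_ %/ 4](_ : _ = q * t + r %/ 2 * t.-1); last by lia.
rewrite [_ %% 4](_ : _ = r); last by lia.
rewrite modnMDl; case: ifP => r2.
  by rewrite (_ : r %/ 2 = 0) ?mul0n ?mod0n //; lia.
rewrite (_ : r %/ 2 = 1); last by lia.
by rewrite mul1n modn_small ?eqxx // prednK.
Qed.

Lemma tours_all_chains t m E : 0 < t ->
  tours [seq pnode 1 q | q <- iota 0 (m * t)]
    ([seq (spread t p.1, spread t p.2) | p <- E] ++ all_chain_links t m) =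
  2 ^ (m * t.-1) * tours [seq pnode t q | q <- iota 0 m] E.
Proof.
move=> t0; rewrite -[tours _ E](tours_map (spread_inj t0)) -map_comp.
rewrite (tours_permE _ (permEl (perm_catC _ _))) tours_all_chains_rec //.
  congr (_ * tours _ _); apply: eq_map => q.
  rewrite /= /pnode /chain_node /node /= map_nseq /=.
  have s0 : spread t (4 * q) = 4 * (q * t).
    by rewrite -[4 * q]addn0 spread_port //= mul0n !addn0.
  by rewrite s0 !spread_port //= !mul1n !mul0n !addn0.
apply/allP => x; rewrite pts_map => /mapP [y _ ->].
by rewrite /= (negPf (spread_not_internal _ t0)).
Qed.

Lemma perm_pts_chain_links m k :
  perm_eq ([:: 4 * m; 4 * m + 1; 4 * (m + k) + 2; 4 * (m + k) + 3] ++
           pts (chain_links m k)) (iota (4 * m) (4 * k.+1)).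
Proof.
elim: k => [|k /permP IH].
  by rewrite addn0 /= !addn1 addn2 addn3.
apply/permP => P; have := IH P.
have -> : iota (4 * m) (4 * k.+2) = iota (4 * m) (4 * k.+1) ++
    [:: 4 * (m + k.+1); 4 * (m + k.+1) + 1; 4 * (m + k.+1) + 2; 4 * (m + k.+1) + 3].
  rewrite [4 * k.+2]mulnS addnC iotaD -mulnDr; congr (_ ++ _).
  by rewrite /= !addn1 addn2 addn3.
rewrite chain_linksS pts_cat !count_cat /=; lia.
Qed.

(** That every port is linked exactly once is what makes the expanded network 4-regular. *)
Lemma perm_pts_all_chains t m E : 0 < t -> perm_eq (pts E) (iota 0 (4 * m)) ->
  perm_eq (pts ([seq (spread t p.1, spread t p.2) | p <- E] ++ all_chain_links t m))
    (iota 0 (4 * (m * t))).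
Proof.
move=> t0 pE; rewrite pts_cat pts_map.
apply: (@perm_trans _ ([seq spread t x | x <- iota 0 (4 * m)] ++ pts (all_chain_links t m))).
  by rewrite perm_cat2r perm_map.
elim: m {pE} => [|m IH]; first by [].
have -> : iota 0 (4 * m.+1) = iota 0 (4 * m) ++ [:: 4 * m; 4 * m + 1; 4 * m + 2; 4 * m + 3].
  by rewrite mulnS addnC iotaD /= add0n !addn1 addn2 addn3.
have -> : iota 0 (4 * (m.+1 * t)) = iota 0 (4 * (m * t)) ++ iota (4 * (m * t)) (4 * t).
  by rewrite (mulSn m t) addnC mulnDr iotaD.
have s0 : spread t (4 * m) = 4 * (m * t).
  by rewrite -[4 * m]addn0 spread_port //= mul0n !addn0.
rewrite map_cat all_chain_linksS pts_cat /= s0 !spread_port //= !mul1n !mul0n !addn0.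
rewrite prednK //; have /permP H2 := perm_pts_chain_links (m * t) t.-1.
rewrite prednK // in H2; apply/permP => P; move/permP/(_ P): IH (H2 P).
rewrite !count_cat /=; lia.
Qed.

(** * Reading a network as a 4-regular multigraph *)

Lemma nth_pts (l : seq (nat * nat)) i (b : bool) :
  nth 0 (pts l) (2 * i + b) = if b then (nth (0, 0) l i).2 else (nth (0, 0) l i).1.
Proof.
elim: l i => [|p l IH] i; first by rewrite !nth_nil; case: b.
case: i => [|i]; first by clear IH; case: b.
have -> : 2 * i.+1 + b = (2 * i + b).+2 by lia.
exact: IH.
Qed.

Lemma size_pts (T : eqType) (l : seq (T * T)) : size (pts l) = 2 * size l.
Proof. by elim: l => //= p l ->; rewrite mulnS. Qed.

Lemma exists_ordinals n (l : seq (nat * nat)) : all (gtn n) (pts l) ->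
  exists es : seq ('I_n * 'I_n), [seq (val uv.1, val uv.2) | uv <- es] = l.
Proof.
elim: l => [|[a b] l IH] /=; first by exists [::].
case/and3P => an bn /IH [es <-].
by exists ((Ordinal an, Ordinal bn) :: es).
Qed.

Lemma num_eulerian_tours_ports (G : multigraph) (lab : edge_end G -> nat)
    (f : 'I_(nvert G) -> seq nat) :
  injective lab ->
  (forall v, uniq (f v) && perm_eq (f v) (map lab (ends_at v))) ->
  num_eulerian_tours G =
  tours [seq pairings (f v) | v <- enum 'I_(nvert G)]
        [seq (lab (i, false), lab (i, true)) | i <- enum (edge G)].
Proof.
move=> linj fP; rewrite num_eulerian_toursE -(tours_map linj).
have := tours_perm_pairings_map (enum 'I_(nvert G)) [::]
  [seq (lab (i, false), lab (i, true)) | i <- enum (edge G)] fP.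
rewrite !cats0 => ->; rewrite -!map_comp; congr tours.
by apply: eq_map => v /=; rewrite pairings_map.
Qed.

Lemma perm_pairings_node (T : eqType) (a1 a2 b1 b2 : T) :
  uniq [:: a1; a2; b1; b2] ->
  perm_eq (pairings [:: a1; a2; b1; b2]) (node 1 a1 a2 b1 b2).
Proof.
rewrite /= !inE !negb_or -!andbA => /and5P [_ _ _ n1 /and3P [n2 n3 _]].
rewrite /pairings /= !eqxx (negPf n1) (negPf n2) (negPf n3) /= !eqxx /=.
by apply/permP => P; rewrite /= /node /=; clear; lia.
Qed.

Lemma mem_ports x q :
  (x \in [:: 4 * q; 4 * q + 1; 4 * q + 2; 4 * q + 3]) = (x %/ 4 == q).
Proof. by rewrite !inE; lia. Qed.

(** Vertices are the blocks of four ports and edges are the links, the end [(i, b)] carrying entry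
    [2 * i + b] of [pts l]. As [pts l] lists every port once, this labelling is a bijection, and the
    pairings of a block are the three options of a node of weight 1. *)
Lemma exists_query_graph n (l : seq (nat * nat)) :
  perm_eq (pts l) (iota 0 (4 * n)) ->
  exists H : multigraph,
    [/\ encode_graph H = n :: flatten [seq [:: p.1 %/ 4; p.2 %/ 4] | p <- l],
        four_regular H &
        num_eulerian_tours H = tours [seq pnode 1 q | q <- iota 0 n] l].
Proof.
move=> pl.
have [es esE] : exists es : seq ('I_n * 'I_n),
    [seq (val uv.1, val uv.2) | uv <- es] = [seq (p.1 %/ 4, p.2 %/ 4) | p <- l].
  apply: exists_ordinals; rewrite (pts_map (divn^~ 4)); apply/allP => _ /mapP [x xl ->].
  by move: xl; rewrite (perm_mem pl) mem_iota /=; lia.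
have sz : size es = size l.
  rewrite -[size es](size_map (fun uv : 'I_n * 'I_n => (val uv.1, val uv.2))).
  by rewrite esE size_map.
pose H := Multigraph es; exists H.
pose lab (x : edge_end H) := nth 0 (pts l) (2 * x.1 + x.2).
have upl : uniq (pts l) by rewrite (perm_uniq pl) iota_uniq.
have szl : size (pts l) = 2 * size es by rewrite size_pts sz.
have labP (x : edge_end H) : 2 * x.1 + x.2 < size (pts l).
  by rewrite szl; have := ltn_ord x.1; case: (x.2) => /=; lia.
have labI : injective lab.
  move=> x y /eqP; rewrite /lab nth_uniq // => /eqP.
  case: x y {labP} => [i b] [j c] /= e.
  have ij : i = j by apply: val_inj => /=; case: b e; case: c => /=; lia.
  by congr pair => //; case: b e; case: c => /=; rewrite ij //; lia.
have vlab (x : edge_end H) : vertex_of x = lab x %/ 4 :> nat.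
  case: x labP => i b _; rewrite /lab nth_pts /vertex_of /=.
  have -> : tnth (in_tuple (edges H)) i = nth (tnth (in_tuple (edges H)) i) es i.
    exact: tnth_nth.
  have := congr1 (fun s => nth (0, 0) s i) esE.
  rewrite (nth_map (tnth (in_tuple (edges H)) i)) ?ltn_ord //.
  by rewrite (nth_map (0, 0)) -?sz ?ltn_ord // => [[e1 e2]]; case: b.
pose f (v : 'I_(nvert H)) := [:: 4 * v; 4 * v + 1; 4 * v + 2; 4 * v + 3].
have uf v : uniq (f v) by rewrite /f /= !inE; lia.
have fP v : uniq (f v) && perm_eq (f v) (map lab (ends_at v)).
  rewrite uf; apply: uniq_perm => //.
    by rewrite (map_inj_uniq labI) filter_uniq // enum_uniq.
  move=> x; apply/idP/mapP => [xf|[y]]; last first.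
    by rewrite mem_ends_at -val_eqE /= vlab => yv ->; rewrite mem_ports.
  have xv : x %/ 4 = v by apply/eqP; rewrite -mem_ports.
  have xl : x \in pts l.
    have vn : v < n := ltn_ord v.
    by rewrite (perm_mem pl) mem_iota add0n /=; clear -xv vn; lia.
  have ix : index x (pts l) < size (pts l) by rewrite index_mem.
  have i2 : index x (pts l) %/ 2 < size (edges H) by move: ix; rewrite szl /=; lia.
  pose y : edge_end H := (Ordinal i2, odd (index x (pts l))).
  have labE : lab y = x.
    rewrite /lab /=.
    have -> : 2 * (index x (pts l) %/ 2) + odd (index x (pts l)) = index x (pts l).
      by rewrite mulnC -modn2 -divn_eq.
    by rewrite nth_index.
  exists y => //; by rewrite mem_ends_at -val_eqE /= vlab labE xv.
split.
- rewrite /encode_graph /=; congr (_ :: flatten _).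
  have := congr1 (map (fun p : nat * nat => [:: p.1; p.2])) esE.
  by rewrite -!map_comp.
- apply/forallP => v; rewrite /degree cardsE cardE.
  have -> : enum (fun x : edge_end H => vertex_of x == v) = ends_at v.
    by rewrite /ends_at enumT.
  have /andP [_ /perm_size] := fP v; by rewrite size_map => <-.
- rewrite (num_eulerian_tours_ports labI fP).
  have -> : [seq (lab (i, false), lab (i, true)) | i <- enum (edge H)] = l.
    apply: (@eq_from_nth _ (0, 0)).
      by rewrite size_map size_enum_ord sz.
    move=> i; rewrite size_map size_enum_ord => ies.
    rewrite (nth_map (Ordinal ies)) ?size_enum_ord //.
    by rewrite /lab !nth_pts /= nth_enum_ord //; case: (nth _ _ _).
  have -> : iota 0 n = [seq val v | v <- enum 'I_n] by rewrite val_enum_ord.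
  rewrite -map_comp; elim: (enum _) (l) => //= v r IH l'.
  have p := perm_pairings_node (uf v).
  rewrite (perm_big _ p) /=; apply: eq_bigr => o _; exact: IH.
Qed.

(* The [i]-th half-edge of the input is port [i %% 2] of the node inserted in
   edge [i %/ 2]. *)
Definition half_edge_port (i : nat) : nat := 4 * (i %/ 2) + (i - 2 * (i %/ 2)).

(** Entry 0 of the input is the number of vertices, so half-edge [i] is found at entry [i.+1]. *)
Definition ports_at (w : word) (n v : nat) : seq nat :=
  [seq half_edge_port i | i <- iota 0 n & nth 0 w i.+1 == v].

Lemma half_edge_port_inj : injective half_edge_port.
Proof. by move=> i j; rewrite /half_edge_port; lia. Qed.

Lemma uniq_ports_at w n v : uniq (ports_at w n v).
Proof. by rewrite (map_inj_uniq half_edge_port_inj) filter_uniq // iota_uniq. Qed.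

(** * The input graph in terms of ports *)

Section Input.
Variable G : multigraph.
Let w := encode_graph G.
Let E0 := size (edges G).

Lemma flatten_pairs (l : seq (nat * nat)) : flatten [seq [:: p.1; p.2] | p <- l] = pts l.
Proof. by rewrite ptsE. Qed.

Lemma encode_graphE :
  w = nvert G :: pts [seq (val uv.1, val uv.2) | uv <- edges G].
Proof. by rewrite /w /encode_graph -flatten_pairs -map_comp. Qed.

Lemma size_encode_graph : size w = (2 * E0).+1.
Proof. by rewrite encode_graphE /= size_pts size_map. Qed.

Let pos (x : edge_end G) : nat := 2 * x.1 + x.2.

Lemma nth_encode_graph x : nth 0 w (pos x).+1 = vertex_of x.
Proof.
case: x => i b; rewrite encode_graphE /= nth_pts /vertex_of /=.
rewrite (nth_map (tnth (in_tuple (edges G)) i)) ?ltn_ord //.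
by rewrite -[nth _ (edges G) i](tnth_nth _ (in_tuple (edges G))) /=; case: b.
Qed.

Lemma pos_lt x : pos x < 2 * E0.
Proof. by have := ltn_ord x.1; rewrite /pos /E0; case: (x.2) => /=; lia. Qed.

Lemma pos_inj : injective pos.
Proof.
move=> [i b] [j c]; rewrite /pos /= => e.
have ij : i = j by apply: val_inj => /=; case: b e; case: c => /=; lia.
by congr pair => //; case: b e; case: c => /=; rewrite ij //; lia.
Qed.

Lemma pos_surj i : i < 2 * E0 -> exists x, pos x = i.
Proof.
move=> iE; have i2 : i %/ 2 < size (edges G) by rewrite -/E0; lia.
exists (Ordinal i2, odd i : bool); rewrite /pos /=.
by rewrite mulnC -modn2 -divn_eq.
Qed.

Lemma perm_ports_at (v : 'I_(nvert G)) :
  perm_eq (ports_at w (2 * E0) v) [seq half_edge_port (pos x) | x <- ends_at v].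
Proof.
rewrite /ports_at [X in perm_eq _ X]map_comp; apply: perm_map.
apply: uniq_perm.
- by rewrite filter_uniq // iota_uniq.
- by rewrite (map_inj_uniq pos_inj) filter_uniq // enum_uniq.
move=> i; rewrite mem_filter mem_iota add0n leq0n andTb.
apply/andP/mapP => [[/eqP vi /pos_surj [x xi]]|[x]].
  exists x => //; rewrite mem_ends_at; apply/eqP/val_inj.
  by rewrite /= -nth_encode_graph xi.
by rewrite mem_ends_at => /eqP <- ->; rewrite nth_encode_graph pos_lt.
Qed.

Lemma num_eulerian_tours_input :
  num_eulerian_tours G =
  tours [seq pairings (ports_at w (2 * E0) v) | v <- iota 0 (nvert G)]
        [seq (4 * e, 4 * e + 1) | e <- iota 0 E0].
Proof.
have inj : injective (fun x => half_edge_port (pos x)).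
  by move=> x y /half_edge_port_inj /pos_inj.
rewrite (@num_eulerian_tours_ports _ _ (fun v => ports_at w (2 * E0) (val v)) inj); last first.
  by move=> v; rewrite uniq_ports_at perm_ports_at.
rewrite -[iota 0 (nvert G)]val_enum_ord -[iota 0 E0]val_enum_ord -!map_comp.
congr tours; apply: eq_map => i /=; rewrite /half_edge_port /pos /=.
case: i => i _ /=; congr pair; clear; lia.
Qed.

Lemma odd_ports_at v : eulerian G -> v < nvert G -> ~~ odd (size (ports_at w (2 * E0) v)).
Proof.
move=> /andP [_ /forallP ev] vG; have := ev (Ordinal vG).
rewrite (perm_size (perm_ports_at (Ordinal vG))) size_map /degree cardsE cardE.
by rewrite /ends_at enumT.
Qed.

(** This keeps the loop over the vertices polynomial, their number being given in binary. In a
    connected graph with at least two vertices each vertex lies on an edge, so there are at most as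
    many vertices as edge-ends. *)
Lemma nvert_le_size : eulerian G -> nvert G <= size w.
Proof.
move=> /andP [/forallP co _]; rewrite size_encode_graph.
have [|n1] := leqP (nvert G) 1; first by case: (nvert G) => [|[|]].
have ex (v : 'I_(nvert G)) : exists x, vertex_of x = v.
  have [u uv] : exists u : 'I_(nvert G), u != v.
    have n0 : 0 < nvert G by apply: leq_trans n1.
    have [->|] := eqVneq v (Ordinal n0); last by exists (Ordinal n0); rewrite eq_sym.
    by exists (Ordinal n1); rewrite -val_eqE.
  have /forallP /(_ u) /connectP [[|y p] /=] := co v.
    by move=> _ e; rewrite e eqxx in uv.
  by case/andP => /existsP [x /andP [/eqP xv _]] _ _; exists x.
have : #|'I_(nvert G)| <= #|[set vertex_of x | x : edge_end G]|.
  apply: subset_leq_card; apply/subsetP => v _; apply/imsetP.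
  by have [x xv] := ex v; exists x.
rewrite card_ord => /leq_trans; apply; apply: leq_trans (leq_imset_card _ _) _.
by rewrite card_prod card_ord card_bool mulnC ltnW.
Qed.

Lemma size_ports_at v : size (ports_at w (2 * E0) v) <= 2 * E0.
Proof.
by rewrite size_map size_filter (leq_trans (count_size _ _)) // size_iota.
Qed.

Lemma perm_ports :
  perm_eq (pts [seq (4 * q + 2, 4 * q + 3) | q <- iota 0 E0] ++
           flatten [seq ports_at w (2 * E0) v | v <- iota 0 (nvert G)])
          (iota 0 (4 * E0)).
Proof.
have p1 : perm_eq (flatten [seq ports_at w (2 * E0) v | v <- iota 0 (nvert G)])
    [seq half_edge_port i | i <- iota 0 (2 * E0)].
  have -> : [seq ports_at w (2 * E0) v | v <- iota 0 (nvert G)] =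
      [seq [seq half_edge_port i | i <- s] | s <-
        [seq [seq i <- iota 0 (2 * E0) | nth 0 w i.+1 == v] | v <- iota 0 (nvert G)]].
    by rewrite -map_comp.
  rewrite -map_flatten; apply: perm_map; apply: uniq_perm.
  - by apply: uniq_flatten_fibers; apply: iota_uniq.
  - exact: iota_uniq.
  move=> i; apply/flatten_mapP/idP => [[v _]|iE]; first by rewrite mem_filter => /andP [].
  exists (nth 0 w i.+1); last by rewrite mem_filter eqxx.
  rewrite mem_iota add0n in iE; have [x <-] := pos_surj iE.
  by rewrite nth_encode_graph mem_iota ltn_ord.
apply/permP => P; rewrite count_cat (permP p1 P) count_map.
elim: E0 => [//|n IH].
have -> : iota 0 (4 * n.+1) = iota 0 (4 * n) ++ [:: 4 * n; 4 * n + 1; 4 * n + 2; 4 * n + 3].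
  by rewrite (mulnS 4 n) addnC iotaD /= add0n !addn1 addn2 addn3.
have -> : iota 0 (2 * n.+1) = iota 0 (2 * n) ++ [:: 2 * n; 2 * n + 1].
  by rewrite (mulnS 2 n) addnC iotaD /= add0n !addn1.
have -> : iota 0 n.+1 = iota 0 n ++ [:: n] by rewrite -addn1 iotaD.
rewrite map_cat pts_cat !count_cat -IH /= /half_edge_port.
have -> : 4 * (2 * n %/ 2) + (2 * n - 2 * (2 * n %/ 2)) = 4 * n by lia.
have -> : 4 * ((2 * n + 1) %/ 2) + (2 * n + 1 - 2 * ((2 * n + 1) %/ 2)) = 4 * n + 1 by lia.
by clear; lia.
Qed.

End Input.

(** * Polynomial extrapolation *)

Section Differences.
Import GRing.Theory.
Local Open Scope ring_scope.
Implicit Types (f g : nat -> int).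

Definition diff f : nat -> int := fun x => f x.+1 - f x.

Lemma eq_iter_diff d f g : f =1 g -> iter d diff f =1 iter d diff g.
Proof. by move=> fg; elim: d => //= d IH x; rewrite /diff !IH. Qed.

Lemma iter_diffD d f g x :
  iter d diff (fun x => f x + g x) x = iter d diff f x + iter d diff g x.
Proof. by elim: d x => //= d IH x; rewrite /diff !IH opprD addrACA. Qed.

Lemma iter_diff_shift d f x : iter d diff (f \o succn) x = iter d diff f x.+1.
Proof. by elim: d x => //= d IH x; rewrite /diff !IH. Qed.

Lemma iter_diffS d f : iter d diff f =1 (fun=> 0) -> iter d.+1 diff f =1 (fun=> 0).
Proof. by move=> H x; rewrite /= /diff !H subrr. Qed.

(** By the product rule the difference of [x * f x] is [x * diff f x + f x.+1], so a factor [x]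
    raises the degree by at most one. *)
Lemma iter_diffX d f : iter d diff f =1 (fun=> 0) ->
  iter d.+1 diff (fun x => x%:R * f x) =1 (fun=> 0).
Proof.
elim: d f => [|d IH] f H x.
  have H' y : f y = 0 := H y.
  by rewrite /= /diff !H' !mulr0 subrr.
have E : diff (fun x => x%:R * f x) =1 (fun x => x%:R * diff f x + (f \o succn) x).
  move=> y; rewrite /diff /= mulrBr -natr1 mulrDl mul1r addrAC; congr (_ + _).
rewrite iterSr (eq_iter_diff _ E) iter_diffD IH ?add0r; last first.
  by move=> y; rewrite -iterSr.
by rewrite iter_diff_shift.
Qed.

Lemma iter_diff_sum d f x : iter d diff f x =
  \sum_(i < d.+1) (-1) ^+ (d - i) * 'C(d, i)%:R * f (x + i)%N.
Proof.
elim: d x => [|d IH] x.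
  by rewrite big_ord1 subn0 expr0 bin0 !mul1r addn0.
have E : \sum_(i < d.+1) (-1) ^+ (d - i) * 'C(d, i)%:R * f (x + i)%N =
  (-1) ^+ d * f x -
  \sum_(i < d.+1) (-1) ^+ (d - i) * 'C(d, i.+1)%:R * f (x.+1 + i)%N.
  rewrite big_ord_recl /= subn0 bin0 mulr1 addn0; congr (_ + _).
  rewrite [in RHS]big_ord_recr /= bin_small // mulr0 mul0r addr0 -sumrN.
  apply: eq_bigr => i _; rewrite /bump /= add1n addSnnS -!mulNr; congr (_ * _ * _).
  by rewrite -[(d - i)%N]prednK ?subn_gt0 // -subnS exprS mulN1r opprK.
rewrite /= /diff !IH E [RHS]big_ord_recl /= subn0 bin0 mulr1 addn0 exprS mulN1r.
rewrite mulNr opprB addrA addrC; congr (_ + _).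
rewrite -big_split /=; apply: eq_bigr => i _.
by rewrite /bump /= add1n subSS binS natrD addSnnS mulrDr mulrDl addrC.
Qed.

(* [p - n] is the alternating sum of [x 1, .., x j] ending with [+ x j]. *)
Fixpoint alternate (x : nat -> nat) (j : nat) : nat * nat :=
  if j is j'.+1 then
    ((alternate x j').2 + x j, (alternate x j').1)%N
  else (0, 0)%N.

Lemma alternateE x j :
  (alternate x j).1%:Z - (alternate x j).2%:Z =
  \sum_(i < j) (-1) ^+ (j.-1 - i) * (x i.+1)%:Z.
Proof.
elim: j => [|j IH]; first by rewrite big_ord0.
rewrite [alternate x j.+1]/= big_ord_recr /= subnn expr0 mul1r.
rewrite PoszD addrAC; congr (_ + _).
rewrite -opprB IH -sumrN; apply: eq_bigr => i _; rewrite -mulNr; congr (_ * _).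
have ij := ltn_ord i; have -> : (j - i = (j.-1 - i).+1)%N by lia.
by rewrite exprS mulN1r.
Qed.

(* The hypothesis says that [P] is a polynomial of degree at most [m]. *)
Lemma alternate_extrapolate m (P : nat -> nat) p n :
  iter m.+1 diff (fun t => (P t)%:Z) =1 (fun=> 0) ->
  alternate (fun j => 'C(m.+1, j) * P j)%N m.+1 = (p, n) ->
  ((p - n) + (n - p))%N = P 0%N.
Proof.
move=> D A; have := alternateE (fun j => 'C(m.+1, j) * P j)%N m.+1.
rewrite A => E; move: (D 0%N).
rewrite iter_diff_sum big_ord_recl /= subn0 bin0 mulr1 addn0.
under eq_bigr => i _ do rewrite /bump /= add1n subSS add0n -mulrA natz -PoszM.
(* The vanishing difference says that [p - n] is [P 0] up to sign. As [P 0] is a natural number, the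
   absolute value, written as a sum of truncated differences, recovers it. *)
by rewrite -E /= -signr_odd; case: odd; rewrite ?expr0 ?expr1 ?mulN1r ?mul1r; clear; lia.
Qed.

End Differences.

(** In the sum over the states of a node only the turn carries a factor [t], so each node raises the
    degree by at most one. *)
Lemma iter_diff_tours r E :
  iter (size r).+1 diff (fun t => Posz (tours [seq pnode t q | q <- r] E)) =1
  (fun=> 0%R).
Proof.
elim: r E => [|q r IH] E x; first by rewrite /= /diff GRing.subrr.
pose F l := fun t => Posz (tours [seq pnode t q | q <- r] (l ++ E)).
rewrite (@eq_iter_diff _ _ (fun t => (F [:: (4 * q, 4 * q + 2); (4 * q + 1, 4 * q + 3)] t
  + F [:: (4 * q, 4 * q + 3); (4 * q + 1, 4 * q + 2)] t
  + t%:R * F [:: (4 * q, 4 * q + 1); (4 * q + 2, 4 * q + 3)] t)%R)); last first.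
  move=> t; rewrite [tours _ _]/= big_node !PoszD PoszM; congr (_ + _)%R.
  by rewrite natz.
have IHF l : iter (size r).+1 diff (F l) =1 (fun=> 0%R) by apply: IH.
by rewrite 2!iter_diffD !(iter_diffS (IHF _)) (iter_diffX (IHF _)) !GRing.addr0.
Qed.

(** * Cost of programs *)

Lemma ltn_exp_bitlen n : n < 2 ^ bitlen n.
Proof. exact: trunc_log_ltn. Qed.

Lemma bitlen_le n k : 0 < k -> (bitlen n <= k) = (n < 2 ^ k).
Proof.
move=> k0; apply/idP/idP => [nk|].
  by apply: leq_trans (ltn_exp_bitlen n) _; rewrite leq_exp2l.
case: n => [|n] nk; first by rewrite /bitlen trunc_log0.
rewrite /bitlen -(ltn_exp2l _ _ (isT : 1 < 2)).
by apply: leq_ltn_trans nk; apply: trunc_logP.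
Qed.

Lemma bitlen_mono m n : m <= n -> bitlen m <= bitlen n.
Proof.
by move=> mn; rewrite bitlen_le // (leq_ltn_trans mn) // ltn_exp_bitlen.
Qed.

Lemma bitlen_binop o m n : bitlen (binop_sem o m n) <= bitlen m + bitlen n.
Proof.
have m1 := ltn_exp_bitlen m; have n1 := ltn_exp_bitlen n.
case: o => /=.
- rewrite bitlen_le // expnD.
  have := expn_gt0 2 (trunc_log 2 m); have := expn_gt0 2 (trunc_log 2 n).
  move: m1 n1; rewrite /bitlen !expnS; move: (2 ^ _) (2 ^ _) => p q; nia.
- by apply: leq_trans (bitlen_mono (leq_subr n m)) _; apply: leq_addr.
- rewrite bitlen_le // expnD; case: (posnP n) => [->|n0].
    by rewrite muln0 muln_gt0 !expn_gt0.
  apply: (@leq_trans (2 ^ bitlen m * n)); first by rewrite ltn_mul2r n0.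
  by rewrite leq_mul2l ltnW ?orbT.
- by apply: leq_trans (bitlen_mono (leq_div m n)) _; apply: leq_addr.
Qed.

(* Factors such that, in a store whose cells have at most [b] bits, the value
   of [e] has at most [width e * b] bits and its cost is at most [work e * b]. *)
Fixpoint width (e : expr) : nat :=
  match e with
  | Const n => bitlen n
  | Get _ _ => 1
  | Op _ e1 e2 => width e1 + width e2
  end.

Fixpoint work (e : expr) : nat :=
  width e +
  match e with
  | Const _ => 0
  | Get _ e1 => work e1
  | Op _ e1 e2 => work e1 + work e2
  end.

(* The same for a command all of whose loops and queries have at most [N]
   rounds or cells. *)
Fixpoint effort (N : nat) (c : cmd) : nat :=
  match c with
  | Skip => 1
  | Set_ _ e1 e2 => work e1 + work e2
  | Seq c1 c2 => effort N c1 + effort N c2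
  | If e c1 c2 => work e + effort N c1 + effort N c2
  | While e c => N * (work e + effort N c) + work e
  | Ask _ e1 _ e2 => work e1 + work e2 + N + 1
  end.

Fixpoint depth (c : cmd) : nat :=
  match c with
  | Skip => 0
  | Set_ _ e1 e2 => 0
  | Seq c1 c2 => maxn (depth c1) (depth c2)
  | If e c1 c2 => maxn (depth c1) (depth c2)
  | While e c => (depth c).+1
  | Ask _ e1 _ e2 => 1
  end.

(** Only loops and queries depend on [N], so the nesting depth bounds the degree. *)
Lemma effort_poly N c : 0 < N -> effort N c <= effort 1 c * N ^ depth c.
Proof.
move=> N0; have mono d d' x y : x <= y * N ^ d -> d <= d' -> x <= y * N ^ d'.
  by move=> xy dd; apply: leq_trans xy _; rewrite leq_mul2l leq_pexp2l ?orbT.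
elim: c => //=.
- by move=> _ e1 e2; rewrite muln1.
- move=> c1 IH1 c2 IH2; rewrite mulnDl leq_add //.
    by apply: mono IH1 _; apply: leq_maxl.
  by apply: mono IH2 _; apply: leq_maxr.
- move=> e c1 IH1 c2 IH2; rewrite !mulnDl !leq_add //.
  + by rewrite leq_pmulr // expn_gt0 N0.
  + by apply: mono IH1 _; apply: leq_maxl.
  + by apply: mono IH2 _; apply: leq_maxr.
- move=> e c IH; rewrite mul1n expnS mulnDl leq_add //; last first.
    by rewrite leq_pmulr // muln_gt0 N0 expn_gt0 N0.
  rewrite mulnCA leq_mul2l mulnDl leq_add ?orbT //.
  by rewrite leq_pmulr // expn_gt0 N0.
- by move=> _ e1 _ e2; rewrite expn1 !mulnDl !mul1n !leq_add // leq_pmulr.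
Qed.

Definition bounded (b : nat) (s : store) : Prop := forall a i, s a i < 2 ^ b.

Section Bounds.
Variables (b : nat) (s : store).
Hypotheses (b0 : 0 < b) (sb : bounded b s).

Lemma bitlen_eval e : bitlen (eval s e) <= width e * b.
Proof.
elim: e => [n|a e _|o e1 IH1 e2 IH2] /=.
- by rewrite leq_pmulr.
- by rewrite mul1n bitlen_le.
- by rewrite mulnDl; apply: leq_trans (bitlen_binop _ _ _) (leq_add IH1 IH2).
Qed.

Lemma eval_cost_work e : eval_cost s e <= work e * b.
Proof.
elim: e => [n|a e IH|o e1 IH1 e2 IH2] /=; rewrite mulnDl.
- by apply: leq_add => //; apply: (bitlen_eval (Const n)).
- by apply: leq_add => //; apply: (bitlen_eval (Get a e)).
- rewrite [(work e1 + _) * _]mulnDl.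
  exact: leq_add (bitlen_eval (Op o e1 e2)) (leq_add IH1 IH2).
Qed.

Lemma wordlen_segment a n : wordlen (segment s a n) <= n * b.
Proof.
rewrite /wordlen /segment /mkseq -map_comp; elim: n => [//|n IH].
rewrite -addn1 iotaD map_cat sumn_cat /= add0n addn0 mulnDl mul1n.
by apply: leq_add IH _; rewrite bitlen_le.
Qed.

End Bounds.

Lemma bounded_update b s a i n :
  bounded b s -> n < 2 ^ b -> bounded b (update s a i n).
Proof. by move=> sb nb c j; rewrite /update; case: ifP. Qed.

(** * Weakest preconditions with running time *)

Section Wp.
Variables (O : word -> nat) (b N : nat).
Hypothesis b0 : 0 < b.

(** The time bound is read off the text of [c]. For a program it remains to show that all cells stay
    below [2 ^ b] and that the lengths of loops and queries stay within [N]. *)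
Definition wp (c : cmd) (Q : store -> Prop) (s : store) : Prop :=
  exists t s', [/\ exec O c s t s', t <= effort N c * b, bounded b s' & Q s'].

Lemma wp_skip (Q : store -> Prop) s : bounded b s -> Q s -> wp Skip Q s.
Proof. by move=> sb Qs; exists 1, s; split=> //; [apply: exec_skip|rewrite mul1n]. Qed.

Lemma wp_set a e1 e2 (Q : store -> Prop) s :
  bounded b s -> eval s e2 < 2 ^ b ->
  (bounded b (update s a (eval s e1) (eval s e2)) ->
   Q (update s a (eval s e1) (eval s e2))) ->
  wp (Set_ a e1 e2) Q s.
Proof.
move=> sb eb Qs; have sb' := bounded_update a (eval s e1) sb eb.
exists (eval_cost s e1 + eval_cost s e2), (update s a (eval s e1) (eval s e2)).
split=> //; [exact: exec_set| |exact: Qs].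
by rewrite /= mulnDl leq_add // eval_cost_work.
Qed.

Lemma wp_seq c1 c2 (Q : store -> Prop) s :
  wp c1 (fun s' => wp c2 Q s') s -> wp (Seq c1 c2) Q s.
Proof.
move=> [t1 [s1 [H1 T1 _ [t2 [s2 [H2 T2 B2 Q2]]]]]].
exists (t1 + t2), s2; split=> //; first exact: exec_seq H1 H2.
by rewrite /= mulnDl leq_add.
Qed.

Lemma wp_if e c1 c2 (Q : store -> Prop) s : bounded b s ->
  (eval s e != 0 -> wp c1 Q s) -> (eval s e = 0 -> wp c2 Q s) ->
  wp (If e c1 c2) Q s.
Proof.
move=> sb H1 H2; have ew := eval_cost_work b0 sb e.
have [e0|en0] := eqVneq (eval s e) 0.
  have [t [s' [X T B Q']]] := H2 e0.
  exists (eval_cost s e + t), s'; split=> //; first by apply: exec_if; rewrite e0.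
  by rewrite /= !mulnDl -addnA leq_add // (leq_trans T) // leq_addl.
have [t [s' [X T B Q']]] := H1 en0.
exists (eval_cost s e + t), s'; split=> //; first by apply: exec_if; rewrite en0.
by rewrite /= !mulnDl -addnA leq_add // (leq_trans T) // leq_addr.
Qed.

(** The invariant is indexed by the completed rounds and [n] is their exact final number, which
    settles termination and cost at once. *)
Lemma wp_while e c (I : nat -> store -> Prop) n (Q : store -> Prop) s :
  n <= N -> bounded b s -> I 0 s ->
  (forall k s, k < n -> bounded b s -> I k s ->
     eval s e != 0 /\ wp c (I k.+1) s) ->
  (forall s, bounded b s -> I n s -> eval s e = 0 /\ Q s) ->
  wp (While e c) Q s.
Proof.
move=> nN sb I0 step last.
suff H d k s0 : d + k = n -> bounded b s0 -> I k s0 ->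
    exists t s', [/\ exec O (While e c) s0 t s',
      t <= (d * (work e + effort N c) + work e) * b, bounded b s' & Q s'].
  have [t [s' [H1 H2 H3 H4]]] := H n 0 s (addn0 n) sb I0.
  exists t, s'; split=> //; apply: leq_trans H2 _ => /=.
  by rewrite leq_mul2r leq_add2r leq_mul2r nN !orbT.
elim: d k s0 => [|d IH] k s0 dk sb0 Ik.
  rewrite -dk add0n in last; have [e0 Qs] := last _ sb0 Ik.
  exists (eval_cost s0 e), s0; split=> //; first exact: exec_while_end.
  by rewrite add0n eval_cost_work.
have kn : k < n by rewrite -dk addSn ltnS leq_addl.
have [en0 [t1 [s1 [X1 T1 B1 I1]]]] := step _ _ kn sb0 Ik.
have [|t2 [s2 [X2 T2 B2 Q2]]] := IH k.+1 s1 _ B1 I1; first by rewrite addnS.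
exists (eval_cost s0 e + t1 + t2), s2; split=> //.
  exact: exec_while_loop X1 X2.
have T0 := eval_cost_work b0 sb0 e.
rewrite mulSn -[_ + work e]addnA mulnDl [(work e + effort N c) * b]mulnDl.
by apply: leq_add T2; apply: leq_add.
Qed.

Lemma wp_ask a e1 c e2 (Q : store -> Prop) s :
  bounded b s -> eval s e1 <= N ->
  O (segment s a (eval s e1)) < 2 ^ b ->
  (bounded b (update s c (eval s e2) (O (segment s a (eval s e1)))) ->
   Q (update s c (eval s e2) (O (segment s a (eval s e1))))) ->
  wp (Ask a e1 c e2) Q s.
Proof.
move=> sb eN Ob Qs; pose w := segment s a (eval s e1).
have sb' := bounded_update c (eval s e2) sb Ob.
exists (eval_cost s e1 + eval_cost s e2 + wordlen w + bitlen (O w)),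
  (update s c (eval s e2) (O w)); split=> //; [exact: exec_ask| |exact: Qs].
rewrite /= !mulnDl !leq_add ?eval_cost_work ?mul1n ?bitlen_le //.
by apply: leq_trans (wordlen_segment b0 sb _ _) _; rewrite leq_mul2r eN orbT.
Qed.

End Wp.

(** * The reduction *)

(* Array numbers; the arrays [v..] only use cell 0.  [vK] collects the factor by
   which the gadgets multiply the number of tours. *)
Notation aW := 0 (only parsing).
Notation aLen := 1 (only parsing).
Notation aA := 2 (only parsing).
Notation aR := 3 (only parsing).
Notation aQ := 4 (only parsing).
Notation vr := 5 (only parsing).
Notation vM := 6 (only parsing).
Notation vK := 7 (only parsing).
Notation vi := 8 (only parsing).
Notation vv := 9 (only parsing).
Notation vh := 10 (only parsing).
Notation vS := 11 (only parsing).
Notation vm := 12 (only parsing).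
Notation vk := 13 (only parsing).
Notation vtwo := 14 (only parsing).
Notation vbin := 15 (only parsing).
Notation vscale := 16 (only parsing).
Notation vj := 17 (only parsing).
Notation vp := 18 (only parsing).
Notation vn := 19 (only parsing).
Notation vtmp := 20 (only parsing).
Notation vans := 21 (only parsing).

Declare Scope expr_scope.
Delimit Scope expr_scope with E.
Bind Scope expr_scope with expr.
Notation "'$' a" := (Get a (Const 0)) (at level 8, a at level 2) : expr_scope.
Notation "a .[ e ]" := (Get a e%E) : expr_scope.
Notation "x + y" := (Op Add x y) : expr_scope.
Notation "x - y" := (Op Defs.Sub x y) : expr_scope.
Notation "x * y" := (Op Mul x y) : expr_scope.
Notation "x / y" := (Op Div x y) : expr_scope.
Notation "# n" := (Const n%N) (at level 7, n at level 2) : expr_scope.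
Notation "a ::= e" := (Set_ a (Const 0) e%E) (at level 60).
Notation "c1 ;; c2" := (Seq c1 c2) (at level 65, right associativity).

Definition emit (e1 e2 : expr) : cmd :=
  Set_ aR ($vr)%E e1 ;; Set_ aR ($vr + #1)%E e2 ;; vr ::= $vr + #2.

(** In the loop tests truncated subtraction serves as strict comparison: it is nonzero exactly while
    the counter is below the bound. *)
Definition edge_phase : cmd :=
  vK ::= #1 ;;
  While (($aLen - #1) / #2 - $vM)%E (
    emit (#4 * $vM + #2) (#4 * $vM + #3) ;;
    vK ::= $vK * #2 ;;
    vM ::= $vM + #1).

Definition gather : cmd :=
  vh ::= #0 ;;
  vi ::= #0 ;;
  While ($aLen - #1 - $vi)%E (
    If ((aW.[$vi + #1] - $vv) + ($vv - aW.[$vi + #1]))%E Skip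
      (Set_ aA ($vh)%E (#4 * ($vi / #2) + ($vi - #2 * ($vi / #2)))%E ;;
       vh ::= $vh + #1) ;;
    vi ::= $vi + #1).

(** A column of [$vm] nodes, numbered from [$vM], is put between the strand [$vS] and the end at
    index [$vi]. Port 2 of its first node becomes the new strand, and port 1 of its last node
    replaces the end in [aA]. *)
Definition add_column : cmd :=
  emit ($vS) (#4 * $vM) ;;
  vS ::= #4 * $vM + #2 ;;
  vk ::= $vm - #1 ;;
  While ($vk)%E (
    emit (#4 * $vM + #3) (#4 * ($vM + #1)) ;;
    emit (#4 * $vM + #1) (#4 * ($vM + #1) + #2) ;;
    vM ::= $vM + #1 ;;
    vk ::= $vk - #1) ;;
  emit (#4 * $vM + #3) (aA.[$vi]) ;;
  Set_ aA ($vi)%E (#4 * $vM + #1)%E ;;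
  vM ::= $vM + #1 ;;
  vK ::= $vK * $vm ;;
  vi ::= $vi + #1 ;;
  vm ::= $vm - #1.

(** The last end is inserted among the others. The loop overwrites the first [$vh - 2] entries of
    [aA] with the ends that remain; the entry after them is the last candidate. *)
Definition match_last : cmd :=
  vS ::= aA.[$vh - #1] ;;
  vi ::= #0 ;;
  vm ::= $vh - #2 ;;
  While ($vm)%E add_column ;;
  emit ($vS) (aA.[$vi]) ;;
  vh ::= $vh - #2.

Definition vertex_phase : cmd :=
  While (aW.[#0] - $vv)%E (
    gather ;;
    While ($vh)%E match_last ;;
    vv ::= $vv + #1).

(** The first loop computes [spread_vertex], with the remainder modulo 2 expressed by division. The
    second one writes the vertices of [all_chain_links] and has no rounds for [$vj] equal to 1. *)
Definition write_query : cmd :=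
  Set_ aQ (#0)%E ($vM * $vj)%E ;;
  vi ::= #0 ;;
  While ($vr - $vi)%E (
    Set_ aQ ($vi + #1)%E
      ((aR.[$vi] / #4) * $vj + (aR.[$vi] / #2 - #2 * (aR.[$vi] / #4)) * ($vj - #1))%E ;;
    vi ::= $vi + #1) ;;
  vi ::= #0 ;;
  While ($vM * ($vj - #1) - $vi)%E (
    Set_ aQ ($vr + #1 + #4 * $vi)%E ($vi + $vi / ($vj - #1))%E ;;
    Set_ aQ ($vr + #2 + #4 * $vi)%E ($vi + $vi / ($vj - #1) + #1)%E ;;
    Set_ aQ ($vr + #3 + #4 * $vi)%E ($vi + $vi / ($vj - #1))%E ;;
    Set_ aQ ($vr + #4 + #4 * $vi)%E ($vi + $vi / ($vj - #1) + #1)%E ;;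
    vi ::= $vi + #1).

Definition power_phase : cmd :=
  vtwo ::= #1 ;;
  vi ::= #0 ;;
  While ($vM - $vi)%E (vtwo ::= $vtwo * #2 ;; vi ::= $vi + #1).

(** The binomial coefficient of M+1 over [$vj] comes from its predecessor by an exact division, and
    [$vscale] is the power of 2 contributed by the M chains of length [$vj]. Without negative
    numbers, the sums of the terms of either sign are kept apart, in [vp] and [vn], and change
    places in each round. *)
Definition query_phase : cmd :=
  vbin ::= #1 ;;
  vscale ::= #1 ;;
  vj ::= #1 ;;
  While ($vM + #2 - $vj)%E (
    vbin ::= $vbin * ($vM + #2 - $vj) / $vj ;;
    write_query ;;
    Ask aQ (#4 * $vM * $vj + #1)%E vans (#0)%E ;;
    vtmp ::= $vn ;;
    vn ::= $vp ;;
    vp ::= $vtmp + $vbin * ($vans / $vscale) ;;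
    vscale ::= $vscale * $vtwo ;;
    vj ::= $vj + #1).

Definition reduction : cmd :=
  edge_phase ;; vertex_phase ;; power_phase ;; query_phase ;;
  Set_ aW (#0)%E ((($vp - $vn) + ($vn - $vp)) / $vK)%E.

(** * Frames and contents of arrays *)

Fixpoint reads (e : expr) : seq nat :=
  match e with
  | Const _ => [::]
  | Get a e1 => a :: reads e1
  | Op _ e1 e2 => reads e1 ++ reads e2
  end.

Definition frame (l : seq nat) (s s' : store) : Prop :=
  forall a i, a \notin l -> s' a i = s a i.

Lemma frame_refl l s : frame l s s.
Proof. by []. Qed.

Lemma frame_trans l s1 s2 s3 : frame l s1 s2 -> frame l s2 s3 -> frame l s1 s3.
Proof. by move=> H1 H2 a i al; rewrite H2 ?H1. Qed.

Lemma frame_sub l l' s s' : all (mem l') l -> frame l s s' -> frame l' s s'.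
Proof.
by move=> /allP sub H a i al; apply: H; apply: contra al => /sub.
Qed.

Lemma frame_update l a i n s : a \in l -> frame l s (update s a i n).
Proof.
move=> al c j cl; rewrite /update; case: (c =P a) => //= ca.
by rewrite ca al in cl.
Qed.

Lemma frame_upd l a i n s s' :
  frame l s s' -> a \in l -> frame l s (update s' a i n).
Proof. by move=> fr al; apply: frame_trans fr (frame_update _ _ _ al). Qed.

Ltac solve_frame :=
  repeat first [assumption | exact: frame_refl | apply: frame_upd => //].

Lemma eval_frame l s s' e :
  all (fun a => a \notin l) (reads e) -> frame l s s' -> eval s' e = eval s e.
Proof.
move=> + fr; elim: e => //= [a e IH /andP [al /IH ->]|o e1 IH1 e2 IH2].
  exact: fr.
by rewrite all_cat => /andP [/IH1 -> /IH2 ->].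
Qed.

Definition holds_seq (s : store) (a : nat) (l : seq nat) : Prop :=
  forall i, i < size l -> s a i = nth 0 l i.

Lemma holds_seq_frame l s s' a t :
  a \notin l -> frame l s s' -> holds_seq s a t -> holds_seq s' a t.
Proof. by move=> al fr H i it; rewrite fr // H. Qed.

Lemma holds_seq_rcons s a t n :
  holds_seq s a t -> holds_seq (update s a (size t) n) a (rcons t n).
Proof.
move=> H i; rewrite size_rcons ltnS leq_eqVlt nth_rcons /update eqxx.
case: (i =P size t) => [->|_] /= it; first by rewrite ltnn.
by rewrite it H.
Qed.

Lemma pts_rcons (l : seq (nat * nat)) p :
  pts (rcons l p) = rcons (rcons (pts l) p.1) p.2.
Proof. by elim: l => //= q l ->. Qed.

(** * Correctness of the construction of the network *)

Section Emit.
Variables (O : word -> nat) (b N : nat).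
Hypothesis b0 : 0 < b.

Lemma wp_emit e1 e2 x y (l : seq (nat * nat)) (Q : store -> Prop) s :
  bounded b s -> s vr 0 = 2 * size l -> holds_seq s aR (pts l) ->
  eval s e1 = x -> eval s e2 = y ->
  all (fun a => a \notin [:: aR; vr]) (reads e2) ->
  x < 2 ^ b -> y < 2 ^ b -> 2 * size l + 2 < 2 ^ b ->
  (forall s', bounded b s' -> frame [:: aR; vr] s s' ->
    s' vr 0 = 2 * size (rcons l (x, y)) ->
    holds_seq s' aR (pts (rcons l (x, y))) -> Q s') ->
  wp O b N (emit e1 e2) Q s.
Proof.
move=> sb sr sR ex ey re xb yb lb H.
apply: wp_seq; apply: wp_set => //=; first by rewrite ex.
rewrite ex => sb1; set s1 := update _ _ _ _ in sb1 *.
have ey1 : eval s1 e2 = y by rewrite -ey; apply: eval_frame re _; apply: frame_update.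
have r1 : s1 vr 0 = 2 * size l by [].
apply: wp_seq; apply: wp_set => //=; first by rewrite ey1.
rewrite ey1 r1 => sb2; set s2 := update _ _ _ _ in sb2 *.
have r2 : s2 vr 0 = 2 * size l by [].
apply: wp_set => //=; rewrite r2 // => sb3.
apply: H => //.
- move=> a i; rewrite !inE negb_or => /andP [a3 a5].
  by rewrite /update (negPf a5) /= /s2 /update (negPf a3) /= /s1 /update (negPf a3).
- by rewrite /update /= size_rcons; lia.
rewrite pts_rcons; apply: holds_seq_frame (_ : frame [:: vr] s2 _) _ => //.
  exact: frame_update.
have H1 := @holds_seq_rcons _ _ _ x sR.
have := @holds_seq_rcons _ _ _ y H1.
by rewrite size_rcons size_pts /s2 /s1 addn1 sr.
Qed.
End Emit.

Lemma ports_atS w k v : ports_at w k.+1 v =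
  if nth 0 w k.+1 == v then rcons (ports_at w k v) (half_edge_port k)
  else ports_at w k v.
Proof.
rewrite /ports_at -[in LHS](addn1 k) iotaD filter_cat map_cat /= add0n.
by case: ifP; rewrite ?cats1 // cats0.
Qed.

Section Gather.
Variables (O : word -> nat) (b N : nat).
Hypotheses (b0 : 0 < b) (Nb : N < 2 ^ b).

Lemma small n : n <= N -> n < 2 ^ b.
Proof. by move=> nN; apply: leq_ltn_trans Nb. Qed.

Lemma wp_gather (w : word) n v (Q : store -> Prop) s :
  bounded b s -> (forall i, s aW i = nth 0 w i) -> s aLen 0 = n.+1 ->
  s vv 0 = v -> 4 * n.+1 <= N ->
  (forall s', bounded b s' -> frame [:: aA; vi; vh] s s' ->
    s' vh 0 = size (ports_at w n v) -> holds_seq s' aA (ports_at w n v) -> Q s') ->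
  wp O b N gather Q s.
Proof.
move=> sb sW sL sv nN H.
have szp k : size (ports_at w k v) <= k.
  by rewrite size_map size_filter (leq_trans (count_size _ _)) // size_iota.
apply: wp_seq; apply: wp_set => //=; first exact: small.
set s1 := update _ _ _ _ => sb1.
apply: wp_seq; apply: wp_set => //=; first exact: small.
set s2 := update _ _ _ _ => sb2.
have fr2 : frame [:: aA; vi; vh] s s2.
  by solve_frame.
pose I k s' := [/\ frame [:: aA; vi; vh] s s', s' vi 0 = k,
  s' vh 0 = size (ports_at w k v) & holds_seq s' aA (ports_at w k v)].
apply: (@wp_while _ _ _ b0 _ _ I n) => //; first by lia.
- move=> k s3 kn sb3 [fr3 i3 h3 A3].
  have W3 i : s3 aW i = nth 0 w i by rewrite fr3.
  have L3 : s3 aLen 0 = n.+1 by rewrite fr3.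
  have v3 : s3 vv 0 = v by rewrite fr3.
  split; first by rewrite /= L3 i3; lia.
  apply: wp_seq; apply: wp_if => //=; rewrite W3 v3 i3 addn1 => wv.
  + apply: wp_skip => //; apply: wp_set => //=; rewrite i3; first by apply: small; lia.
    move=> sb4; split=> //=.
    * by solve_frame.
    * by rewrite /update /= addn1.
    * by rewrite /update /= ports_atS ifN //; lia.
    * rewrite ports_atS ifN; last by lia.
      by apply: holds_seq_frame (_ : frame [:: vi] s3 _) A3 => //; apply: frame_update.
  + have wv' : nth 0 w k.+1 == v by lia.
    apply: wp_seq; apply: wp_set => //=; rewrite ?i3 ?h3.
      by apply: small; lia.
    set s4 := update _ _ _ _ => sb4.
    have i4 : s4 vi 0 = k by [].
    have h4 : s4 vh 0 = size (ports_at w k v) by [].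
    apply: wp_set => //=; rewrite ?h4; first by apply: small; have := szp k; lia.
    set s5 := update _ _ _ _ => sb5.
    have i5 : s5 vi 0 = k by [].
    apply: wp_set => //=; rewrite ?i5; first by apply: small; lia.
    set s6 := update _ _ _ _ => sb6.
    split.
    * by solve_frame.
    * by rewrite /s6 /update /= addn1.
    * by rewrite ports_atS wv' size_rcons /s6 /s5 /update /= addn1.
    * rewrite ports_atS wv'.
      apply: (@holds_seq_frame [:: vi; vh] s4) => //; last exact: holds_seq_rcons.
      by solve_frame.
- move=> s3 sb3 [fr3 i3 h3 A3]; split; last exact: H.
  have L3 : s3 aLen 0 = n.+1 by rewrite fr3.
  by rewrite /= L3 i3; lia.
Qed.

End Gather.

Lemma perm_pts_column_links m k :
  perm_eq ([:: 4 * m; 4 * m + 2; 4 * (m + k) + 3; 4 * (m + k) + 1] ++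
           pts (column_links m k)) (iota (4 * m) (4 * k.+1)).
Proof.
elim: k => [|k /permP IH].
  by apply/permP => P; rewrite addn0 /= !addn1 addn2 addn3; clear; lia.
apply/permP => P; have := IH P.
have -> : iota (4 * m) (4 * k.+2) = iota (4 * m) (4 * k.+1) ++
    [:: 4 * (m + k.+1); 4 * (m + k.+1) + 1; 4 * (m + k.+1) + 2; 4 * (m + k.+1) + 3].
  rewrite [4 * k.+2]mulnS addnC iotaD -mulnDr; congr (_ ++ _).
  by rewrite /= !addn1 addn2 addn3.
rewrite column_linksS pts_cat !count_cat /=; clear; lia.
Qed.

Lemma size_column_links m k : size (column_links m k) = 2 * k.
Proof. by elim: k => // k IH; rewrite column_linksS size_cat IH /= mulnS addnC. Qed.

Lemma options_in_map_pairings (P : pred nat) (rs : seq (seq nat)) :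
  all P (flatten rs) -> options_in P [seq pairings s | s <- rs].
Proof.
move=> /allP Prs; apply/allP => _ /mapP [s srs ->].
suff: options_in P [:: pairings s] by rewrite /options_in /= andbT.
by apply: options_in_pairings; apply/allP => x xs; apply: Prs; apply/flattenP; exists s.
Qed.

Lemma holds_seq_set s a t1 t2 y n : holds_seq s a (t1 ++ y :: t2) ->
  holds_seq (update s a (size t1) n) a (rcons t1 n ++ t2).
Proof.
move=> H i; rewrite size_cat size_rcons addSnnS => it.
rewrite /update eqxx /=; case: (i =P size t1) => [->|/eqP ne].
  by rewrite nth_cat size_rcons ltnSn nth_rcons ltnn eqxx.
rewrite H ?size_cat //= cat_rcons !nth_cat.
by case: ltngtP ne => // lt _; rewrite -(subnKC lt) addSnnS addKn.
Qed.

Section AddColumn.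
Variables (O : word -> nat) (b N Bm : nat) (G : multigraph).
Let w := encode_graph G.
Hypotheses (b0 : 0 < b) (Nb : N < 2 ^ b) (BmN : 4 * Bm + 8 <= N)
  (wN : 4 * size w <= N) (wBm : size w ^ Bm < 2 ^ b).

(* [l] lists the links written so far, [slots] the ports not linked yet; [vs]
   are the pairings of these ports still to be realized. *)
Record progress (s : store) (M K : nat) (l : seq (nat * nat)) (slots : seq nat)
    (vs : seq (seq (seq (nat * nat)))) : Prop := Progress {
  pr_W : forall i, s aW i = nth 0 w i;
  pr_Len : s aLen 0 = size w;
  pr_r : s vr 0 = 2 * size l;
  pr_R : holds_seq s aR (pts l);
  pr_M : s vM 0 = M;
  pr_K : s vK 0 = K;
  pr_perm : perm_eq (pts l ++ slots) (iota 0 (4 * M));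
  pr_value : value M l vs = K * num_eulerian_tours G;
  pr_K0 : 0 < K;
  pr_Kb : K <= size w ^ M
}.

Lemma progress_frame f s s' M K l slots vs :
  all (fun a => a \notin f) [:: aW; aLen; vr; aR; vM; vK] ->
  frame f s s' -> progress s M K l slots vs -> progress s' M K l slots vs.
Proof.
move=> /and5P [f0 f1 f5 f3 /and3P [f6 f7 _]] fr [].
move=> H1 H2 H3 H4 H5 H6 H7 H8 H9 H10; split; rewrite ?fr //.
  by move=> i; rewrite fr.
exact: holds_seq_frame fr H4.
Qed.

Lemma size_progress s M K l slots vs :
  progress s M K l slots vs -> 2 * size l <= 4 * M.
Proof.
move=> pr; have := perm_size (pr_perm pr).
by rewrite size_cat size_pts size_iota => <-; apply: leq_addr.
Qed.

Lemma progress_lt s M K l slots vs : progress s M K l slots vs ->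
  all (gtn (4 * M)) (slots ++ pts l) /\ uniq slots.
Proof.
move=> pr; have p := pr_perm pr; split.
  apply/allP => x xl; have : x \in iota 0 (4 * M).
    by rewrite -(perm_mem p) mem_cat orbC -mem_cat.
  by rewrite mem_iota.
by have := iota_uniq 0 (4 * M); rewrite -(perm_uniq p) cat_uniq => /and3P [].
Qed.

Lemma wp_add_column s M K l x s1 y0 s2 rs k (Q : store -> Prop) :
  bounded b s ->
  progress s M K l (x :: s1 ++ y0 :: s2 ++ flatten rs)
    (pairings_into x s1 (y0 :: s2) :: [seq pairings t | t <- rs]) ->
  size s2 = k.+1 -> s vS 0 = x -> s vm 0 = k.+1 -> s vi 0 = size s1 ->
  holds_seq s aA (s1 ++ y0 :: s2) -> M + k.+1 <= Bm -> k.+1 <= size w -> k <= N ->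
  (forall s' l' x' z, bounded b s' ->
    frame [:: aA; aR; vr; vM; vK; vi; vS; vm; vk] s s' ->
    progress s' (M + k.+1) (K * k.+1) l' (x' :: rcons s1 z ++ s2 ++ flatten rs)
      (pairings_into x' (rcons s1 z) s2 :: [seq pairings t | t <- rs]) ->
    s' vS 0 = x' -> s' vm 0 = k -> s' vi 0 = (size s1).+1 ->
    holds_seq s' aA (rcons s1 z ++ s2) -> Q s') ->
  wp O b N add_column Q s.
Proof.
move=> sb pr sz sS sm si sA MB kw kN H.
have lM := size_progress pr; have [lt u] := progress_lt pr.
have [_ _ sr sR sM sK pp pv K0 Kb] := pr.
have xM : x < 4 * M by move: lt => /= /andP [].
have y0M : y0 < 4 * M.
  by apply: (allP lt); rewrite inE !mem_cat inE eqxx !orbT.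
have s1M : size s1 < 4 * M.
  have := perm_size pp; rewrite size_iota => <-; rewrite !(size_cat, size_pts) /=.
  by rewrite size_cat; clear; lia.
have sm' n : n <= N -> n < 2 ^ b by move=> nN; apply: leq_ltn_trans Nb.
apply: wp_seq; apply: (@wp_emit _ _ _ b0 _ _ x (4 * M)) sr sR _ _ _ _ _ _ _ => //;
  try (by rewrite /= ?sM); try by (apply: sm'; lia).
move=> s3 sb3 fr3 r3 R3.
have M3 : s3 vM 0 = M by rewrite fr3.
have m3 : s3 vm 0 = k.+1 by rewrite fr3.
apply: wp_seq; apply: wp_set => //=; rewrite M3; first by apply: sm'; lia.
set s4 := update _ _ _ _ => sb4.
apply: wp_seq; apply: wp_set => //=; rewrite (_ : s4 vm 0 = k.+1) // subn1.
  by apply: sm'; lia.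
set s5 := update _ _ _ _ => sb5.
apply: wp_seq.
pose lj j := rcons l (x, 4 * M) ++ column_links M j.
have szlj j : 2 * size (lj j) = 2 * size l + 2 + 4 * j.
  by rewrite size_cat size_rcons size_column_links; clear; lia.
pose I j s' := [/\ frame [:: aR; vr; vM; vk] s5 s', s' vM 0 = M + j,
  s' vk 0 = k - j, s' vr 0 = 2 * size (lj j) & holds_seq s' aR (pts (lj j))].
apply: (@wp_while _ _ _ b0 _ _ I k) => //.
- by split; rewrite ?addn0 ?subn0 // /lj /column_links /= ?cats0 //;
    apply: holds_seq_frame R3 => //; solve_frame.
- move=> j s6 jk sb6 [fr6 M6 k6 r6 R6]; split; first by rewrite /= k6; lia.
  apply: wp_seq; apply: (@wp_emit _ _ _ b0 _ _ (4 * (M + j) + 3) (4 * (M + j.+1)))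
    r6 R6 _ _ _ _ _ _ _ => //; try (by rewrite /= ?M6 ?addn1 ?addnS);
    try by (rewrite ?szlj; apply: sm'; lia).
  move=> s7 sb7 fr7 r7 R7; have M7 : s7 vM 0 = M + j by rewrite fr7.
  have k7 : s7 vk 0 = k - j by rewrite fr7.
  apply: wp_seq; apply: (@wp_emit _ _ _ b0 _ _ (4 * (M + j) + 1) (4 * (M + j.+1) + 2))
    r7 R7 _ _ _ _ _ _ _ => //; try (by rewrite /= ?M7 ?addn1 ?addnS);
    try by (rewrite ?size_rcons ?mulnS ?szlj; apply: sm'; lia).
  move=> s8 sb8 fr8 r8 R8; have M8 : s8 vM 0 = M + j by rewrite fr8.
  have k8 : s8 vk 0 = k - j by rewrite fr8.
  apply: wp_seq; apply: wp_set => //=; rewrite M8; first by apply: sm'; lia.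
  set s9 := update _ _ _ _ => sb9.
  apply: wp_set => //=; rewrite (_ : s9 vk 0 = k - j) //; first by apply: sm'; lia.
  set s10 := update _ _ _ _ => sb10.
  have lE : rcons (rcons (lj j) (4 * (M + j) + 3, 4 * (M + j.+1)))
      (4 * (M + j) + 1, 4 * (M + j.+1) + 2) = lj j.+1.
    by rewrite /lj column_linksS -!cats1 -!catA.
  rewrite lE in r8 R8.
  have fr10 : frame [:: aR; vr; vM; vk] s5 s10.
    apply: frame_upd => //; apply: frame_upd => //.
    apply: frame_trans fr6 _; apply: (frame_sub _ (frame_trans fr7 fr8)) => //.
  split=> //.
  + by rewrite /s10 /s9 /update /= addn1 addnS.
  + by rewrite /s10 /update /= subn1 subnS.
move=> s6 sb6 [fr6 M6 k6 r6 R6]; split; first by rewrite /= k6 subnn.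
have f56 : frame [:: aR; vr; vM; vS; vk] s s6.
  apply: (@frame_trans _ _ s5); last exact: frame_sub fr6.
  apply: (@frame_upd _ vk) => //; apply: (@frame_upd _ vS) => //.
  exact: frame_sub fr3.
have i6 : s6 vi 0 = size s1 by rewrite f56.
have m6 : s6 vm 0 = k.+1 by rewrite f56.
have A6 : holds_seq s6 aA (s1 ++ y0 :: s2) by apply: holds_seq_frame f56 sA.
have A6i : s6 aA (size s1) = y0.
  by rewrite A6 ?size_cat /= ?nth_cat ?ltnn ?subnn //; lia.
apply: wp_seq; apply: (@wp_emit _ _ _ b0 _ _ (4 * (M + k) + 3) y0)
  r6 R6 _ _ _ _ _ _ _ => //; try (by rewrite /= ?M6 ?i6 ?A6i);
  try by (rewrite ?szlj; apply: sm'; lia).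
move=> s7 sb7 fr7 r7 R7.
have f7 : frame [:: aR; vr; vM; vS; vk] s s7.
  by apply: frame_trans f56 _; apply: frame_sub fr7.
have i7 : s7 vi 0 = size s1 by rewrite f7.
have m7 : s7 vm 0 = k.+1 by rewrite f7.
have M7 : s7 vM 0 = M + k by rewrite fr7.
have K7 : s7 vK 0 = K by rewrite f7.
have A7 : holds_seq s7 aA (s1 ++ y0 :: s2) by apply: holds_seq_frame f7 sA.
pose z := 4 * (M + k) + 1.
apply: wp_seq; apply: wp_set => //=; rewrite M7 ?i7; first by apply: sm'; lia.
set s8 := update _ _ _ _ => sb8.
apply: wp_seq; apply: wp_set => //=; rewrite (_ : s8 vM 0 = M + k) //.
  by apply: sm'; lia.
set s9 := update _ _ _ _ => sb9.
(* The column multiplies [K] by [k.+1 <= size w] and also adds [k.+1] nodes, so the exponent keeps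
   pace. This bounds the bit length of [K]. *)
have Kb' : K * k.+1 <= size w ^ (M + k.+1).
  rewrite expnD leq_mul //; apply: leq_trans kw _.
  by rewrite -{1}(expn1 (size w)) leq_pexp2l // (leq_trans _ kw).
have KB : K * k.+1 < 2 ^ b.
  apply: leq_ltn_trans Kb' _; apply: leq_ltn_trans wBm.
  by rewrite leq_pexp2l // (leq_trans _ kw).
have K9 : s9 vK 0 = K := K7.
have m9 : s9 vm 0 = k.+1 := m7.
apply: wp_seq; apply: wp_set => //=; rewrite K9 m9 //.
set s10 := update _ _ _ _ => sb10.
apply: wp_seq; apply: wp_set => //=; rewrite (_ : s10 vi 0 = size s1) //.
  by apply: sm'; lia.
set s11 := update _ _ _ _ => sb11.
apply: wp_set => //=; rewrite (_ : s11 vm 0 = k.+1) //; first by apply: sm'; lia.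
set s12 := update _ _ _ _ => sb12.
have f12 : frame [:: aA; vM; vK; vi; vm] s7 s12 by solve_frame.
have fs : frame [:: aA; aR; vr; vM; vK; vi; vS; vm; vk] s s12.
  by apply: frame_trans (frame_sub _ f7) (frame_sub _ f12).
pose x' := 4 * M + 2.
apply: (H s12 (rcons (lj k) (4 * (M + k) + 3, y0)) x' z) => //.
- split.
  + by move=> i; rewrite fs // (pr_W pr).
  + by rewrite fs // (pr_Len pr).
  + by rewrite f12.
  + exact: holds_seq_frame f12 R7.
  + by rewrite /s12 /s11 /s10 /s9 /update /= addn1 addnS.
  + by [].
  (* All new ports except [x'] and [z] are linked, and in return [x] and [y0] are no longer open. *)
  + have -> : 4 * (M + k.+1) = 4 * M + 4 * k.+1 by rewrite mulnDr.
    rewrite iotaD add0n; apply/permP => P.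
    rewrite [RHS]count_cat -(permP pp P) -(permP (perm_pts_column_links M k) P).
    rewrite pts_rcons pts_cat pts_rcons -!cats1 !count_cat /= !count_cat /= !count_cat.
    by rewrite /x' /z; clear; lia.
  + rewrite mulnAC -pv [RHS]mulnC -value_column //.
    * by apply: tours_permE; apply/permP => P;
        rewrite /lj -!cats1 /= !count_cat /= ?count_cat /=;
        clear; lia.
    * have : uniq ((s1 ++ y0 :: s2) ++ flatten rs).
        by move: u; rewrite cons_uniq -catA => /andP [].
      by rewrite [uniq (_ ++ flatten _)]cat_uniq => /and3P [].
    * by move: lt; rewrite /= ?all_cat /= ?all_cat /= ?all_cat; clear; lia.
    * apply: options_in_map_pairings.
      by move: lt; rewrite /= ?all_cat /= ?all_cat /= ?all_cat; clear; lia.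
  + by rewrite muln_gt0 K0.
  + by [].
- rewrite f12 // fr7 // fr6 //.
- by rewrite /s12 /update /= subn1.
- by rewrite /s12 /s11 /update /= addn1.
- apply: (@holds_seq_frame [:: vM; vK; vi; vm] s8) => //; first by solve_frame.
  exact: (@holds_seq_set s7 aA s1 s2 y0 z A7).
Qed.

End AddColumn.

Section MatchLast.
Variables (O : word -> nat) (b N Bm : nat) (G : multigraph).
Let w := encode_graph G.
Hypotheses (b0 : 0 < b) (Nb : N < 2 ^ b) (BmN : 4 * Bm + 8 <= N)
  (wN : 4 * size w <= N) (wBm : size w ^ Bm < 2 ^ b).

Let sm' n : n <= N -> n < 2 ^ b.
Proof. by move=> nN; apply: leq_ltn_trans Nb. Qed.

Lemma wp_match_last s M K l n a rs (Q : store -> Prop) :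
  bounded b s ->
  progress G s M K l (a ++ flatten rs) [seq pairings t | t <- a :: rs] ->
  size a = n.+2 -> s vh 0 = n.+2 -> holds_seq s aA a ->
  n.+2 <= size w -> M + n * size w <= Bm ->
  (forall s' M' K' l' a', bounded b s' ->
    frame [:: aA; aR; vr; vM; vK; vi; vS; vm; vk; vh] s s' ->
    progress G s' M' K' l' (a' ++ flatten rs) [seq pairings t | t <- a' :: rs] ->
    size a' = n -> s' vh 0 = n -> holds_seq s' aA a' ->
    M' <= M + n * size w -> Q s') ->
  wp O b N match_last Q s.
Proof.
move=> sb pr sza sh sA nw MB H.
case: a sza pr sA => [//|y0 a] sza.
case/lastP: a sza => [//|s2 x] /eqP; rewrite /= size_rcons !eqSS => /eqP sz2 pr sA.
have hn : s aA n.+1 = x.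
  by rewrite sA /= ?size_rcons ?sz2 // -sz2 nth_rcons ltnn eqxx.
have sn : n.+2 <= N by apply: leq_trans nw _; lia.
have xM : x < 4 * M.
  have [lt _] := progress_lt pr; apply: (allP lt).
  by rewrite !(mem_cat, in_cons, mem_rcons) eqxx ?orbT.
have M1 : M <= Bm by apply: leq_trans MB; apply: leq_addr.
apply: wp_seq; apply: wp_set => //=; rewrite sh subn1 /= hn.
set t1 := update _ _ _ _ => tb1.
apply: wp_seq; apply: wp_set => //=; first exact: sm'.
set t2 := update _ _ _ _ => tb2.
apply: wp_seq; apply: wp_set => //=; rewrite (_ : t2 vh 0 = n.+2) // subn2 /=.
  by apply: sm'; lia.
set t3 := update _ _ _ _ => tb3.
(* The program inserts the last end whereas [pairings] expands the first one; invariance under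
   permutations reconciles the two. *)
have pr3 : progress G t3 M K l (x :: (y0 :: s2) ++ flatten rs)
    (pairings_into x [::] (y0 :: s2) :: [seq pairings t | t <- rs]).
  have fr : frame [:: vS; vi; vm] s t3 by solve_frame.
  have pl : perm_eq (y0 :: rcons s2 x) (x :: y0 :: s2).
    by rewrite -cats1 -cat_cons perm_catC.
  have [lt u] := progress_lt pr.
  have [H1 H2 H3 H4 H5 H6 H7 H8 H9 H10] :=
    @progress_frame G [:: vS; vi; vm] _ _ _ _ _ _ _ isT fr pr.
  split=> //.
    apply: perm_trans H7; rewrite perm_cat2l -!cat_cons perm_cat2r perm_sym.
    exact: pl.
  rewrite pairings_into_all -(value_perm_pairings _ _ _ _ pl) //.
  by move: u; rewrite -cat_cons cat_uniq => /and3P [].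
(* After [j] columns [x'] is the current strand, [s1] holds the [j] fresh ends left behind, [y'] is
   the next candidate and [s2'] the later ones. *)
pose I j s' := exists M' K' l' x' s1 y' s2', [/\
  progress G s' M' K' l' (x' :: s1 ++ y' :: s2' ++ flatten rs)
    (pairings_into x' s1 (y' :: s2') :: [seq pairings t | t <- rs]),
  [/\ frame [:: aA; aR; vr; vM; vK; vi; vS; vm; vk] t3 s', s' vS 0 = x',
    s' vm 0 = n - j, s' vi 0 = j & holds_seq s' aA (s1 ++ y' :: s2')],
  size s1 = j, size s2' = n - j & M' <= M + j * size w].
apply: wp_seq; apply: (@wp_while _ _ _ b0 _ _ I n) => //.
- by lia.
- exists M, K, l, x, [::], y0, s2; split=> //; rewrite ?subn0 ?addn0 //.
  split=> //; rewrite ?subn0 // => i it.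
  rewrite /t3 /t2 /t1 /update /= sA /=; last by move: it; rewrite /= size_rcons; lia.
  by case: i it => [|i] //= it; rewrite nth_rcons ifT.
- move=> j s4 jn sb4 [M' [K' [l' [x' [s1 [y' [s2' [pr4 [f4 S4 m4 i4 A4] z1 z2 MM]]]]]]]].
  split; first by rewrite /= m4; lia.
  have kE : n - j = (n - j.+1).+1 by lia.
  rewrite kE in m4 z2.
  have jw : (j.+1) * size w <= n * size w by rewrite leq_mul2r jn orbT.
  have njw : n - j.+1 < size w by lia.
  case: s2' z2 pr4 A4 => [//|y'' s2'] z2 pr4 A4.
  apply: (@wp_add_column O b N Bm G b0 Nb BmN wN wBm _ M' K' l' x' s1 y' (y'' :: s2')
    rs (n - j.+1)) => //; try by rewrite ?z1 //.
  + by rewrite mulSn in jw; lia.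
  + by lia.
  move=> s5 l5 x5 z5 sb5 f5 pr5 S5 m5 i5 A5.
  exists (M' + (n - j.+1).+1), (K' * (n - j.+1).+1), l5, x5, (rcons s1 z5), y'', s2'.
  split=> //.
  + split=> //; last by rewrite i5 z1.
    exact: frame_trans f4 f5.
  + by rewrite size_rcons z1.
  + by case: z2.
  + by rewrite mulSn; lia.
move=> s4 sb4 [M' [K' [l' [x' [s1 [y' [s2' [pr4 [f4 S4 m4 i4 A4] z1 z2 MM]]]]]]]].
split; first by rewrite /= m4 subnn.
rewrite subnn in z2; have {z2} E2 := size0nil z2; subst s2'.
have A4n : s4 aA n = y' by rewrite A4 ?size_cat ?z1 /= ?addn1 // nth_cat z1 ltnn subnn.
have [lt u] := progress_lt pr4.
have x'M : x' < 4 * M' by move: lt => /= /andP [].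
have y'M : y' < 4 * M' by apply: (allP lt); rewrite inE !mem_cat inE eqxx !orbT.
have lM := size_progress pr4.
have M'B : M' <= Bm by apply: leq_trans MM MB.
have [W4 L4 r4 R4 M4 K4 p4 v4 K04 Kb4] := pr4.
have sB c : c <= 4 * Bm + 8 -> c < 2 ^ b by move=> cB; apply: sm'; apply: leq_trans BmN.
apply: wp_seq; apply: (@wp_emit _ _ _ b0 _ _ x' y') r4 R4 _ _ _ _ _ _ _ => //;
  try (by rewrite /= ?i4 ?A4n); try by (apply: sB; lia).
move=> s5 sb5 f5 r5 R5.
have f45 : frame [:: aA; aR; vr; vM; vK; vi; vS; vm; vk] t3 s5.
  by apply: frame_trans f4 _; apply: frame_sub f5.
have h5 : s5 vh 0 = n.+2 by rewrite f45.
apply: wp_set => //=; rewrite h5 subn2 /=; first by apply: sm'; lia.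
set s6 := update _ _ _ _ => sb6.
have f56 : frame [:: aR; vr; vh] s4 s6.
  by apply: frame_upd => //; apply: frame_sub f5.
apply: (H s6 M' K' (rcons l' (x', y')) s1) => //.
- have F : frame [:: aA; aR; vr; vM; vK; vi; vS; vm; vk; vh] t3 s6.
    by apply: frame_upd => //; apply: frame_sub f45.
  by apply: frame_trans F; solve_frame.
- split=> //.
  + by move=> i; rewrite f56.
  + by rewrite f56.
  + by rewrite f56.
  + by rewrite f56.
  + apply: perm_trans p4; apply/permP => P.
    by rewrite pts_rcons -!cats1 !count_cat /= !count_cat /= ?count_cat; clear; lia.
  + rewrite -v4 value_cons; apply: tours_permE; apply/permP => P.
    by rewrite -cats1 count_cat /=; clear; lia.
- have : holds_seq s6 aA (s1 ++ [:: y']) by apply: holds_seq_frame f56 A4.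
  move=> A6 i it; rewrite A6 ?size_cat ?addn1 ?(ltnW it) //.
    by rewrite nth_cat it.
  by rewrite ltnS ltnW.
Qed.

End MatchLast.

(** Products are abstracted into variables so that linear arithmetic remains: [x] bounds the nodes
    spent so far at the current vertex, [y] those at earlier ones. *)
Lemma chain_bound m3 m1 x y z u v n W B :
  m3 <= m1 + x -> m1 <= W + y -> u + x <= z -> y + z <= v -> n <= u ->
  W + v <= B -> m3 + n <= B.
Proof. lia. Qed.

Section GraphPhases.
Variables (O : word -> nat) (b N Bm : nat) (G : multigraph).
Let w := encode_graph G.
Let E0 := size (edges G).
Hypotheses (b0 : 0 < b) (Nb : N < 2 ^ b) (BmN : 4 * Bm + 8 <= N)
  (wN : 4 * size w <= N) (wBm : size w ^ Bm < 2 ^ b)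
  (Bm_ge : size w + size w * size w ^ 3 <= Bm) (euG : eulerian G).

Let sm' n : n <= N -> n < 2 ^ b.
Proof. by move=> nN; apply: leq_ltn_trans Nb. Qed.

Let remaining j := [seq ports_at w (2 * E0) v | v <- iota j (nvert G - j)].

Let Lw : size w = (2 * E0).+1 := size_encode_graph G.

Lemma wp_edge_phase (Q : store -> Prop) s :
  bounded b s -> (forall i, s aW i = nth 0 w i) -> s aLen 0 = size w ->
  s vr 0 = 0 -> s vM 0 = 0 ->
  (forall s' l, bounded b s' -> frame [:: aR; vr; vM; vK] s s' ->
    progress G s' E0 (2 ^ E0) l (flatten (remaining 0))
      [seq pairings t | t <- remaining 0] -> Q s') ->
  wp O b N edge_phase Q s.
Proof.
move=> sb sW sL sr sM H.
have E0N : 8 * E0 + 4 <= N by apply: leq_trans wN; rewrite Lw; lia.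
have pw j : j <= E0 -> 2 ^ j <= size w ^ j.
  by case: j => // j jE; rewrite leq_exp2r // Lw; lia.
have pwb j : j <= E0 -> 2 ^ j < 2 ^ b.
  move=> jE; apply: leq_ltn_trans (pw _ jE) _; apply: leq_ltn_trans wBm.
  by rewrite leq_pexp2l ?Lw //; move: Bm_ge; rewrite Lw; lia.
apply: wp_seq; apply: wp_set => //=; first by apply: sm'; lia.
set s1 := update _ _ _ _ => sb1.
pose lj j : seq (nat * nat) := [seq (4 * q + 2, 4 * q + 3) | q <- iota 0 j].
have szlj j : size (lj j) = j by rewrite size_map size_iota.
pose I j s' := [/\ frame [:: aR; vr; vM; vK] s s', s' vM 0 = j, s' vK 0 = 2 ^ j,
  s' vr 0 = 2 * size (lj j) & holds_seq s' aR (pts (lj j))].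
apply: (@wp_while _ _ _ b0 _ _ I E0) => //.
- by lia.
- by split=> //; solve_frame.
- move=> j s2 jE sb2 [f2 M2 K2 r2 R2].
  have L2 : s2 aLen 0 = (2 * E0).+1 by rewrite f2 // sL Lw.
  split; first by rewrite /= L2 M2; lia.
  apply: wp_seq; apply: (@wp_emit _ _ _ b0 _ _ (4 * j + 2) (4 * j + 3))
    r2 R2 _ _ _ _ _ _ _ => //; try (by rewrite /= ?M2);
    try by (rewrite ?szlj; apply: sm'; lia).
  move=> s3 sb3 f3 r3 R3.
  have M3 : s3 vM 0 = j by rewrite f3.
  have K3 : s3 vK 0 = 2 ^ j by rewrite f3.
  apply: wp_seq; apply: wp_set => //=; rewrite K3 mulnC -expnS; first exact: pwb.
  set s4 := update _ _ _ _ => sb4.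
  have M4 : s4 vM 0 = j := M3.
  apply: wp_set => //=; rewrite M4; first by apply: sm'; lia.
  set s5 := update _ _ _ _ => sb5.
  have lE : rcons (lj j) (4 * j + 2, 4 * j + 3) = lj j.+1.
    by rewrite /lj -[in RHS](addn1 j) iotaD map_cat /= cats1.
  rewrite lE in r3 R3.
  split=> //.
  + apply: frame_upd => //; apply: frame_upd => //; apply: frame_trans f2 _.
    exact: frame_sub f3.
  + by rewrite /s5 /update /= addn1.
- move=> s2 sb2 [f2 M2 K2 r2 R2]; split.
    by rewrite /= f2 // sL Lw M2; lia.
  apply: (H s2 (lj E0)) => //; split=> //.
  + by move=> i; rewrite f2.
  + by rewrite f2.
  + by have := perm_ports G; rewrite /remaining subn0.
  + rewrite /value /remaining subn0 -map_comp.
    have := @tours_edge_nodes 0 E0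
      [seq pairings (ports_at w (2 * E0) v) | v <- iota 0 (nvert G)] [::].
    rewrite !cats0 /= => -> //; first by rewrite num_eulerian_tours_input.
    have : all (predC (fun x => (x %/ 4 < 0 + E0) && (1 < x %% 4)))
      (flatten [seq ports_at w (2 * E0) v | v <- iota 0 (nvert G)]).
      apply/allP => x /flatten_mapP [v _] /mapP [i _ ->].
      by rewrite /= /half_edge_port; lia.
    by move/options_in_map_pairings; rewrite -map_comp.
  + by rewrite expn_gt0.
  + exact: pw.
Qed.

Lemma wp_vertex_phase s M K l (Q : store -> Prop) :
  bounded b s -> s vv 0 = 0 -> M <= size w ->
  progress G s M K l (flatten (remaining 0)) [seq pairings t | t <- remaining 0] ->
  (forall s' M' K' l', bounded b s' ->
    frame [:: aA; aR; vr; vM; vK; vi; vS; vm; vk; vh; vv] s s' ->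
    progress G s' M' K' l' [::] [::] -> M' <= Bm -> Q s') ->
  wp O b N vertex_phase Q s.
Proof.
move=> sb sv Mw pr H.
have nvw : nvert G <= size w by apply: nvert_le_size.
have wN' : size w <= N by lia.
pose fs := [:: aA; aR; vr; vM; vK; vi; vS; vm; vk; vh; vv].
pose I j s' := exists M' K' l', [/\ progress G s' M' K' l' (flatten (remaining j))
  [seq pairings t | t <- remaining j], frame fs s s', s' vv 0 = j &
  M' <= size w + j * size w ^ 3].
apply: (@wp_while _ _ _ b0 _ _ I (nvert G)) => //.
- by lia.
- by exists M, K, l; rewrite addn0.
- move=> j s1 jn sb1 [M1 [K1 [l1 [pr1 f1 v1 M1w]]]].
  have W1 := pr_W pr1; have L1 := pr_Len pr1.
  split; first by rewrite /= W1 v1; move: jn; rewrite /w encode_graphE /=; lia.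
  set a := ports_at w (2 * E0) j.
  have rE : remaining j = a :: remaining j.+1.
    by rewrite /remaining -subnSK.
  have sza : size a <= 2 * E0 by apply: size_ports_at.
  have oa : ~~ odd (size a) by apply: odd_ports_at.
  (* As the degree is even, exactly [d] insertions use up the ends. *)
  pose d := (size a)./2; have aE : size a = 2 * d by rewrite mul2n even_halfK.
  apply: wp_seq; apply: (@wp_gather O b N b0 Nb w (2 * E0) j _ s1) => //.
  + by rewrite L1 Lw.
  + by apply: leq_trans wN; rewrite Lw.
  move=> s2 sb2 f2 h2 A2.
  have pr2 : progress G s2 M1 K1 l1 (a ++ flatten (remaining j.+1))
      [seq pairings t | t <- a :: remaining j.+1].
    rewrite rE in pr1.
    exact: (@progress_frame G [:: aA; vi; vh] _ _ _ _ _ _ _ isT f2 pr1).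
  pose I' i s' := exists M' K' l' a', [/\ progress G s' M' K' l'
      (a' ++ flatten (remaining j.+1)) [seq pairings t | t <- a' :: remaining j.+1],
    [/\ frame [:: aA; aR; vr; vM; vK; vi; vS; vm; vk; vh] s1 s',
      s' vh 0 = 2 * (d - i) & holds_seq s' aA a'],
    size a' = 2 * (d - i) & M' <= M1 + i * (size w * size w)].
  have w3 : size w ^ 3 = size w * (size w * size w) by rewrite !expnS expn0 muln1.
  have jw : j * size w ^ 3 + size w ^ 3 <= size w * size w ^ 3.
    by rewrite -mulSnr leq_mul2r (leq_trans jn) ?orbT.
  have dw : d <= size w by rewrite Lw; lia.
  apply: wp_seq; apply: (@wp_while _ _ _ b0 _ _ I' d) => //.
  + by apply: leq_trans dw _.
  + exists M1, K1, l1, a; rewrite subn0 mul0n addn0 -aE; split=> //; split=> //.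
    exact: frame_sub f2.
  + move=> i s3 id sb3 [M3 [K3 [l3 [a3 [pr3 [f3 h3 A3] sz3 M3w]]]]].
    split; first by rewrite /= h3; lia.
    pose n := 2 * (d - i.+1).
    have nE : 2 * (d - i) = n.+2 by rewrite /n; lia.
    rewrite nE in h3 sz3.
    have iw : i.+1 * (size w * size w) <= size w ^ 3.
      by rewrite w3 leq_mul2r (leq_trans id) ?orbT.
    have nw : n.+2 <= size w by rewrite -nE Lw; lia.
    have nww : n * size w <= size w * size w by rewrite leq_mul2r; lia.
    rewrite mulSn in iw.
    apply: (@wp_match_last O b N Bm G b0 Nb BmN wN wBm s3 M3 K3 l3 n a3
      (remaining j.+1)) => //.
      exact: chain_bound M3w M1w iw jw nww Bm_ge.
    move=> s4 M4 K4 l4 a4 sb4 f4 pr4 sz4 h4 A4 M4w.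
    exists M4, K4, l4, a4; split=> //; last first.
      by rewrite mulSn [_ + i * _]addnC addnA; apply: leq_trans M4w (leq_add M3w nww).
    split=> //; apply: frame_trans f3 f4.
  move=> s3 sb3 [M3 [K3 [l3 [a3 [pr3 [f3 h3 A3] sz3 M3w]]]]].
  rewrite subnn muln0 in h3 sz3.
  split; first by rewrite /= h3.
  have dw3 : d * (size w * size w) <= size w ^ 3 by rewrite w3 leq_mul2r dw orbT.
  have v3 : s3 vv 0 = j by rewrite f3.
  apply: wp_set => //=; rewrite v3; first by apply: sm'; lia.
  set s4 := update _ _ _ _ => sb4.
  have E3 := size0nil sz3; rewrite {}E3 {a3 A3 sz3} in pr3.
  have f34 : frame [:: vv] s3 s4 by solve_frame.
  exists M3, K3, l3; split.
  + have [H1 H2 H3 H4 H5 H6 H7 H8 H9 H10] :=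
      @progress_frame G [:: vv] _ _ _ _ _ _ _ isT f34 pr3.
    by split=> //; rewrite -H8 /= value_nil.
  + by apply: frame_upd => //; apply: frame_trans f1 _; apply: frame_sub f3.
  + by rewrite /s4 /update /= addn1.
  + by rewrite mulSn [_ + j * _]addnC addnA; apply: leq_trans M3w (leq_add M1w dw3).
- move=> s1 sb1 [M1 [K1 [l1 [pr1 f1 v1 M1w]]]].
  split.
    by rewrite /= (pr_W pr1) v1 /w encode_graphE /= subnn.
  rewrite /remaining subnn in pr1.
  apply: (H s1 M1 K1 l1) => //.
  apply: leq_trans M1w _; apply: leq_trans Bm_ge.
  by rewrite leq_add2l leq_mul2r nvw orbT.
Qed.

End GraphPhases.

(** Three states per node, rounded up to four: the bit length of an answer is linear in the number
    of vertices. *)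
Lemma tours_pnodes_bound r l : tours [seq pnode 1 q | q <- r] l <= 2 ^ (2 * size r).
Proof.
elim: r l => [|q r IH] l; first by rewrite /= muln0 leq_b1.
rewrite [tours _ _]/= big_node [size _]/= mulnS expnD mul1n.
have := IH ([:: (4 * q, 4 * q + 2); (4 * q + 1, 4 * q + 3)] ++ l).
have := IH ([:: (4 * q, 4 * q + 3); (4 * q + 1, 4 * q + 2)] ++ l).
have := IH ([:: (4 * q, 4 * q + 1); (4 * q + 2, 4 * q + 3)] ++ l).
move: (2 ^ (2 * size r)) (tours _ _) (tours _ _) (tours _ _) => B x y z.
by rewrite (_ : 2 ^ 2 = 4) //; lia.
Qed.

Lemma alternate_bound x B j :
  (forall i, 0 < i <= j -> x i <= B) ->
  (alternate x j).1 <= j * B /\ (alternate x j).2 <= j * B.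
Proof.
elim: j => [|j IH] xB //=.
have [|H1 H2] := IH.
  by move=> i /andP [i0 ij]; apply: xB; rewrite i0 leqW.
have := xB j.+1; rewrite leqnn => /(_ isT); rewrite mulSn; lia.
Qed.

(** * Queries and their answers *)

Section Query.
Variables (M : nat) (l : seq (nat * nat)).

Definition query_links j :=
  [seq (spread j p.1, spread j p.2) | p <- l] ++ all_chain_links j M.

Definition query j : word :=
  M * j :: flatten [seq [:: p.1 %/ 4; p.2 %/ 4] | p <- query_links j].

Definition query_tail j i : seq nat :=
  flatten [seq [:: q; q.+1; q; q.+1] | q <- [seq u + u %/ j.-1 | u <- iota 0 i]].

Lemma query_tailS j i : query_tail j i.+1 =
  query_tail j i ++ let q := i + i %/ j.-1 in [:: q; q.+1; q; q.+1].
Proof. by rewrite /query_tail -[in LHS](addn1 i) iotaD !map_cat flatten_cat /=. Qed.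

Lemma size_query_tail j i : size (query_tail j i) = 4 * i.
Proof. by elim: i => // i IH; rewrite query_tailS size_cat IH /=; lia. Qed.

Lemma queryE j : query j =
  M * j :: [seq spread_vertex j x | x <- pts l] ++ query_tail j (M * j.-1).
Proof.
rewrite /query /query_links map_cat flatten_cat; congr (_ :: _ ++ _).
- elim: l => //= p r ->; rewrite /spread.
  have D a b : (4 * a + b %% 4) %/ 4 = a by lia.
  by rewrite !D.
rewrite /all_chain_links /query_tail.
elim: [seq i + i %/ j.-1 | i <- iota 0 (M * j.-1)] => //= q r ->.
by congr [:: _, _, _, _ & _]; lia.
Qed.

Lemma size_query j : 0 < j -> 2 * size l = 4 * M -> size (query j) = 4 * M * j + 1.
Proof.
move=> j0 sl; rewrite queryE /= size_cat size_map size_pts sl size_query_tail.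
by case: j j0 => // j _ /=; rewrite mulnS; lia.
Qed.

End Query.

Lemma segment_holds s a t : holds_seq s a t -> segment s a (size t) = t.
Proof.
move=> H; apply: (@eq_from_nth _ 0); rewrite size_mkseq // => i it.
by rewrite nth_mkseq // H.
Qed.

Section QueryPhases.
Variables (O : word -> nat) (b N : nat).
Hypotheses (b0 : 0 < b) (Nb : N < 2 ^ b).

Let sm' n : n <= N -> n < 2 ^ b.
Proof. by move=> nN; apply: leq_ltn_trans Nb. Qed.

Lemma wp_power_phase M (Q : store -> Prop) s :
  bounded b s -> s vM 0 = M -> M <= N -> M < b ->
  (forall s', bounded b s' -> frame [:: vtwo; vi] s s' -> s' vtwo 0 = 2 ^ M -> Q s') ->
  wp O b N power_phase Q s.
Proof.
move=> sb sM MN Mb H.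
have p2 i : i <= M -> 2 ^ i < 2 ^ b by move=> iM; rewrite ltn_exp2l //; lia.
apply: wp_seq; apply: wp_set => //=; first exact: (p2 0).
set s1 := update _ _ _ _ => sb1.
apply: wp_seq; apply: wp_set => //=; first by apply: sm'.
set s2 := update _ _ _ _ => sb2.
pose I i s' := [/\ frame [:: vtwo; vi] s s', s' vi 0 = i & s' vtwo 0 = 2 ^ i].
apply: (@wp_while _ _ _ b0 _ _ I M) => //.
- by split=> //; solve_frame.
- move=> i s3 iM sb3 [f3 i3 t3].
  split; first by rewrite /= f3 // sM i3; lia.
  apply: wp_seq; apply: wp_set => //=; rewrite t3 mulnC -expnS; first exact: p2.
  set s4 := update _ _ _ _ => sb4; have i4 : s4 vi 0 = i := i3.
  apply: wp_set => //=; rewrite i4; first by apply: sm'; lia.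
  set s5 := update _ _ _ _ => sb5; split=> //; first by solve_frame.
  by rewrite /s5 /update /= addn1.
- move=> s3 sb3 [f3 i3 t3]; split; last exact: H.
  by rewrite /= f3 // sM i3 subnn.
Qed.

Lemma wp_write_query M j l (Q : store -> Prop) s :
  bounded b s -> s vM 0 = M -> s vj 0 = j -> s vr 0 = 2 * size l ->
  holds_seq s aR (pts l) -> perm_eq (pts l) (iota 0 (4 * M)) ->
  0 < j -> 4 * M * j + 8 <= N ->
  (forall s', bounded b s' -> frame [:: aQ; vi] s s' ->
     holds_seq s' aQ (query M l j) -> Q s') ->
  wp O b N write_query Q s.
Proof.
move=> sb sM sj sr sR p j0 jN H.
have szl : 2 * size l = 4 * M by rewrite -size_pts (perm_size p) size_iota.
have MMj : M <= M * j by rewrite leq_pmulr.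
have Mj1 : M * j = M * j.-1 + M by rewrite -mulnSr prednK.
have jN' : 4 * (M * j) + 8 <= N by rewrite mulnA.
apply: wp_seq; apply: wp_set => //=; rewrite sM sj; first by apply: sm'; lia.
set s1 := update _ _ _ _ => sb1.
apply: wp_seq; apply: wp_set => //=; first exact: sm'.
set s2 := update _ _ _ _ => sb2.
have f2 : frame [:: aQ; vi] s s2 by solve_frame.
pose hd i := M * j :: [seq spread_vertex j x | x <- take i (pts l)].
have szt i : i <= 4 * M -> size (hd i) = i.+1.
  by move=> iM; rewrite /= size_map size_takel // size_pts szl.
pose I i s' := [/\ frame [:: aQ; vi] s s', s' vi 0 = i & holds_seq s' aQ (hd i)].
apply: wp_seq; apply: (@wp_while _ _ _ b0 _ _ I (4 * M)) => //.
- by lia.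
- by split=> // i; rewrite /hd take0 /=; case: i.
- move=> i s3 iM sb3 [f3 i3 Q3].
  have r3 : s3 vr 0 = 4 * M by rewrite f3 // sr szl.
  have R3 : s3 aR i = nth 0 (pts l) i by rewrite f3 // sR // size_pts szl.
  have j3 : s3 vj 0 = j by rewrite f3.
  split; first by rewrite /= r3 i3; lia.
  set x := nth 0 (pts l) i in R3.
  have xM : x < 4 * M.
    have : x \in iota 0 (4 * M) by rewrite -(perm_mem p) mem_nth // size_pts szl.
    by rewrite mem_iota.
  have svE : x %/ 4 * j + (x %/ 2 - 2 * (x %/ 4)) * (j - 1) = spread_vertex j x.
    rewrite /spread_vertex subn1; congr (_ + _ * _); lia.
  have svb : spread_vertex j x < M * j.
    have x4 : x %/ 4 < M by lia.
    rewrite -ltn_divLR // spread_node //.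
  apply: wp_seq; apply: wp_set => //=; rewrite i3 R3 j3 svE ?addn1.
    by apply: sm'; lia.
  set s4 := update _ _ _ _ => sb4; have i4 : s4 vi 0 = i := i3.
  apply: wp_set => //=; rewrite i4; first by apply: sm'; lia.
  set s5 := update _ _ _ _ => sb5; split; first by solve_frame.
    by rewrite /s5 /update /= addn1.
  have -> : hd i.+1 = rcons (hd i) (spread_vertex j x).
    by rewrite /hd (take_nth 0) ?map_rcons // size_pts szl.
  have := @holds_seq_rcons _ _ _ (spread_vertex j x) Q3.
  by rewrite szt // ltnW.
move=> s3 sb3 [f3 i3 Q3].
split; first by rewrite /= f3 // sr szl i3 subnn.
apply: wp_seq; apply: wp_set => //=; first exact: sm'.
set s4 := update _ _ _ _ => sb4.
have f4 : frame [:: aQ; vi] s s4 by solve_frame.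
pose full i := hd (4 * M) ++ query_tail j i.
have szf i : size (full i) = 4 * M + 1 + 4 * i.
  by rewrite size_cat szt // size_query_tail; lia.
pose I' i s' := [/\ frame [:: aQ; vi] s s', s' vi 0 = i & holds_seq s' aQ (full i)].
apply: (@wp_while _ _ _ b0 _ _ I' (M * j.-1)) => //.
- by lia.
- by split=> //; rewrite /full cats0.
- move=> i s5 iM sb5 [f5 i5 Q5].
  have r5 : s5 vr 0 = 4 * M by rewrite f5 // sr szl.
  have j5 : s5 vj 0 = j by rewrite f5.
  have M5 : s5 vM 0 = M by rewrite f5.
  split; first by rewrite /= M5 j5 i5 subn1; lia.
  pose q := i + i %/ j.-1.
  have qb : q < M * j.
    have : i %/ j.-1 <= M.
      have := leq_div2r j.-1 (ltnW iM); case: (j.-1) => [|k]; first by rewrite divn0.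
      by rewrite mulnK.
    by rewrite /q; lia.
  apply: wp_seq; apply: wp_set => //=; rewrite i5 j5 ?r5 subn1 -/q.
    by apply: sm'; lia.
  set s6 := update _ _ _ _ => sb6.
  have E6 : (s6 vi 0 = i) * (s6 vj 0 = j) * (s6 vr 0 = 4 * M) by [].
  apply: wp_seq; apply: wp_set => //=; rewrite !E6 subn1 -/q.
    by apply: sm'; lia.
  set s7 := update _ _ _ _ => sb7.
  have E7 : (s7 vi 0 = i) * (s7 vj 0 = j) * (s7 vr 0 = 4 * M) by [].
  apply: wp_seq; apply: wp_set => //=; rewrite !E7 subn1 -/q.
    by apply: sm'; lia.
  set s8 := update _ _ _ _ => sb8.
  have E8 : (s8 vi 0 = i) * (s8 vj 0 = j) * (s8 vr 0 = 4 * M) by [].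
  apply: wp_seq; apply: wp_set => //=; rewrite !E8 subn1 -/q.
    by apply: sm'; lia.
  set s9 := update _ _ _ _ => sb9.
  have E9 : s9 vi 0 = i by [].
  apply: wp_set => //=; rewrite E9; first by apply: sm'; lia.
  set s10 := update _ _ _ _ => sb10.
  split; first by solve_frame.
    by rewrite /s10 /update /= addn1.
  have H6 := @holds_seq_rcons _ _ _ q Q5.
  have H7 := @holds_seq_rcons _ _ _ (q + 1) H6.
  have H8 := @holds_seq_rcons _ _ _ q H7.
  have := @holds_seq_rcons _ _ _ (q + 1) H8.
  rewrite !size_rcons szf.
  rewrite (_ : (4 * M + 1 + 4 * i).+1 = 4 * M + 2 + 4 * i); last by clear; lia.
  rewrite (_ : (4 * M + 2 + 4 * i).+1 = 4 * M + 3 + 4 * i); last by clear; lia.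
  rewrite (_ : (4 * M + 3 + 4 * i).+1 = 4 * M + 4 + 4 * i); last by clear; lia.
  rewrite -/s6 -/s7 -/s8 -/s9 => H9.
  have -> : full i.+1 = rcons (rcons (rcons (rcons (full i) q) (q + 1)) q) (q + 1).
    by rewrite /full query_tailS -!cats1 -!catA /= !addn1.
  by apply: (@holds_seq_frame [:: vi] s9) => //; solve_frame.
move=> s5 sb5 [f5 i5 Q5]; split.
  have M5 : s5 vM 0 = M by rewrite f5.
  have j5 : s5 vj 0 = j by rewrite f5.
  by rewrite /= M5 j5 i5 subn1 subnn.
apply: H => //; rewrite queryE.
by move: Q5; rewrite /full /hd take_oversize // size_pts szl.
Qed.

Lemma wp_query_phase M l (Q : store -> Prop) s :
  oracle_for count_tours_four_regular O ->
  bounded b s -> s vM 0 = M -> s vr 0 = 2 * size l -> s vtwo 0 = 2 ^ M ->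
  s vp 0 = 0 -> s vn 0 = 0 ->
  holds_seq s aR (pts l) -> perm_eq (pts l) (iota 0 (4 * M)) ->
  8 * (M + 2) ^ 2 <= N -> N <= b ->
  (forall s', bounded b s' ->
    frame [:: aQ; vi; vbin; vscale; vj; vp; vn; vtmp; vans] s s' ->
    s' vp 0 - s' vn 0 + (s' vn 0 - s' vp 0) =
      tours [seq pnode 0 q | q <- iota 0 M] l -> Q s') ->
  wp O b N query_phase Q s.
Proof.
move=> OP sb sM sr s2 sp sn sR p MN Nb' H.
have MN2 : 8 * (M * M) + 32 * M + 32 <= N by move: MN; rewrite expnS expn1; lia.
pose P j := tours [seq pnode j q | q <- iota 0 M] l.
pose x j := 'C(M.+1, j) * P j.
have OE j : 0 < j -> O (query M l j) = 2 ^ (M * j.-1) * P j.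
  move=> j0; have [g [gE g4 gn]] := exists_query_graph (perm_pts_all_chains j0 p).
  by have /= := OP g g4; rewrite gE gn tours_all_chains.
have Ob j : 0 < j -> O (query M l j) <= 2 ^ (2 * (M * j)).
  move=> j0; have [g [gE g4 gn]] := exists_query_graph (perm_pts_all_chains j0 p).
  have /= := OP g g4; rewrite gE gn -/(query_links M l j) -/(query M l j) => ->.
  by apply: leq_trans (tours_pnodes_bound _ _) _; rewrite size_iota.
(* The first factor bounds the binomial coefficients of [M.+1], the second the answer to the largest
   query, which has [M * M.+1] vertices. The quadratic exponent requires numbers with quadratically
   many bits. *)
pose B := 2 ^ M.+1 * 2 ^ (2 * (M * M.+1)).
have xB j : 0 < j <= M.+1 -> x j <= B.
  case/andP => j0 jM; apply: leq_mul.
    rewrite -[2]/(1 + 1) expnDn (bigD1 (Ordinal (jM : j < M.+2))) //=.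
    by rewrite !exp1n !muln1 leq_addr.
  have := Ob j j0; rewrite OE // => PB.
  have PB' : P j <= 2 ^ (2 * (M * j)) by apply: leq_trans PB; rewrite leq_pmull ?expn_gt0.
  by apply: leq_trans PB' _; rewrite leq_exp2l // !leq_mul2l jM !orbT.
have small2 e : e <= 8 * (M * M) + 32 * M + 31 -> 2 ^ e < 2 ^ b.
  by move=> eM; rewrite ltn_exp2l //; lia.
have altb j : j <= M.+1 -> (alternate x j).1 < 2 ^ b /\ (alternate x j).2 < 2 ^ b.
  move=> jM; have [|H1 H2] := @alternate_bound x B j.
    by move=> i /andP [i0 ij]; apply: xB; rewrite i0 (leq_trans ij).
  have jB : j * B < 2 ^ b.
    apply: (@leq_ltn_trans (2 ^ M.+1 * B)).
      by rewrite leq_mul2r (leq_trans jM) ?orbT // ltnW // ltn_expl.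
    by rewrite /B -!expnD; apply: small2; rewrite mulnS; lia.
  by split; [apply: leq_ltn_trans H1 _|apply: leq_ltn_trans H2 _].
have szl : 2 * size l = 4 * M by rewrite -size_pts (perm_size p) size_iota.
apply: wp_seq; apply: wp_set => //=; first by apply: sm'; lia.
set s3 := update _ _ _ _ => sb3.
apply: wp_seq; apply: wp_set => //=; first by apply: sm'; lia.
set s4 := update _ _ _ _ => sb4.
apply: wp_seq; apply: wp_set => //=; first by apply: sm'; lia.
set s5 := update _ _ _ _ => sb5.
pose fs := [:: aQ; vi; vbin; vscale; vj; vp; vn; vtmp; vans].
pose I k s' := [/\ frame fs s s', s' vj 0 = k.+1,
  s' vbin 0 = 'C(M.+1, k), s' vscale 0 = 2 ^ (M * k) &
  s' vp 0 = (alternate x k).1 /\ s' vn 0 = (alternate x k).2].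
apply: (@wp_while _ _ _ b0 _ _ I M.+1) => //.
- by lia.
- by split=> //; [solve_frame | rewrite muln0].
- move=> k s6 kM sb6 [f6 j6 b6 c6 [p6 n6]].
  have M6 : s6 vM 0 = M by rewrite f6.
  have kM2 : M * k.+1 <= M * M.+1 by rewrite leq_mul2l kM orbT.
  have kME : M * M.+1 = M * M + M by rewrite mulnS addnC.
  split; first by rewrite /= M6 j6; lia.
  have bE : 'C(M.+1, k) * (M + 2 - k.+1) %/ k.+1 = 'C(M.+1, k.+1).
    have -> : M + 2 - k.+1 = M.+1 - k by lia.
    by rewrite mulnC -mul_bin_left mulKn.
  have bB : 'C(M.+1, k.+1) < 2 ^ b.
    have kM' : k.+1 < M.+2 by [].
    apply: (@leq_ltn_trans (2 ^ M.+1)); last by apply: small2; lia.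
    by rewrite -[2]/(1 + 1) expnDn (bigD1 (Ordinal kM')) //= !exp1n !muln1 leq_addr.
  apply: wp_seq; apply: wp_set => //=; rewrite M6 j6 b6 bE //.
  set s7 := update _ _ _ _ => sb7.
  have f7 : frame fs s s7 by solve_frame.
  have R7 : holds_seq s7 aR (pts l) by apply: holds_seq_frame f7 sR.
  apply: wp_seq; apply: (@wp_write_query M k.+1 l _ s7) => //.
  + by rewrite f7.
  + by rewrite -mulnA; lia.
  move=> s8 sb8 f8 Q8.
  have f8' : frame fs s s8 by apply: frame_trans f7 _; apply: frame_sub f8.
  have M8 : s8 vM 0 = M by rewrite f8'.
  have j8 : s8 vj 0 = k.+1 by rewrite f8.
  have segE : segment s8 aQ (4 * M * k.+1 + 1) = query M l k.+1.
    by have := segment_holds Q8; rewrite (size_query _ szl).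
  apply: wp_seq; apply: wp_ask => //=; rewrite M8 j8 ?segE.
  + by rewrite -mulnA; lia.
  + by apply: leq_ltn_trans (Ob _ _) _ => //; apply: small2; lia.
  set s9 := update _ _ _ _ => sb9.
  have f9 : frame fs s s9 by solve_frame.
  have a9 : s9 vans 0 = 2 ^ (M * k) * P k.+1 by exact: (OE k.+1).
  have n9 : s9 vn 0 = (alternate x k).2 by rewrite -n6 /s9 /update /= f8.
  apply: wp_seq; apply: wp_set => //=; rewrite n9.
  set s10 := update _ _ _ _ => sb10.
  have p10 : s10 vp 0 = (alternate x k).1 by rewrite -p6 /s10 /s9 /update /= f8.
  apply: wp_seq; apply: wp_set => //=; rewrite p10.
  set s11 := update _ _ _ _ => sb11.
  have t11 : s11 vtmp 0 = (alternate x k).2 by [].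
  have b11 : s11 vbin 0 = 'C(M.+1, k.+1).
    by rewrite /s11 /s10 /s9 /update /= f8.
  have c11 : s11 vscale 0 = 2 ^ (M * k).
    by rewrite -c6 /s11 /s10 /s9 /update /= f8.
  have a11 : s11 vans 0 = 2 ^ (M * k) * P k.+1 by rewrite -a9.
  apply: wp_seq; apply: wp_set => //=;
    rewrite t11 b11 a11 c11 mulKn ?expn_gt0 // -/(x k.+1).
    by have [] := altb k.+1 kM.
  set s12 := update _ _ _ _ => sb12.
  have c12 : s12 vscale 0 = 2 ^ (M * k) := c11.
  have f12 : frame fs s s12 by solve_frame.
  have t12 : s12 vtwo 0 = 2 ^ M by rewrite f12.
  apply: wp_seq; apply: wp_set => //=; rewrite c12 t12 -expnD addnC -mulnS.
    by apply: small2; lia.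
  set s13 := update _ _ _ _ => sb13.
  have j13 : s13 vj 0 = k.+1 by rewrite -j8.
  apply: wp_set => //=; rewrite j13; first by apply: sm'; lia.
  set s14 := update _ _ _ _ => sb14.
  split; first by solve_frame.
  + by rewrite /s14 /update /= addn1.
  + exact: b11.
  + by [].
  + by split.
- move=> s6 sb6 [f6 j6 b6 c6 [p6 n6]]; split.
    have M6 : s6 vM 0 = M by rewrite f6.
    by rewrite /= M6 j6; lia.
  apply: (H s6) => //; rewrite p6 n6.
  apply: (@alternate_extrapolate M P); last by rewrite -surjective_pairing.
  move=> t; have := @iter_diff_tours (iota 0 M) l t.
  by rewrite size_iota.
Qed.

End QueryPhases.

(** * Polynomial running time *)

(** For an input of [n] entries: at most [n] nodes on edges, and for each of at most [n] vertices at
    most [n] insertions, of at most [n] columns with at most [n] nodes each. *)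
Definition node_bound (n : nat) : nat := n + n * n ^ 3.
(** One number bounds rounds, cells and bit lengths alike. With M nodes a query has [4 * M * j + 1]
    cells and its answer is at most [2 ^ (2 * M * j)], where [j <= M + 1]. *)
Definition round_bound (n : nat) : nat := 8 * (node_bound n + 2) ^ 2.

Lemma round_bound_poly m n : m <= n -> 0 < n -> round_bound m <= 128 * n ^ 8.
Proof.
move=> mn n0; have n4 : node_bound m + 2 <= 4 * n ^ 4.
  have h1 : m <= n ^ 4 by apply: leq_trans mn _; rewrite -{1}(expn1 n) leq_pexp2l.
  have h2 : m * m ^ 3 <= n ^ 4 by rewrite -expnS leq_exp2r.
  have h3 : 0 < n ^ 4 by rewrite expn_gt0 n0.
  by rewrite /node_bound; lia.
rewrite /round_bound (_ : 128 * n ^ 8 = 8 * (4 * n ^ 4) ^ 2).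
  by rewrite leq_mul2l /= leq_exp2r.
by rewrite expnMn -expnM mulnA.
Qed.

Lemma size_wordlen w : size w <= wordlen w.
Proof. by elim: w => //= n w IH; rewrite /wordlen /= -add1n leq_add. Qed.

Lemma nth_encode_graph_le G i : nth 0 (encode_graph G) i <= nvert G.
Proof.
rewrite encode_graphE; case: i => [//|i] /=.
have [il|il] := ltnP i (size (pts [seq (val uv.1, val uv.2) | uv <- edges G])); last first.
  by rewrite nth_default.
have := mem_nth 0 il; case/ptsP => _ /mapP [[u v] _ ->] /=.
by rewrite !inE => /orP [] /eqP ->; apply: ltnW; apply: ltn_ord.
Qed.

Lemma wp_reduction (O : word -> nat) (G : multigraph) :
  oracle_for count_tours_four_regular O -> eulerian G ->
  let N := round_bound (size (encode_graph G)) in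
  wp O N N reduction (fun s => output s = num_eulerian_tours G)
    (init_store (encode_graph G)).
Proof.
move=> OP euG N; set w := encode_graph G; pose L := size w; pose Bm := node_bound L.
have L0 : 0 < L by rewrite /L /w encode_graphE.
have BmL : L <= Bm by apply: leq_addr.
have NE : N = 8 * ((Bm + 2) * (Bm + 2)) by rewrite /N /round_bound -/w -/L -/Bm -mulnn.
have BmN : 4 * Bm + 8 <= N by rewrite NE; nia.
have wN : 4 * L <= N by lia.
have N0 : 0 < N by lia.
have Nb : N < 2 ^ N by apply: ltn_expl.
(* This follows from [L < 2 ^ L], the exponent [L * Bm] being below [N]. *)
have wBm : L ^ Bm < 2 ^ N.
  apply: (@leq_trans (2 ^ (L * Bm)).+1).
    by rewrite ltnS expnM leq_exp2r ?(leq_trans L0) // ltnW // ltn_expl.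
  by rewrite ltn_exp2l // NE; nia.
have nvL : nvert G <= L by apply: nvert_le_size.
have LN : L <= N by lia.
have sb : bounded N (init_store w).
  move=> a i; apply: leq_ltn_trans Nb; case: a => [|[|a]] //=.
    by apply: leq_trans (nth_encode_graph_le _ _) _; lia.
  by case: (i == 0).
have E0L : size (edges G) <= L by rewrite /L size_encode_graph; lia.
apply: wp_seq; apply: (@wp_edge_phase O N N Bm G N0 Nb BmN wN wBm (leqnn _) euG _ _ sb) => //.
move=> s1 l1 sb1 f1 pr1.
apply: wp_seq; apply: (@wp_vertex_phase O N N Bm G N0 Nb BmN wN wBm (leqnn _) euG
  s1 _ _ l1 _ sb1 _ _ pr1) => //; first by rewrite f1.
move=> s2 M K l sb2 f2 pr2 MB.
have [W2 L2 r2 R2 M2 K2 p2 v2 K0 _] := pr2.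
rewrite cats0 in p2; rewrite /value cats0 in v2.
have MN : M < N by lia.
apply: wp_seq; apply: (@wp_power_phase O N N N0 Nb M _ s2) => //; first exact: ltnW.
move=> s3 sb3 f3 t3.
(* The accumulators [vp] and [vn] are never initialized by the program: they are 0 in the initial
   store, and no earlier phase writes to them. *)
have c3 a i : a \notin [:: aW; aLen] ->
    a \notin [:: aA; aR; vr; vM; vK; vi; vS; vm; vk; vh; vv; vtwo] -> s3 a i = 0.
  rewrite !inE !negb_or => a1 a2; rewrite f3 ?f2 ?f1 ?inE ?negb_or; try by lia.
  by case: a a1 {a2} => [|[|a]].
apply: wp_seq; apply: (@wp_query_phase O N N N0 Nb M l _ s3) => //.
- by rewrite f3.
- by rewrite f3.
- by rewrite c3.
- by rewrite c3.
- by apply: holds_seq_frame f3 R2.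
- by rewrite NE leq_mul2l /= -mulnn leq_mul // leq_add2r.
move=> s4 sb4 f4 e4.
have K4 : s4 vK 0 = K by rewrite f4 // f3.
have resE : (s4 vp 0 - s4 vn 0 + (s4 vn 0 - s4 vp 0)) %/ s4 vK 0 = num_eulerian_tours G.
  by rewrite e4 v2 K4 mulKn.
apply: wp_set => //=.
  apply: leq_ltn_trans (leq_div _ _) _.
  by have := sb4 vp 0; have := sb4 vn 0; clear; lia.
Qed.

Theorem theorem1 :
  poly_time_turing_reducible count_tours_eulerian count_tours_four_regular.
Proof.
pose d := depth reduction; pose e := effort 1 reduction.
(* The time is at most the effort [e * N ^ d] times the bit length [N], and [N] is at most 128 times
   the eighth power of the input length. *)
exists reduction, (e * 128 ^ d.+1), (8 * d.+1) => O OP G euG.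
have [t [s [ex tb _ os]]] := wp_reduction OP euG.
exists t, s; split=> //.
set w := encode_graph G in tb *.
have w0 : 0 < wordlen w.
  by apply: leq_trans (size_wordlen w); rewrite /w encode_graphE.
have Nw := round_bound_poly (size_wordlen w) w0.
set N := round_bound (size w) in tb Nw.
have N0 : 0 < N by rewrite muln_gt0 expn_gt0 addn2.
apply: leq_trans tb _; apply: leq_trans (leq_addr _ _).
apply: (@leq_trans (e * N ^ d * N)).
  by rewrite leq_mul2r effort_poly ?orbT.
rewrite -mulnA -expnSr -mulnA leq_mul2l expnM -expnMn; apply/orP; right.
by rewrite leq_exp2r.
Qed.
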